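(* Let $\mathfrak g_N=\mathfrak o_N$ or $\mathfrak g_N=\mathfrak{sp}_N$. The coefficients of the series $\mathbb T^+_m(u)$, where $m=1,\dots,N$ in the orthogonal case and $m=1,\dots,N/2$ in the symplectic case, generate a commutative subalgebra of the dual Yangian $\mathrm Y^+(\mathfrak g_N)$.
   Context: **Basic data.** $N\ge 2$; orthogonal case $\mathfrak g_N=\mathfrak o_N$, symplectic case $\mathfrak g_N=\mathfrak{sp}_N$ ($N$ even). $\varepsilon_1=\dots=\varepsilon_N=1$ in the orthogonal case; $\varepsilon_i=1$ for $i\le N/2$, $\varepsilon_i=-1$ for $i>N/2$ in the symplectic case; $i'=N-i+1$. For a matrix $A=(a_{ij})$ with entries in an algebra, $A'=(\varepsilon_i\varepsilon_ja_{j'i'})$. $\kappa=N/2-1$ (orthogonal), $\kappa=N/2+1$ (symplectic). $P=\sum e_{ij}\otimes e_{ji}$, $Q=\sum\varepsilon_i\varepsilon_je_{ij}\otimes e_{i'j'}$. $h$ is a formal parameter and $R(u)=1-\frac{hP}{u}+\frac{hQ}{u-h\kappa}$. Subscripts indicate copies of $\mathrm{End}\,\mathbb C^N$. Expressions $(u_1+\dots+u_k)^r$, $r<0$, are expanded in nonnegative powers of $u_2,\dots,u_k$ (and of $h$). **Dual Yangian.** $\mathrm Y^+(\mathfrak g_N)$ is the $h$-adically completed subalgebra of the double Yangian generated by the elements $t_{ij}^{(-r)}$ ($1\le i,j\le N$, $r\ge1$). Equivalently (Poincaré–Birkhoff–Witt theorem for the double Yangian), it is the quotient by the relation $T^+(u)T^+(u+h\kappa)'=1$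 of the $h$-adic completion of the associative $\mathbb C[[h]]$-algebra with generators $t_{ij}^{(-r)}$, $r\ge1$, and defining relations $$R(u-v)T^+_1(u)T^+_2(v)=T^+_2(v)T^+_1(u)R(u-v),$$ where $T^+(u)=\sum e_{ij}\otimes t^+_{ij}(u)$, $t^+_{ij}(u)=\delta_{ij}-h\sum_{r\ge1}t_{ij}^{(-r)}u^{r-1}$ (relations read on the generators after cancelling the common power of $h$). **The series $\mathbb T_m^+(u)$.** $S_{[m]}\in(\mathrm{End}\,\mathbb C^N)^{\otimes m}$ is the image of the idempotent $s^{(m)}$ of the Brauer algebra attached to the one-dimensional representation sending all transpositions $s_{ij}$ to $1$ and all $\varepsilon_{ij}$ to $0$, under the representation of $\mathcal B_m(N)$, $s_{ij}\mapsto P_{ij}$, $\varepsilon_{ij}\mapsto Q_{ij}$ (orthogonal), resp. of $\mathcal B_m(-N)$, $s_{ij}\mapsto -P_{ij}$, $\varepsilon_{ij}\mapsto -Q_{ij}$ (symplectic). Put $(\overline u_1,\dots,\overline u_m)=(u-(m-1)h,\dots,u-h,u)$ (orthogonal), $(u,u-h,\dots,u-(m-1)h)$ (symplectic). Explicitly $S_{[m]}=\frac1{m!}\prod_{1\le i<j\le m}R_{ij}(\overline u_i-\overline u_j)$, product in lexicographic order on $(i,j)$. Regarded as a series over $\mathrm Y^+(\mathfrak g_N)$ (via the identification of the vacuum module with $\mathrm Y^+(\mathfrak g_N)$, $x\mathbf 1\leftrightarrow x$), $$\mathbb T^+_m(u)=\mathrm{tr}_{1,\dots,m}\,S_{[m]}\,T_1^+(\overline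 u_1)\cdots T_m^+(\overline u_m)\in\mathrm Y^+(\mathfrak g_N)[[u]],$$ the trace being taken over all $m$ copies of $\mathrm{End}\,\mathbb C^N$. *)

(* Defs.v *)
From HB Require Import structures.
From mathcomp Require Import all_boot all_algebra.
From mathcomp Require Import boolp classical_sets.
From mathcomp.multinomials Require Import monalg.

Set Implicit Arguments.
Unset Strict Implicit.
Unset Printing Implicit Defensive.

Import GRing.Theory.
Local Open Scope ring_scope.
Local Open Scope quotient_scope.

Reserved Notation "{ 'fps' A }" (format "{ 'fps'  A }").

(* Formal power series in one central variable over a ring A that need not be
   commutative.  Several variables are obtained by iteration: in
   {fps {fps A}} the inner variable is always h, and the outer one is u or v. *)

Record fps (A : Type) := Fps { fcoef :> nat -> A }.
Notation "{ 'fps' A }" := (fps A) : type_scope.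

Lemma fpsP (A : Type) (f g : {fps A}) : f =1 g -> f = g.
Proof. by case: f g => [f] [g] /= /funext ->. Qed.

HB.instance Definition _ (A : Type) := [isNew for @fcoef A].
HB.instance Definition _ (A : choiceType) := [Choice of {fps A} by <:].

Section FpsZmod.
Variable A : zmodType.
Implicit Types f g : {fps A}.

Definition fps_zero : {fps A} := Fps (fun=> 0).
Definition fps_opp f : {fps A} := Fps (fun n => - f n).
Definition fps_add f g : {fps A} := Fps (fun n => f n + g n).

Fact fps_addA : associative fps_add.
Proof. by move=> f g k; apply: fpsP => n /=; rewrite addrA. Qed.
Fact fps_addC : commutative fps_add.
Proof. by move=> f g; apply: fpsP => n /=; rewrite addrC. Qed.
Fact fps_add0 : left_id fps_zero fps_add.
Proof. by move=> f; apply: fpsP => n /=; rewrite add0r. Qed.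
Fact fps_addN : left_inverse fps_zero fps_opp fps_add.
Proof. by move=> f; apply: fpsP => n /=; rewrite addNr. Qed.

HB.instance Definition _ :=
  GRing.isZmodule.Build {fps A} fps_addA fps_addC fps_add0 fps_addN.

Lemma fps0E n : (0 : {fps A}) n = 0. Proof. by []. Qed.
Lemma fpsNE f n : (- f) n = - f n. Proof. by []. Qed.
Lemma fpsDE f g n : (f + g) n = f n + g n. Proof. by []. Qed.

Definition fpsC (a : A) : {fps A} := Fps (fun n => if n == 0%N then a else 0).

End FpsZmod.

Section FpsRing.
Variable A : pzRingType.
Implicit Types f g k : {fps A}.

Definition fps_mul f g : {fps A} :=
  Fps (fun n => \sum_(i < n.+1) f i * g (n - i)%N).

Lemma fps_mul_rev f g n :
  fps_mul f g n = \sum_(i < n.+1) f (n - i)%N * g i.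
Proof.
rewrite /= (reindex_inj rev_ord_inj) /=.
by apply: eq_bigr => i _; rewrite subSS (sub_ordK i).
Qed.

Fact fps_mulA : associative fps_mul.
Proof.
move=> f g k; apply: fpsP => n; rewrite [RHS]fps_mul_rev /=.
pose c3 j l := f j * (g (n - j - l)%N * k l).
transitivity (\sum_(j < n.+1) \sum_(l < n.+1 | (l <= n - j)%N) c3 j l).
  apply: eq_bigr => j _.
  have /= -> := fps_mul_rev g k (n - j); rewrite big_distrr /=.
  by rewrite (big_ord_narrow_leq (leq_subr _ _)).
rewrite (exchange_big_dep predT) //=; apply: eq_bigr => l _.
transitivity (\sum_(j < n.+1 | (j <= n - l)%N) c3 j l).
  apply: eq_bigl => j; rewrite -ltnS -(ltnS j) -!subSn ?leq_ord //.
  by rewrite -subn_gt0 -(subn_gt0 j) -!subnDA addnC.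
rewrite (big_ord_narrow_leq (leq_subr _ _)) big_distrl /=.
by apply: eq_bigr => j _; rewrite /c3 -!subnDA addnC mulrA.
Qed.

Fact fps_mul1 : left_id (fpsC 1) fps_mul.
Proof.
move=> f; apply: fpsP => n /=; rewrite big_ord_recl subn0 mul1r.
by rewrite big1 ?addr0 // => i _; rewrite mul0r.
Qed.

Fact fps_mulr1 : right_id (fpsC 1) fps_mul.
Proof.
move=> f; apply: fpsP => n; rewrite fps_mul_rev big_ord_recl subn0 mulr1.
by rewrite big1 ?addr0 // => i _; rewrite mulr0.
Qed.

Fact fps_mulDl : left_distributive fps_mul +%R.
Proof.
move=> f g k; apply: fpsP => n; rewrite [RHS]fpsDE /= -big_split.
by apply: eq_bigr => i _; rewrite mulrDl.
Qed.

Fact fps_mulDr : right_distributive fps_mul +%R.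
Proof.
move=> f g k; apply: fpsP => n; rewrite [RHS]fpsDE /= -big_split.
by apply: eq_bigr => i _; rewrite mulrDr.
Qed.

HB.instance Definition _ := GRing.Zmodule_isPzRing.Build {fps A}
  fps_mulA fps_mul1 fps_mulr1 fps_mulDl fps_mulDr.

Lemma fps1E n : (1 : {fps A}) n = (n == 0%N)%:R.
Proof. by rewrite /= /fpsC /=; case: eqP. Qed.
Lemma fpsME f g n : (f * g) n = \sum_(i < n.+1) f i * g (n - i)%N.
Proof. by []. Qed.

Definition fpsX : {fps A} := Fps (fun n => (n == 1%N)%:R).

End FpsRing.

Definition fps_map (A B : Type) (phi : A -> B) (f : {fps A}) : {fps B} :=
  Fps (fun n => phi (f n)).

(* f(u + c h) for f(u) a series in u over A[[h]]: the coefficient of u^s is the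
   h-adically convergent sum of 'C(s + k, k) c^k h^k f_(s + k) over k >= 0. *)
Definition fps_shift (A : pzRingType) (c : A) (f : {fps {fps A}}) :
    {fps {fps A}} :=
  Fps (fun s => Fps (fun n =>
    \sum_(k < n.+1) c ^+ k * f (s + k)%N (n - k)%N *+ 'C(s + k, k))).

(* MathComp has quotients by ideals of commutative rings only. *)

HB.mixin Record isTwoSidedIdeal (R : pzRingType) (S : R -> bool) := {
  twosided_mull : forall a, {in S, forall x, a * x \in S};
  twosided_mulr : forall a, {in S, forall x, x * a \in S}
}.

#[short(type="twoSidedIdeal")]
HB.structure Definition TwoSidedIdeal (R : pzRingType) :=
  {S of isTwoSidedIdeal R S & GRing.ZmodClosed R S}.

Section TwoSidedQuotient.
Variables (R : pzRingType) (I : twoSidedIdeal R).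

Definition tsquot := Quotient.quot I.
HB.instance Definition _ := GRing.Zmodule.on tsquot.

Definition tsproj (x : R) : tsquot := \pi_(Quotient.quot I) x.

Lemma tsprojE x y : (tsproj x = tsproj y) <-> (x - y \in I).
Proof. by rewrite (Quotient.idealrBE I); split=> [/eqP|/eqP]. Qed.

Lemma tsproj_surj (y : tsquot) : exists x, y = tsproj x.
Proof. by exists (repr (y : Quotient.quot I)); rewrite /tsproj reprK. Qed.

Fact tsproj_is_zmod_morphism : zmod_morphism tsproj.
Proof. by move=> x y; rewrite /tsproj raddfB. Qed.

Definition tsmul (x y : tsquot) : tsquot :=
  tsproj (repr (x : Quotient.quot I) * repr (y : Quotient.quot I)).

Lemma tsprojM x y : tsproj (x * y) = tsmul (tsproj x) (tsproj y).
Proof.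
apply/tsprojE; set x' := repr _; set y' := repr _.
have Hx : x - x' \in I by apply/tsprojE; rewrite {2}/tsproj reprK.
have Hy : y - y' \in I by apply/tsprojE; rewrite {2}/tsproj reprK.
have -> : x * y - x' * y' = (x - x') * y + x' * (y - y').
  by rewrite mulrBl mulrBr addrA subrK.
apply: rpredD; first exact: twosided_mulr.
exact: twosided_mull.
Qed.

Fact tsmulA : associative tsmul.
Proof.
move=> x y z; have [x' ->] := tsproj_surj x; have [y' ->] := tsproj_surj y.
by have [z' ->] := tsproj_surj z; rewrite -!tsprojM mulrA.
Qed.
Fact tsmul1 : left_id (tsproj 1) tsmul.
Proof. by move=> x; have [x' ->] := tsproj_surj x; rewrite -tsprojM mul1r. Qed.
Fact tsmulr1 : right_id (tsproj 1) tsmul.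
Proof. by move=> x; have [x' ->] := tsproj_surj x; rewrite -tsprojM mulr1. Qed.
Fact tsprojD x y : tsproj (x + y) = tsproj x + tsproj y.
Proof. by rewrite /tsproj raddfD. Qed.
Fact tsmulDl : left_distributive tsmul +%R.
Proof.
move=> x y z; have [x' ->] := tsproj_surj x; have [y' ->] := tsproj_surj y.
have [z' ->] := tsproj_surj z.
by rewrite -tsprojD -!tsprojM -tsprojD mulrDl.
Qed.
Fact tsmulDr : right_distributive tsmul +%R.
Proof.
move=> x y z; have [x' ->] := tsproj_surj x; have [y' ->] := tsproj_surj y.
have [z' ->] := tsproj_surj z.
by rewrite -tsprojD -!tsprojM -tsprojD mulrDr.
Qed.

HB.instance Definition _ := GRing.Zmodule_isPzRing.Build tsquot
  tsmulA tsmul1 tsmulr1 tsmulDl tsmulDr.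

HB.instance Definition _ := GRing.isZmodMorphism.Build R tsquot tsproj
  tsproj_is_zmod_morphism.
Fact tsproj_is_monoid_morphism : monoid_morphism tsproj.
Proof. by split=> // x y; rewrite tsprojM. Qed.
HB.instance Definition _ := GRing.isMonoidMorphism.Build R tsquot tsproj
  tsproj_is_monoid_morphism.

End TwoSidedQuotient.

Variant bcd_type := Orthogonal | Symplectic.

(* (End C^N)^{(x) m} (x) A is the matrix ring over A whose rows and columns are
   indexed by the maps 'I_m -> 'I_N (multi-indices), enumerated by midx. *)
Section Tensor.
Variables (A : pzRingType) (g : bcd_type) (N m : nat).

Local Notation tensmx := 'M[A]_#|{ffun 'I_m -> 'I_N}|.

Definition midx (x : 'I_#|{ffun 'I_m -> 'I_N}|) : {ffun 'I_m -> 'I_N} :=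
  enum_val x.

Definition slot (a : 'I_m) (X : 'M[A]_N) : tensmx :=
  \matrix_(x, y)
    if [forall b, (b != a) ==> (midx x b == midx y b)]
    then X (midx x a) (midx y a) else 0.

Definition epsilon (i : 'I_N) : A :=
  match g with
  | Orthogonal => 1
  | Symplectic => if (i < N./2)%N then 1 else -1
  end.

(* Indices start from 0, so that i' = N - i + 1 becomes rev_ord i. *)
Definition primemx (X : 'M[A]_N) : 'M[A]_N :=
  \matrix_(i, j) (epsilon i * epsilon j * X (rev_ord j) (rev_ord i)).

Definition Pmx (a b : 'I_m) : tensmx :=
  \sum_(i < N) \sum_(j < N) slot a (delta_mx i j) *m slot b (delta_mx j i).

Definition Qmx (a b : 'I_m) : tensmx :=
  \sum_(i < N) \sum_(j < N) (epsilon i * epsilon j) *: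
    (slot a (delta_mx i j) *m slot b (delta_mx (rev_ord i) (rev_ord j))).

End Tensor.

Section DualYangian.
Variables (F : fieldType) (g : bcd_type) (N : nat).

Definition kappa : F :=
  match g with
  | Orthogonal => N%:R / 2%:R - 1
  | Symplectic => N%:R / 2%:R + 1
  end.

Definition freealg := {malg F[{fmonom ('I_N * 'I_N * nat)%type}]}.

(* Since the free C[[h]]-algebra is the free C-algebra tensored with C[[h]] over
   C, its h-adic completion is the power series ring over the free C-algebra. *)
Definition cfreealg := {fps freealg}.
HB.instance Definition _ := GRing.PzRing.on cfreealg.

(* tgen i j s is the generator t_ij^{(-r)} with r = s + 1. *)
Definition tgen (i j : 'I_N) (s : nat) : freealg := << fmu (i, j, s) >>.

Definition Tplus : 'M[{fps {fps freealg}}]_N :=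
  \matrix_(i, j) ((i == j)%:R
                  - Fps (fun s => fpsX freealg * fpsC (tgen i j s))).

Definition unitarity_mx : 'M[{fps {fps freealg}}]_N :=
  Tplus *m primemx g (map_mx (fps_shift kappa%:MP) Tplus) - 1%:M.

Local Notation mx2 B := 'M[B]_#|{ffun 'I_2 -> 'I_N}|.

(* R(u - v) is the sum over k >= 0 of Rcoef k u^{-k}, because 1/(u - v) and
   1/(u - v - h kappa) expand as the sums over c >= 0 of v^c u^{-c-1} and of
   (v + h kappa)^c u^{-c-1}.  Outer variable: v. *)
Definition Rcoef (k : nat) : mx2 {fps {fps freealg}} :=
  let h := fpsC (fpsX freealg) in
  let v := fpsX {fps freealg} in
  if k is c.+1 then
    - (h * v ^+ c) *: Pmx _ N ord0 ord_max
    + (h * (v + h * fpsC (fpsC kappa%:MP)) ^+ c) *: Qmx _ g N ord0 ord_max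
  else 1%:M.

Definition T1coef (p : int) : mx2 {fps {fps freealg}} :=
  if p is Posz s then map_mx (fun f => fpsC (fcoef f s)) (slot ord0 Tplus)
  else 0.

Definition T2 : mx2 {fps {fps freealg}} := slot ord_max Tplus.

(* The coefficient of u^p v^q in R(u-v) T_1(u) T_2(v) - T_2(v) T_1(u) R(u-v).
   All terms of Rcoef k have total degree k in (h, v), so that only k <= q + n
   contribute to the coefficient of v^q h^n. *)
Definition rtt_mx (p : int) (q : nat) : mx2 {fps freealg} :=
  \matrix_(x, y) Fps (fun n => \sum_(k < (q + n).+1)
    (Rcoef k *m T1coef (p + k%:Z) *m T2
     - T2 *m T1coef (p + k%:Z) *m Rcoef k) x y q n).

(* These coefficients are divisible by h and h^2 respectively, and r is unique
   because the completed free algebra has no h-torsion. *)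
Definition dy_relation : set cfreealg :=
  [set r | (exists i j s, fpsX freealg * r = unitarity_mx i j s) \/
           (exists p q x y, fpsX freealg ^+ 2 * r = rtt_mx p q x y)].

Definition closed_ideal (J : set cfreealg) : Prop :=
  [/\ GRing.zmod_closed [pred x | x \in J],
      forall a x, J x -> J (a * x) /\ J (x * a) &
      forall x : cfreealg,
        (forall n, exists2 y : cfreealg, J y & forall k, (k < n)%N -> x k = y k) ->
        J x].

Definition dy_ideal : {pred cfreealg} :=
  [pred x | x \in smallest closed_ideal dy_relation].

Lemma dy_idealP x :
  x \in dy_ideal <-> smallest closed_ideal dy_relation x.
Proof. by rewrite unfold_in /= in_setE. Qed.

Fact dy_ideal_zmod_closed : GRing.zmod_closed dy_ideal.
Proof.
split=> [|x y /dy_idealP Jx /dy_idealP Jy]; apply/dy_idealP => J JP.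
  by have [[[J0 _] _ _] _] := JP; move: J0; rewrite unfold_in /= in_setE.
have [[[_ JB] _ _] _] := JP; have := JB x y; rewrite !unfold_in /= !in_setE.
by apply; [apply: Jx | apply: Jy].
Qed.

Fact dy_ideal_mull a : {in dy_ideal, forall x, a * x \in dy_ideal}.
Proof.
move=> x /dy_idealP Jx; apply/dy_idealP => J JP.
by have [[_ /(_ a x (Jx J JP)) []]] := JP.
Qed.

Fact dy_ideal_mulr a : {in dy_ideal, forall x, x * a \in dy_ideal}.
Proof.
move=> x /dy_idealP Jx; apply/dy_idealP => J JP.
by have [[_ /(_ a x (Jx J JP)) []]] := JP.
Qed.

HB.instance Definition _ :=
  GRing.isZmodClosed.Build cfreealg dy_ideal dy_ideal_zmod_closed.
HB.instance Definition _ :=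
  isTwoSidedIdeal.Build cfreealg dy_ideal dy_ideal_mull dy_ideal_mulr.

(* Y^+ is h-adically complete and separated, hence the closure
   of the ideal of relations in the h-adic topology. *)
Definition dualYangian := tsquot dy_ideal.
HB.instance Definition _ := GRing.PzRing.on dualYangian.

Definition dy_proj : cfreealg -> dualYangian := tsproj dy_ideal.

(* The structure map of the C[[h]]-algebra Y^+. *)
Definition dy_scalar (c : {fps F}) : dualYangian :=
  dy_proj (fps_map (fun a : F => a%:MP) c).

Definition gen_subalgebra (G : set dualYangian) : set dualYangian :=
  smallest (fun S => GRing.subring_closed [pred x | x \in S] /\
                     forall c, S (dy_scalar c)) G.

Section TransferSeries.
Variable m : nat.

(* The m-tuple of spectral parameters is u_a = u + (ubar a) h. *)
Definition ubar (a : 'I_m) : F :=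
  match g with
  | Orthogonal => - (m.-1 - a)%N%:R
  | Symplectic => - a%:R
  end.

(* R_ab(u_a - u_b), in which h cancels. *)
Definition Rubar (a b : 'I_m) : 'M[F]_#|{ffun 'I_m -> 'I_N}| :=
  let d := ubar a - ubar b in
  1%:M - d^-1 *: Pmx F N a b + (d - kappa)^-1 *: Qmx F g N a b.

Definition Smx : 'M[F]_#|{ffun 'I_m -> 'I_N}| :=
  (m`!%:R)^-1 *: \prod_(a < m) \prod_(b < m | (a < b)%N) Rubar a b.

Definition Tplus_at (c : F) : 'M[{fps dualYangian}]_N :=
  map_mx (fun f => fps_map dy_proj (fps_shift c%:MP f)) Tplus.

Definition TTplus : {fps dualYangian} :=
  \tr (map_mx (fun c => fpsC (dy_scalar (fpsC c))) Smx
       *m \prod_(a < m) slot a (Tplus_at (ubar a))).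

End TransferSeries.

Definition TTcoefs : set dualYangian :=
  [set y | exists m s,
     (1 <= m <= match g with Orthogonal => N | Symplectic => N./2 end)%N
     /\ y = TTplus m s].

End DualYangian.

Arguments TTcoefs F g N : clear implicits.

(* Main.v *)
(* Write R(x) for x (x - h kappa) times the R-matrix, so that R is polynomial,
   and let S_m be the ordered product of the R-matrices at the parameters
   ubar, so that TT_m(u) is proportional to tr S_m T_1 ... T_m.
   Consider m + n tensor factors, the first m carrying T(u + ubar_a h) and the
   last n carrying T(v + ubar_b h).  The RTT relations and the Yang-Baxter
   equation give, for the ordered product K of all R-matrices between the two
   groups and S = S_m S_n,
     K (T_1 ... T_m) (T'_1 ... T'_n) = (T'_1 ... T'_n) (T_1 ... T_m) K
   and S K = L S with L the reordered product.  At the given parameters S_m is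
   proportional to an idempotent: neighbouring factors R_{a,a+1} absorb P up to
   a sign and annihilate Q.  Since R(x) R(-x) is a scalar, K is invertible up to
   a scalar, and cyclicity of the trace yields
     tr S (T_1 ... T_m) (T'_1 ... T'_n) = tr S (T'_1 ... T'_n) (T_1 ... T_m),
   that is, TT_m(u) TT_n(v) = TT_n(v) TT_m(u).
   The scalar is a product of factors u - v + a h.  The algebra Y^+ is not shown
   to be free of h-torsion, but it is h-adically separated, and this suffices
   for u - v + a h to be a nonzerodivisor on Y^+[[u, v]]. *)

From HB Require Import structures.
Require Import Defs.
From mathcomp Require Import all_boot all_order all_algebra.
From mathcomp Require Import boolp classical_sets reals complex.
From mathcomp.multinomials Require Import monalg.
From mathcomp Require Import ring zify.

Set Implicit Arguments.
Unset Strict Implicit.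
Unset Printing Implicit Defensive.

Import Order.TTheory GRing.Theory Num.Theory.
Local Open Scope ring_scope.

(** * Formal power series *)

(** Between the two groups [u] and [v] stay independent, and only nonzero constants and factors u -
    v + a h are cancelled. Inside one group the parameters differ by multiples of [h], so clearing
    the denominators of an R-matrix brings in h^2. The substitution v = u is therefore carried out
    in the completed free algebra: the generators of the ideal are RTT coefficients already divided
    by h^2, so both sides of the substituted relation carry h^2 explicitly, and it is removed before
    projecting. A shift u -> u + c h is an infinite sum, and h-adic closedness of the ideal keeps
    its values in the ideal. The trace argument cannot just cycle K around, because S K = L S with L
    different from K. What saves it is that S^2 is a multiple of S and that S passes through the
    reordered T's, so that a second copy of S can be inserted and cycled to the other side of K. *)

Fact fps_mulC (C : comPzRingType) : commutative (@fps_mul C).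
Proof.
move=> f g; apply: fpsP => n; rewrite fps_mul_rev /=.
by apply: eq_bigr => i _; rewrite mulrC.
Qed.

HB.instance Definition _ (C : comPzRingType) :=
  GRing.PzRing_hasCommutativeMul.Build {fps C} (@fps_mulC C).

Section FpsAdditive.
Variables (A : zmodType).

Definition coef_at n (f : {fps A}) : A := f n.
Fact coef_at_is_zmod_morphism n : zmod_morphism (coef_at n).
Proof. by []. Qed.
HB.instance Definition _ n := GRing.isZmodMorphism.Build {fps A} A
  (coef_at n) (coef_at_is_zmod_morphism n).

Lemma fps_sumE (I : Type) (r : seq I) (P : pred I) (F : I -> {fps A}) n :
  (\sum_(i <- r | P i) F i) n = \sum_(i <- r | P i) F i n.
Proof. exact: (raddf_sum (coef_at n)). Qed.

Lemma fpsMnE (f : {fps A}) k n : (f *+ k) n = f n *+ k.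
Proof. exact: (raddfMn (coef_at n)). Qed.

Lemma fpsBE (f g : {fps A}) n : (f - g) n = f n - g n.
Proof. by []. Qed.

Lemma fpsCE (a : A) n : fpsC a n = if n == 0%N then a else 0.
Proof. by []. Qed.

End FpsAdditive.

Section FpsMorphisms.
Variables (A B : pzRingType).

Lemma fpsC_mulE (a : A) (f : {fps A}) n : (fpsC a * f) n = a * f n.
Proof.
rewrite fpsME big_ord_recl subn0 big1 ?addr0 // => i _.
by rewrite fpsCE mul0r.
Qed.

Lemma mul_fpsCE (a : A) (f : {fps A}) n : (f * fpsC a) n = f n * a.
Proof.
rewrite [LHS](fps_mul_rev f) big_ord_recl subn0 big1 ?addr0 // => i _.
by rewrite fpsCE mulr0.
Qed.

Fact fpsC_is_zmod_morphism : zmod_morphism (@fpsC A).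
Proof.
by move=> a b; apply: fpsP => n; rewrite fpsBE !fpsCE; case: eqP; rewrite ?subr0.
Qed.
Fact fpsC_is_monoid_morphism : monoid_morphism (@fpsC A).
Proof.
by split=> // a b; apply: fpsP => n; rewrite fpsC_mulE !fpsCE; case: eqP; rewrite ?mulr0.
Qed.
HB.instance Definition _ := GRing.isZmodMorphism.Build A {fps A} (@fpsC A)
  fpsC_is_zmod_morphism.
HB.instance Definition _ := GRing.isMonoidMorphism.Build A {fps A} (@fpsC A)
  fpsC_is_monoid_morphism.

Lemma fpsX_mulE (f : {fps A}) n :
  (fpsX A * f) n = if n is n'.+1 then f n' else 0.
Proof.
rewrite fpsME; case: n => [|n]; first by rewrite big_ord1 mul0r.
rewrite 2!big_ord_recl /= mul0r add0r mul1r subSS subn0 big1 ?addr0 // => i _.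
by rewrite mul0r.
Qed.

Lemma fpsX_comm (f : {fps A}) : fpsX A * f = f * fpsX A.
Proof.
apply: fpsP => n; rewrite fpsX_mulE [RHS](fps_mul_rev f).
case: n => [|n]; first by rewrite big_ord1 mulr0.
rewrite 2!big_ord_recl /= mulr0 add0r mulr1 subSS subn0 big1 ?addr0 // => i _.
by rewrite mulr0.
Qed.

Lemma fpsX_inj (f g : {fps A}) : fpsX A * f = fpsX A * g -> f = g.
Proof.
move=> fg; apply: fpsP => n; have := congr1 (fun k : {fps A} => k n.+1) fg.
by rewrite !fpsX_mulE.
Qed.

Variable phi : {rmorphism A -> B}.

Fact fps_map_is_zmod_morphism : zmod_morphism (fps_map phi).
Proof. by move=> f g; apply: fpsP => n /=; rewrite raddfB. Qed.
Fact fps_map_is_monoid_morphism : monoid_morphism (fps_map phi).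
Proof.
split=> [|f g]; apply: fpsP => n /=; first by case: eqP; rewrite ?rmorph1 ?rmorph0.
by rewrite rmorph_sum; apply: eq_bigr => i _; rewrite rmorphM.
Qed.
HB.instance Definition _ := GRing.isZmodMorphism.Build {fps A} {fps B}
  (fps_map phi) fps_map_is_zmod_morphism.
HB.instance Definition _ := GRing.isMonoidMorphism.Build {fps A} {fps B}
  (fps_map phi) fps_map_is_monoid_morphism.

Lemma fps_mapC a : fps_map phi (fpsC a) = fpsC (phi a).
Proof. by apply: fpsP => n /=; case: eqP; rewrite ?rmorph0. Qed.

Lemma fps_mapX : fps_map phi (fpsX A) = fpsX B.
Proof. by apply: fpsP => n /=; rewrite rmorph_nat. Qed.

End FpsMorphisms.

Lemma fpsC_central (A : pzRingType) (a : A) :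
  (forall x, a * x = x * a) -> forall f, fpsC a * f = f * fpsC a.
Proof. by move=> ca f; apply: fpsP => n; rewrite fpsC_mulE mul_fpsCE. Qed.

Lemma fps_map_central (A B : pzRingType) (phi : {rmorphism A -> B}) :
  (forall a x, phi a * x = x * phi a) ->
  forall f g, fps_map phi f * g = g * fps_map phi f.
Proof.
move=> cphi f g; apply: fpsP => n; rewrite [RHS](fps_mul_rev g) fpsME.
by apply: eq_bigr => i _; rewrite cphi.
Qed.

(* The weight of the monomial v^q h^n is al q + n: al = 0 gives the h-adic
   filtration, al = 1 the filtration by total degree. *)
Section Weight.
Variables (A : pzRingType) (al : nat).
Implicit Types f g : {fps {fps A}}.

Definition wt_ge k f := forall q n, (al * q + n < k)%N -> f q n = 0.

Lemma wt_geD k f g : wt_ge k f -> wt_ge k g -> wt_ge k (f + g).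
Proof. by move=> Hf Hg q n lt; rewrite !fpsDE Hf ?Hg ?addr0. Qed.

Lemma wt_geN k f : wt_ge k f -> wt_ge k (- f).
Proof. by move=> Hf q n lt; rewrite !fpsNE Hf ?oppr0. Qed.

Lemma wt_geB k f g : wt_ge k f -> wt_ge k g -> wt_ge k (f - g).
Proof. by move=> Hf Hg; apply: wt_geD => //; apply: wt_geN. Qed.

Lemma wt_ge_any f : wt_ge 0 f.
Proof. by []. Qed.

Lemma wt_ge_sum k (I : Type) (r : seq I) (P : pred I) (F : I -> {fps {fps A}}) :
  (forall i, P i -> wt_ge k (F i)) -> wt_ge k (\sum_(i <- r | P i) F i).
Proof.
by move=> HF; elim/big_ind: _ => //; apply: wt_geD.
Qed.

Lemma wt_geM k l f g : wt_ge k f -> wt_ge l g -> wt_ge (k + l) (f * g).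
Proof.
move=> Hf Hg q n lt; rewrite fpsME fps_sumE big1 // => i _.
rewrite fpsME big1 // => j _.
have [lt1|ge1] := ltnP (al * i + j) k; first by rewrite Hf ?mul0r.
rewrite Hg ?mulr0 //.
have le_i := leq_ord i; have le_j := leq_ord j.
have e : (al * q = al * i + al * (q - i))%N by rewrite -mulnDr subnKC.
lia.
Qed.

Lemma wt_geMl k f g : wt_ge k g -> wt_ge k (f * g).
Proof. by move=> Hg; rewrite -[k]add0n; apply: wt_geM. Qed.

Lemma wt_geMr k f g : wt_ge k f -> wt_ge k (f * g).
Proof. by move=> Hf; rewrite -[k]addn0; apply: wt_geM. Qed.

Lemma wt_geX k f j : wt_ge k f -> wt_ge (j * k) (f ^+ j).
Proof.
move=> Hf; elim: j => [|j IH]; first by rewrite mul0n; apply: wt_ge_any.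
by rewrite exprS mulSn; apply: wt_geM.
Qed.

Lemma wt_geW k l f : (k <= l)%N -> wt_ge l f -> wt_ge k f.
Proof. by move=> le Hf q n lt; apply: Hf; apply: leq_trans le. Qed.

Lemma wt_ge_h : wt_ge 1 (fpsC (fpsX A)).
Proof.
move=> q n; rewrite fpsCE; case: eqP => // _.
by case: n => // n; lia.
Qed.

Lemma wt_ge_v : al = 1%N -> wt_ge 1 (fpsX {fps A}).
Proof.
by move=> al1 q n; rewrite al1; case: q => [|q] //; rewrite mul1n.
Qed.

Lemma wt_ge_inf f : (forall k, wt_ge k f) -> f = 0.
Proof.
move=> Hf; apply: fpsP => q; apply: fpsP => n.
by rewrite (Hf (al * q + n).+1).
Qed.

End Weight.

(** * Shifting a variable by a multiple of h *)

Section Shift.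
Variables (A : pzRingType) (c : A).
Hypothesis c_central : forall x, c * x = x * c.
Implicit Types f g : {fps {fps A}}.
Local Notation h := (fpsX A).
Local Notation ch := (fpsC c * h).
Local Notation sh := (fps_shift c).

Lemma ch_comm (x : {fps A}) : ch * x = x * ch.
Proof. by rewrite -mulrA fpsX_comm mulrA (fpsC_central c_central) mulrA. Qed.

Lemma ch_exp_comm k (x : {fps A}) : ch ^+ k * x = x * ch ^+ k.
Proof. by apply/commr_sym/commrX/commr_sym/ch_comm. Qed.

Lemma ch_expE k (x : {fps A}) n :
  (ch ^+ k * x) n = if (k <= n)%N then c ^+ k * x (n - k)%N else 0.
Proof.
elim: k n => [|k IH] n; first by rewrite !expr0 !mul1r subn0.
rewrite exprS -!mulrA fpsC_mulE fpsX_mulE.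
case: n => [|n]; first by rewrite ltn0 mulr0.
rewrite IH ltnS subSS; case: ifP => _; last by rewrite mulr0.
by rewrite exprS mulrA.
Qed.

(** The h-adic sum behind [fps_shift], cut off after K terms. It is exact modulo h^K, so identities
    between infinite sums are checked on finite ones. *)
Definition shK K f s : {fps A} := \sum_(k < K) ch ^+ k * f (s + k)%N *+ 'C(s + k, k).

Lemma fps_shiftE K f s n : (n < K)%N -> sh f s n = shK K f s n.
Proof.
move=> lt; rewrite /shK fps_sumE /=.
rewrite (big_ord_widen K (fun k => c ^+ k * f (s + k)%N (n - k)%N *+ 'C(s + k, k))) //.
rewrite big_mkcond /=; apply: eq_bigr => k _.
by rewrite fpsMnE ch_expE ltnS; case: ifP => //; rewrite mul0rn.
Qed.

Fact fps_shift_is_zmod_morphism : zmod_morphism sh.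
Proof.
move=> f g; apply: fpsP => s; apply: fpsP => n; rewrite !fpsBE /=.
rewrite -sumrB; apply: eq_bigr => k _.
by rewrite mulrBr mulrnBl.
Qed.
HB.instance Definition _ := GRing.isZmodMorphism.Build {fps {fps A}} {fps {fps A}}
  (fps_shift c) fps_shift_is_zmod_morphism.

Lemma fps_mul_cong K (x x' y y' : {fps A}) :
  (forall i, (i < K)%N -> x i = x' i) -> (forall i, (i < K)%N -> y i = y' i) ->
  forall i, (i < K)%N -> (x * y) i = (x' * y') i.
Proof.
move=> Hx Hy i lt; rewrite !fpsME; apply: eq_bigr => j _.
by rewrite Hx ?Hy //; have := leq_ord j; lia.
Qed.

Lemma fps_shift_mulC f (x : {fps A}) : sh (f * fpsC x) = sh f * fpsC x.
Proof.
apply: fpsP => s; apply: fpsP => n.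
rewrite (@fps_shiftE n.+1) // mul_fpsCE.
rewrite (@fps_mul_cong n.+1 _ (shK n.+1 f s) x x) //; last by move=> i; apply: fps_shiftE.
congr fcoef; rewrite /shK mulr_suml; apply: eq_bigr => k _.
by rewrite mul_fpsCE mulrA mulrnAl.
Qed.

Lemma fps_shift_Cmul f (x : {fps A}) : sh (fpsC x * f) = fpsC x * sh f.
Proof.
apply: fpsP => s; apply: fpsP => n.
rewrite (@fps_shiftE n.+1) // fpsC_mulE.
rewrite (@fps_mul_cong n.+1 x x _ (shK n.+1 f s)) //; last by move=> i; apply: fps_shiftE.
congr fcoef; rewrite /shK mulr_sumr; apply: eq_bigr => k _.
by rewrite fpsC_mulE mulrA ch_exp_comm -mulrA mulrnAr.
Qed.

(** Pascal's rule: [binS] splits each binomial coefficient into the contribution of the variable and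
    that of c h. *)
Lemma fps_shiftX f : sh (fpsX {fps A} * f) = (fpsX {fps A} + fpsC ch) * sh f.
Proof.
(* One term more than order n requires: once the first term is split off, as many remain as in
   [ch * shK n.+1]. *)
apply: fpsP => s; apply: fpsP => n; rewrite (@fps_shiftE n.+2) //.
rewrite mulrDl fpsDE fpsX_mulE fpsC_mulE.
rewrite (@fps_mul_cong n.+1 ch ch _ (shK n.+1 f s)) //; last by move=> i; apply: fps_shiftE.
have e1 : (ch * shK n.+1 f s) = \sum_(k < n.+1) ch ^+ k.+1 * f (s + k)%N *+ 'C(s + k, k).
  by rewrite mulr_sumr; apply: eq_bigr => k _; rewrite -mulrnAr mulrA exprS mulrnAr.
rewrite e1 {e1}; case: s => [|s].
  rewrite add0r /shK big_ord_recl addn0 fpsX_mulE mulr0 mul0rn add0r.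
  congr fcoef; apply: eq_bigr => k _.
  by rewrite add0n lift0 fpsX_mulE !binn.
rewrite (@fps_shiftE n.+2) //.
rewrite -fpsDE; congr fcoef; rewrite /shK big_ord_recl [in RHS]big_ord_recl !bin0 -addrA.
congr (_ + _); first by rewrite !addn0 fpsX_mulE.
rewrite -big_split; apply: eq_bigr => k _; rewrite lift0 addSn fpsX_mulE.
by rewrite addnS addSn binS mulrnDr.
Qed.

End Shift.

(** * Tensor factors *)

Section Slots.
Variables (A : pzRingType) (N m : nat).
Local Notation K := #|{ffun 'I_m -> 'I_N}|.
Local Notation slot := (@slot A N m).
Implicit Types (x y z : 'I_K) (a b c : 'I_m) (X Y : 'M[A]_N).

Definition agree (D : pred 'I_m) x y := [forall b, ~~ D b ==> (midx x b == midx y b)].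

Lemma agreeP D x y : reflect (forall b, ~~ D b -> midx x b = midx y b) (agree D x y).
Proof.
apply: (iffP forallP) => H b; first by move=> Db; have := H b; rewrite Db => /eqP.
by apply/implyP => /H ->.
Qed.

Lemma agree_refl D x : agree D x x.
Proof. exact/agreeP. Qed.

Lemma agree_sym D x y : agree D x y = agree D y x.
Proof. by apply/agreeP/agreeP => H b /H. Qed.

Lemma agree_trans D x y z : agree D x y -> agree D y z -> agree D x z.
Proof. by move=> /agreeP H1 /agreeP H2; apply/agreeP => b Db; rewrite H1 // H2. Qed.

Lemma midx_inj : injective (@midx N m).
Proof. exact: enum_val_inj. Qed.

Lemma midx_rank (w : {ffun 'I_m -> 'I_N}) : midx (enum_rank w) = w.
Proof. exact: enum_rankK. Qed.

Lemma slotE a X x y :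
  slot a X x y = if agree (pred1 a) x y then X (midx x a) (midx y a) else 0.
Proof. by rewrite mxE. Qed.

Lemma sum_only (I : finType) (V : nmodType) (i0 : I) (F : I -> V) :
  (forall i, i != i0 -> F i = 0) -> \sum_i F i = F i0.
Proof. by move=> F0; rewrite (bigD1 i0) //= big1 ?addr0. Qed.

Lemma slot_sum a x (G : 'I_N -> A) :
  \sum_(z | agree (pred1 a) x z) G (midx z a) = \sum_i G i.
Proof.
pose h i := enum_rank [ffun b => if b == a then i else midx x b].
rewrite (reindex_onto h (fun z => midx z a)); last first.
  move=> z /agreeP H; apply: midx_inj; apply/ffunP => b.
  by rewrite midx_rank ffunE; case: eqP => [->//|/eqP ne]; rewrite H.
apply: eq_big => [i|i _]; last by rewrite midx_rank ffunE eqxx.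
rewrite midx_rank ffunE !eqxx andbT; apply/agreeP => b /= ne.
by rewrite midx_rank ffunE (negPf ne).
Qed.

Lemma slotM a X Y : slot a (X *m Y) = slot a X * slot a Y.
Proof.
apply/matrixP => x y; rewrite slotE [RHS]mxE.
case: ifPn => [axy|naxy]; last first.
  rewrite big1 // => z _; rewrite !slotE.
  case: ifPn => [axz|]; last by rewrite mul0r.
  case: ifPn => [azy|]; last by rewrite mulr0.
  by case/negP: naxy; apply: agree_trans azy.
rewrite mxE -(slot_sum a x (fun i => X (midx x a) i * Y i (midx y a))).
rewrite big_mkcond; apply: eq_bigr => z _; rewrite !slotE.
case: ifPn => axz; last by rewrite mul0r.
by rewrite (agree_trans _ axy) // agree_sym.
Qed.

Lemma slot1 a : slot a 1%:M = 1.
Proof.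
apply/matrixP => x y; rewrite slotE !mxE.
have [<-|ne] := eqVneq x y; first by rewrite agree_refl eqxx.
case: agreeP => // H; case: eqP => // e; case/eqP: ne.
apply: midx_inj; apply/ffunP => b; have [->//|ne] := eqVneq b a.
exact: H.
Qed.

Fact slot_is_zmod_morphism a : zmod_morphism (slot a).
Proof.
by move=> X Y; apply/matrixP => x y; rewrite !mxE; case: ifP; rewrite ?subr0.
Qed.
HB.instance Definition _ a := GRing.isZmodMorphism.Build _ _ (slot a)
  (slot_is_zmod_morphism a).

(** A single intermediate multi-index contributes to the matrix product: y at the factor a and x
    elsewhere. *)
Lemma slot_mulE a b X Y x y : a != b -> (slot a X * slot b Y) x y =
  if agree (pred2 a b) x y then X (midx x a) (midx y a) * Y (midx x b) (midx y b) else 0.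
Proof.
move=> ne_ab; rewrite mxE.
pose z0 : 'I_K := enum_rank [ffun c => if c == a then midx y a else midx x c].
have z0E c : midx z0 c = if c == a then midx y a else midx x c.
  by rewrite midx_rank ffunE.
rewrite (@sum_only _ _ z0) => [|z ne].
  rewrite !slotE; have -> : agree (pred1 a) x z0.
    by apply/agreeP => c /negPf /= ne; rewrite z0E ne.
  have -> : agree (pred1 b) z0 y = agree (pred2 a b) x y.
    apply/agreeP/agreeP => H c; rewrite ?inE /=.
      by rewrite negb_or => /andP[na nb]; have := H c nb; rewrite z0E (negPf na).
    move=> nb; rewrite z0E; case: eqP => [->//|/eqP na].
    by apply: H; rewrite /= negb_or na.
  case: ifP; rewrite ?mulr0 //.
  by rewrite !z0E eqxx eq_sym (negPf ne_ab).
rewrite !slotE; case: agreeP => [H1|]; rewrite ?mul0r //.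
case: agreeP => [H2|]; rewrite ?mulr0 //; case/eqP: ne.
apply: midx_inj; apply/ffunP => c; rewrite z0E.
by case: eqP => [->|/eqP ne]; [apply: H2 | rewrite H1].
Qed.

(** Acting on different factors is not enough over a noncommutative ring, hence the condition on the
    entries; it fails for two T-matrices. *)
Lemma slot_comm a b X Y : a != b ->
  (forall i j k l, X i j * Y k l = Y k l * X i j) ->
  slot a X * slot b Y = slot b Y * slot a X.
Proof.
move=> ne C; apply/matrixP => x y; rewrite !slot_mulE // 1?eq_sym // C.
by rewrite (_ : agree (pred2 b a) x y = agree (pred2 a b) x y) //;
   apply/agreeP/agreeP => H c Hc; apply: H; rewrite /= orbC.
Qed.

End Slots.

Section Embedding.
Variables (A : pzRingType) (N k m : nat) (f : 'I_k -> 'I_m).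
Hypothesis f_inj : injective f.
Local Notation Kk := #|{ffun 'I_k -> 'I_N}|.
Local Notation K := #|{ffun 'I_m -> 'I_N}|.

Definition res (x : 'I_K) : 'I_Kk := enum_rank [ffun i => midx x (f i)].

(* emb X is X acting on the tensor factors f i, and the identity on the others. *)
Definition emb (X : 'M[A]_Kk) : 'M[A]_K :=
  \matrix_(x, y) if agree (mem (codom f)) x y then X (res x) (res y) else 0.

Lemma emb_sum (x : 'I_K) (G : 'I_Kk -> A) :
  \sum_(z | agree (mem (codom f)) x z) G (res z) = \sum_w G w.
Proof.
pose h (w : 'I_Kk) : 'I_K := enum_rank
  [ffun b => if [pick i | f i == b] is Some i then midx w i else midx x b].
have hE w i : midx (h w) (f i) = midx w i.
  rewrite midx_rank ffunE; case: pickP => [j /eqP /f_inj -> //|/(_ i)].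
  by rewrite eqxx.
rewrite (reindex_onto h res); last first.
  move=> z /agreeP H; apply: midx_inj; apply/ffunP => b.
  rewrite midx_rank ffunE; case: pickP => [j /eqP <-|nb].
    by rewrite midx_rank ffunE.
  by apply: H => /=; apply/codomP => -[i e]; have := nb i; rewrite e eqxx.
have resh w : res (h w) = w.
  by apply: midx_inj; apply/ffunP => i; rewrite midx_rank ffunE hE.
apply: eq_big => [w|w _]; last by rewrite resh.
rewrite resh eqxx andbT; apply/agreeP => b nb; rewrite midx_rank ffunE.
case: pickP => // j /eqP e; case/negP: nb => /=; rewrite -e; exact: codom_f.
Qed.

Lemma embM X Y : emb (X * Y) = emb X * emb Y.
Proof.
apply/matrixP => x y; rewrite mxE [RHS]mxE.
case: ifPn => [axy|naxy]; last first.
  rewrite big1 // => z _; rewrite !mxE.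
  case: ifPn => [axz|]; last by rewrite mul0r.
  case: ifPn => [azy|]; last by rewrite mulr0.
  by case/negP: naxy; apply: agree_trans azy.
rewrite mxE -(emb_sum x (fun i => X (res x) i * Y i (res y))).
rewrite big_mkcond; apply: eq_bigr => z _; rewrite !mxE.
case: ifPn => axz; last by rewrite mul0r.
by rewrite (agree_trans _ axy) // agree_sym.
Qed.

Lemma emb1 : emb 1 = 1.
Proof.
apply/matrixP => x y; rewrite !mxE.
have [<-|ne] := eqVneq x y; first by rewrite agree_refl eqxx.
case: agreeP => // H; case: eqP => // e; case/eqP: ne.
apply: midx_inj; apply/ffunP => b; have [/codomP[i ->]|nb] := boolP (b \in codom f).
  by have := congr1 (fun w => midx w i) e; rewrite !midx_rank !ffunE.
exact: H.
Qed.

Fact emb_is_zmod_morphism : zmod_morphism emb.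
Proof.
by move=> X Y; apply/matrixP => x y; rewrite !mxE; case: ifP; rewrite ?subr0.
Qed.
HB.instance Definition _ := GRing.isZmodMorphism.Build _ _ emb
  emb_is_zmod_morphism.

Lemma embZ (r : A) X : emb (r *: X) = r *: emb X.
Proof.
by apply/matrixP => x y; rewrite !mxE; case: ifP; rewrite ?mulr0.
Qed.

Lemma emb_slot a (X : 'M[A]_N) : emb (slot a X) = slot (f a) X.
Proof.
apply/matrixP => x y; rewrite slotE mxE slotE !midx_rank !ffunE.
have -> : agree (pred1 (f a)) x y =
    agree (mem (codom f)) x y && agree (pred1 a) (res x) (res y).
  apply/agreeP/andP => [H|[/agreeP H1 /agreeP H2] b nb].
    split; apply/agreeP => b nb.
      apply: H => /=; apply: contraNneq nb => -> /=; exact: codom_f.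
    rewrite !midx_rank !ffunE H //=; apply: contraNneq nb => /f_inj -> /=; exact: eqxx.
  have [/codomP[i e]|nb'] := boolP (b \in codom f); last exact: H1.
  rewrite e in nb *; have := H2 i; rewrite !midx_rank !ffunE; apply.
  by apply: contraNneq nb => /= ->.
by case: (agree _ x y); case: (agree _ _ _).
Qed.

End Embedding.

Lemma emb_map (A B : pzRingType) (phi : {rmorphism A -> B}) N k m (f : 'I_k -> 'I_m)
    (X : 'M[A]_#|{ffun 'I_k -> 'I_N}|) :
  emb f (map_mx phi X) = map_mx phi (emb f X).
Proof.
by apply/matrixP => x y; rewrite !mxE; case: ifP; rewrite ?rmorph0.
Qed.

Lemma slot_map (A B : pzRingType) (phi : A -> B) N m (a : 'I_m) (X : 'M[A]_N) :
  phi 0 = 0 -> slot a (map_mx phi X) = map_mx phi (slot a X).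
Proof.
by move=> phi0; apply/matrixP => x y; rewrite !mxE; case: ifP.
Qed.

Section TensorTrace.
Variables (A : pzRingType) (N m n l : nat) (f : 'I_m -> 'I_l) (g : 'I_n -> 'I_l).
Variable s : 'I_l -> 'I_m + 'I_n.
Hypotheses (sf : forall i, s (f i) = inl i) (sg : forall j, s (g j) = inr j).
Hypothesis sK : forall c, match s c with inl i => f i | inr j => g j end = c.

(** The map [s] sorts the factors into the images of [f] and [g], and a multi-index becomes a pair
    of multi-indices. The order of X and Y is kept, since their entries need not commute. *)
Lemma tr_emb_emb (X : 'M[A]_#|{ffun 'I_m -> 'I_N}|) (Y : 'M[A]_#|{ffun 'I_n -> 'I_N}|) :
  \tr (emb f X * emb g Y) = \tr X * \tr Y.
Proof.
pose G x := X (res f x) (res f x) * Y (res g x) (res g x).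
transitivity (\sum_x G x).
  apply: eq_bigr => x _; rewrite mxE (@sum_only _ _ x) => [|z ne].
    by rewrite !mxE !agree_refl.
  rewrite !mxE; case: agreeP => [H1|]; rewrite ?mul0r //.
  case: agreeP => [H2|]; rewrite ?mulr0 //; case/eqP: ne.
  apply: midx_inj; apply/ffunP => c; have := sK c.
  case e: (s c) => [j|j] ej.
    by apply: H2 => /=; apply/codomP => -[i ei]; rewrite ei sg in e.
  by rewrite H1 //=; apply/codomP => -[i ei]; rewrite ei sf in e.
rewrite /mxtrace mulr_suml; under [RHS]eq_bigr do rewrite mulr_sumr.
rewrite pair_big /=.
pose join (p : 'I_#|{ffun 'I_m -> 'I_N}| * 'I_#|{ffun 'I_n -> 'I_N}|) :
  'I_#|{ffun 'I_l -> 'I_N}| := enum_rank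
  [ffun c => match s c with inl a => midx p.1 a | inr b => midx p.2 b end].
have rl p : res f (join p) = p.1.
  by apply: midx_inj; apply/ffunP => a; rewrite midx_rank ffunE midx_rank ffunE sf.
have rr p : res g (join p) = p.2.
  by apply: midx_inj; apply/ffunP => a; rewrite midx_rank ffunE midx_rank ffunE sg.
rewrite (reindex join); first by apply: eq_bigr => p _; rewrite /G rl rr.
exists (fun x => (res f x, res g x)) => [p _|x _]; first by rewrite rl rr; case: p.
apply: midx_inj; apply/ffunP => c; rewrite midx_rank ffunE.
by have := sK c; case: (s c) => j <-; rewrite midx_rank ffunE.
Qed.

End TensorTrace.

(** * Brauer algebra relations and the Yang-Baxter equation *)

Section Brauer.
Variables (C : comPzRingType) (g : bcd_type) (N m : nat).
Hypothesis N_even : g = Symplectic -> ~~ odd N.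
Local Notation K := #|{ffun 'I_m -> 'I_N}|.
Local Notation E a i j := (@slot C N m a (delta_mx i j)).
Local Notation P := (@Pmx C N m).
Local Notation Q := (@Qmx C g N m).
Local Notation e := (@epsilon C g N).
Implicit Types (a b c d : 'I_m) (i j k l : 'I_N).

Definition bcd_sign : C := match g with Orthogonal => 1 | Symplectic => -1 end.
Local Notation sg := bcd_sign.

Lemma bcd_sign_sqr : sg * sg = 1.
Proof. by rewrite /sg; case: g; rewrite ?mulrNN mulr1. Qed.

Lemma epsilon_sqr i : e i * e i = 1.
Proof. by rewrite /epsilon; case: g; [|case: ifP]; rewrite ?mulrNN mulr1. Qed.

(** For even N exactly one of i and i' lies in the first half, which gives the sign -1 in the
    symplectic case. *)
Lemma epsilon_rev i : e i * e (rev_ord i) = sg.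
Proof.
rewrite /epsilon /sg; case: g N_even => [_|/(_ erefl) evN]; first by rewrite mulr1.
have := odd_double_half N; have := ltn_ord i; rewrite (negPf evN) /= => lt eN.
by case: ifPn => H1; case: ifPn => H2; rewrite ?mulr1 ?mul1r //; exfalso; lia.
Qed.

Lemma sum_mulrb (I : finType) (V : nmodType) (k : I) (F : I -> V) :
  \sum_j F j *+ (j == k) = F k.
Proof.
by rewrite (@sum_only _ _ k) ?eqxx // => j /negPf ->.
Qed.

Lemma slot_delta_mul a i j k l : E a i j * E a k l = E a i l *+ (j == k).
Proof. by rewrite -slotM mul_delta_mx_cond raddfMn. Qed.

Lemma slot_delta_comm a b i j k l : a != b -> E a i j * E b k l = E b k l * E a i j.
Proof. by move=> ne; apply: slot_comm => // *; rewrite mulrC. Qed.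

Lemma slot_commC a b X Y : a != b -> @slot C N m a X * slot b Y = slot b Y * slot a X.
Proof. by move=> ne; apply: slot_comm => // *; rewrite mulrC. Qed.

Lemma slot_delta_sum a : \sum_i E a i i = 1.
Proof. by transitivity (@slot C N m a 1%:M);
  [rewrite mx1_sum_delta raddf_sum | apply: slot1]. Qed.

Lemma scalemxMl n (x : C) (X Y : 'M[C]_n) : (x *: X) * Y = x *: (X * Y).
Proof. by rewrite -[_ * _]/(_ *m _) -scalemxAl. Qed.
Lemma scalemxMr n (x : C) (X Y : 'M[C]_n) : X * (x *: Y) = x *: (X * Y).
Proof. by rewrite -[_ * _]/(_ *m _) -scalemxAr. Qed.

Lemma PmxE a b : P a b = \sum_i \sum_j E a i j * E b j i.
Proof. by []. Qed.
Lemma QmxE a b : Q a b = \sum_i \sum_j (e i * e j) *: (E a i j * E b (rev_ord i) (rev_ord j)).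
Proof. by []. Qed.

Lemma Pmx_sym a b : a != b -> P a b = P b a.
Proof.
move=> ne; rewrite !PmxE exchange_big; apply: eq_bigr => i _; apply: eq_bigr => j _.
by rewrite slot_delta_comm.
Qed.

Lemma sum_rev (V : nmodType) (F : 'I_N -> V) : \sum_i F (rev_ord i) = \sum_i F i.
Proof. by rewrite [RHS](reindex_inj rev_ord_inj). Qed.

Lemma Qmx_sym a b : a != b -> Q a b = Q b a.
Proof.
move=> ne; rewrite !QmxE -sum_rev; apply: eq_bigr => i _; rewrite -sum_rev.
apply: eq_bigr => j _; rewrite !rev_ordK slot_delta_comm //; congr (_ *: _).
transitivity ((e i * e (rev_ord i)) * (e j * e (rev_ord j)) * (e (rev_ord i) * e (rev_ord j))).
  by rewrite !epsilon_rev bcd_sign_sqr mul1r.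
transitivity ((e i * e j) * (e (rev_ord i) * e (rev_ord i)) * (e (rev_ord j) * e (rev_ord j))).
  by ring.
by rewrite !epsilon_sqr !mulr1.
Qed.

Lemma Pmx_deltaE a b k l : a != b -> P a b * E a k l = \sum_i E a i l * E b k i.
Proof.
move=> ne; rewrite PmxE mulr_suml; apply: eq_bigr => i _; rewrite mulr_suml.
rewrite -[RHS](sum_mulrb k (fun j => E a i l * E b j i)); apply: eq_bigr => j _.
by rewrite -mulrA -(slot_delta_comm _ _ _ _ ne) mulrA slot_delta_mul mulrnAl.
Qed.

Lemma Pmx_deltal a b k l : a != b -> P a b * E a k l = E b k l * P a b.
Proof.
move=> ne; rewrite Pmx_deltaE // PmxE mulr_sumr; apply: eq_bigr => i _; rewrite mulr_sumr.
rewrite -[LHS](sum_mulrb l (fun j => E a i j * E b k i)); apply: eq_bigr => j _.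
by rewrite mulrA -(slot_delta_comm _ _ _ _ ne) -mulrA slot_delta_mul mulrnAr eq_sym.
Qed.

Lemma Pmx_slot_comm a b c X : a != c -> b != c -> P a b * @slot C N m c X = slot c X * P a b.
Proof.
move=> nac nbc; rewrite PmxE mulr_suml mulr_sumr; apply: eq_bigr => i _.
rewrite mulr_suml mulr_sumr; apply: eq_bigr => j _.
by rewrite -mulrA (slot_commC _ _ nbc) mulrA (slot_commC _ _ nac) mulrA.
Qed.

Lemma Pmx_sqr a b : a != b -> P a b * P a b = 1.
Proof.
move=> ne; rewrite {2}PmxE mulr_sumr -(slot_delta_sum b); apply: eq_bigr => k _.
rewrite mulr_sumr -[RHS]mul1r -(slot_delta_sum a) mulr_suml; apply: eq_bigr => l _.
rewrite mulrA Pmx_deltaE // mulr_suml -[RHS](sum_mulrb l (fun i => E a i l * E b k k)).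
by apply: eq_bigr => i _; rewrite -mulrA slot_delta_mul mulrnAr.
Qed.

(** The transposition property of Q: next to Q_ab, a matrix X on the factor a may be replaced by X'
    on the factor b. This is the case of a matrix unit. *)
Lemma Qmx_delta a b k l : a != b ->
  Q a b * E a k l = (e k * e l) *: (Q a b * E b (rev_ord l) (rev_ord k)).
Proof.
move=> ne; rewrite QmxE !mulr_suml scaler_sumr; apply: eq_bigr => i _.
rewrite !mulr_suml scaler_sumr.
transitivity ((e i * e k) *: (E a i l * E b (rev_ord i) (rev_ord k))).
  rewrite -[RHS](sum_mulrb k (fun j => (e i * e j) *: (E a i l * E b (rev_ord i) (rev_ord j)))).
  apply: eq_bigr => j _;
    rewrite scalemxMl -mulrA -(slot_delta_comm _ _ _ _ ne) mulrA slot_delta_mul.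
  by rewrite mulrnAl scalerMnr.
rewrite -[LHS](sum_mulrb l (fun j => (e i * e k) *: (E a i j * E b (rev_ord i) (rev_ord k)))).
apply: eq_bigr => j _; rewrite scalemxMl -mulrA slot_delta_mul (inj_eq rev_ord_inj).
case: eqP => [->|_]; last by rewrite !mulr0n mulr0 !scaler0.
rewrite !mulr1n scalerA; congr (_ *: _).
by rewrite -[LHS]mulr1 -(epsilon_sqr l); ring.
Qed.

Lemma delta_Qmx a b k l : a != b ->
  E a k l * Q a b = (e k * e l) *: (E b (rev_ord l) (rev_ord k) * Q a b).
Proof.
move=> ne; rewrite QmxE !mulr_sumr scaler_sumr.
transitivity (\sum_j (e l * e j) *: (E a k j * E b (rev_ord l) (rev_ord j))).
  rewrite -[RHS](sum_mulrb l (fun i => \sum_j (e i * e j) *: (E a k j * E b (rev_ord i) (rev_ord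
    j)))).
  apply: eq_bigr => i _; rewrite mulr_sumr -sumrMnl; apply: eq_bigr => j _.
  by rewrite scalemxMr mulrA slot_delta_mul mulrnAl scalerMnr eq_sym.
rewrite -[LHS](sum_mulrb k (fun i => \sum_j (e l * e j) *: (E a i j * E b (rev_ord l) (rev_ord
  j)))).
apply: eq_bigr => i _; rewrite mulr_sumr scaler_sumr -sumrMnl; apply: eq_bigr => j _.
rewrite scalemxMr mulrA -(slot_delta_comm _ _ _ _ ne) -mulrA slot_delta_mul (inj_eq rev_ord_inj)
  eq_sym.
case: eqP => [->|_]; last by rewrite !mulr0n mulr0 !scaler0.
rewrite !mulr1n scalerA; congr (_ *: _).
by rewrite -[LHS]mulr1 -(epsilon_sqr i); ring.
Qed.

(** [Qmx_delta] carries the first unit of every summand of P over to the factor b. Only the terms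
    with j = i' survive, each with sign [e i * e i']. *)
Lemma Qmx_Pmx a b : a != b -> Q a b * P a b = sg *: Q a b.
Proof.
move=> ne; rewrite PmxE mulr_sumr -[Q a b in RHS]mulr1 -(slot_delta_sum b) mulr_sumr scaler_sumr.
apply: eq_bigr => i _; rewrite mulr_sumr.
rewrite -[RHS](sum_mulrb (rev_ord i) (fun j => sg *: (Q a b * E b i i))).
apply: eq_bigr => j _; rewrite mulrA Qmx_delta // scalemxMl -mulrA slot_delta_mul.
rewrite eq_sym.
case: eqP => [->|_]; last by rewrite !mulr0n mulr0 scaler0.
by rewrite !mulr1n epsilon_rev !rev_ordK.
Qed.
 
Lemma Pmx_Qmx a b : a != b -> P a b * Q a b = sg *: Q a b.
Proof.
move=> ne; rewrite PmxE exchange_big mulr_suml -[Q a b in RHS]mul1r -(slot_delta_sum b).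
rewrite mulr_suml scaler_sumr; apply: eq_bigr => i _; rewrite mulr_suml.
rewrite -[RHS](sum_mulrb (rev_ord i) (fun j => sg *: (E b i i * Q a b))).
apply: eq_bigr => j _;
  rewrite slot_delta_comm // -mulrA delta_Qmx // scalemxMr mulrA slot_delta_mul.
case: eqP => [->|_]; last by rewrite !mulr0n mul0r scaler0.
by rewrite rev_ordK !mulr1n [e _ * _]mulrC epsilon_rev.
Qed.

Lemma Qmx_sqr a b : a != b -> Q a b * Q a b = N%:R *: Q a b.
Proof.
move=> ne; rewrite {2}QmxE mulr_sumr.
transitivity (\sum_(i < N) Q a b); last by rewrite sumr_const card_ord scaler_nat.
apply: eq_bigr => i _; rewrite mulr_sumr -{2}[Q a b]mulr1 -(slot_delta_sum b) mulr_sumr.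
rewrite -[RHS]sum_rev; apply: eq_bigr => j _.
rewrite scalemxMr mulrA Qmx_delta // scalemxMl -mulrA slot_delta_mul eqxx scalerA.
rewrite [X in X *: _](_ : _ = (e i * e i) * (e j * e j)); last by ring.
by rewrite !epsilon_sqr mulr1 scale1r.
Qed.

(** Transposing the factor b of P_bc through Q_ab turns P_bc into Q_ac: Q is the partial transpose
    of P. *)
Lemma Qmx_Pmx_adj a b c : a != b -> b != c -> a != c ->
  Q a b * P b c = Q a b * Q a c.
Proof.
move=> nab nbc nac; rewrite PmxE (QmxE a c) exchange_big !mulr_sumr -sum_rev.
apply: eq_bigr => i _; rewrite !mulr_sumr -sum_rev.
apply: eq_bigr => j _; rewrite scalemxMr !mulrA Qmx_delta // !scalemxMl scalerA.
rewrite -[LHS]scale1r; congr (_ *: _).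
by rewrite -[LHS]mulr1 -{1}(epsilon_sqr i) -(epsilon_sqr j); ring.
Qed.

Lemma Pmx_Qmx_adj a b c : a != b -> b != c -> a != c ->
  P b c * Q a b = Q a c * Q a b.
Proof.
move=> nab nbc nac; rewrite PmxE (QmxE a c) exchange_big !mulr_suml -sum_rev.
apply: eq_bigr => i _; rewrite !mulr_suml -sum_rev.
apply: eq_bigr => j _; rewrite scalemxMl slot_delta_comm // [in RHS]slot_delta_comm //.
rewrite -!mulrA delta_Qmx // scalemxMr scalerA.
rewrite -[LHS]scale1r; congr (_ *: _).
by rewrite -[LHS]mulr1 -{1}(epsilon_sqr i) -(epsilon_sqr j); ring.
Qed.

Lemma Pmx_Pmx_conj a b c : a != b -> b != c -> a != c -> P a b * P a c = P b c * P a b.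
Proof.
move=> nab nbc nac; rewrite (PmxE a c) (PmxE b c) mulr_sumr mulr_suml; apply: eq_bigr => i _.
rewrite mulr_sumr mulr_suml; apply: eq_bigr => j _; rewrite mulrA Pmx_deltal // -!mulrA.
by rewrite Pmx_slot_comm.
Qed.

Lemma Pmx_Qmx_conj a b c : a != b -> b != c -> a != c -> P a b * Q a c = Q b c * P a b.
Proof.
move=> nab nbc nac; rewrite (QmxE a c) (QmxE b c) mulr_sumr mulr_suml; apply: eq_bigr => i _.
rewrite mulr_sumr mulr_suml; apply: eq_bigr => j _; rewrite scalemxMl scalemxMr; congr (_ *: _).
by rewrite mulrA Pmx_deltal // -!mulrA Pmx_slot_comm.
Qed.

End Brauer.

(* x (x - t k) (1 - t p / x + t A / (x - t k)). *)
Definition Rword (C : comPzRingType) n (t k x : C) (p A : 'M[C]_n) : 'M[C]_n :=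
  (x * (x - t * k)) *: (1%:M : 'M[C]_n) + (- (t * (x - t * k))) *: p + (t * x) *: A.

(* The hypotheses hold in the Brauer algebra on three strands.  They rewrite both
   expansions in a common set of words, whose coefficients agree because
   s^2 = 1 and N = 2 k + 2 s. *)
Lemma yang_baxter_words (C : comPzRingType) n (p q r A B D : 'M[C]_n) (s N t k x y : C) :
  p * q * r = q -> p * q * D = s *: (A * D) -> p * B * r = s *: (D * A) ->
  p * B * D = D -> A * q * r = s *: (A * D) -> A * q * D = N *: (A * D) ->
  A * B * r = A -> A * B * D = s *: (A * D) ->
  r * q * p = q -> r * q * A = s *: (D * A) -> r * B * p = s *: (A * D) ->
  r * B * A = A -> D * q * p = s *: (D * A) -> D * q * A = N *: (D * A) ->
  D * B * p = D -> D * B * A = s *: (D * A) ->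
  p * B = D * B -> A * q = A * D -> p * D = B * D -> A * r = A * B ->
  q * D = A * D -> B * r = B * A -> p * r = q * p -> q * r = p * q ->
  r * q = q * p -> r * B = A * B -> D * q = D * A -> r * p = p * q ->
  r * A = B * A -> D * p = D * B -> q * A = D * A -> B * p = B * D ->
  s * s = 1 -> N = k + k + s + s ->
  Rword t k x p A * Rword t k (x + y) q B * Rword t k y r D =
  Rword t k y r D * Rword t k (x + y) q B * Rword t k x p A.
Proof.
move=> w1 w2 w3 w4 w5 w6 w7 w8 w9 w10 w11 w12 w13 w14 w15 w16.
move=> d1 d2 d3 d4 d5 d6 d7 d8 d9 d10 d11 d12 d13 d14 d15 d16 ss eN.
rewrite /Rword -![1%:M]/(1 : 'M[C]_n).
rewrite !(mulrDl, mulrDr, scalemxMl, scalemxMr, mul1r, mulr1, scalerA).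
rewrite w1 w2 w3 w4 w5 w6 w7 w8 w9 w10 w11 w12 w13 w14 w15 w16.
rewrite d1 d2 d3 d4 d5 d6 d7 d8 d9 d10 d11 d12 d13 d14 d15 d16.
rewrite !scalerA.
(* Both sides are now linear in the remaining words, which become independent variables; entrywise
   only an identity in C modulo [ss] and [eN] is left. *)
move: (p * q) (q * p) (A * B) (A * D) (B * A) (B * D) (D * A) (D * B) (1 : 'M[C]_n).
move=> pq qp AB AD BA BD DA DB I; apply/matrixP => i j; rewrite !mxE.
ring: ss eN.
Qed.

Section ScalarMatrices.
Variables (C : comPzRingType) (B : pzRingType) (phi : {rmorphism C -> B}).
Hypothesis phi_central : forall c x, phi c * x = x * phi c.
Local Notation "M ^f" := (map_mx phi M).

Lemma map_scale_comm n (c : C) (M : 'M[C]_n) (Y : 'M[B]_n) :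
  GRing.comm (M^f) Y -> GRing.comm ((c *: M)^f) Y.
Proof.
rewrite /GRing.comm => MY; rewrite map_mxZ.
have -> : phi c *: M^f * Y = phi c *: (M^f * Y) by rewrite -[_ * _]/(_ *m _) -scalemxAl.
rewrite MY; apply/matrixP => i j; rewrite !mxE mulr_sumr; apply: eq_bigr => l _.
by rewrite !mxE !mulrA phi_central.
Qed.

(** Cyclicity survives over the noncommutative ring B because the entries of one of the two factors
    are central. *)
Lemma trace_map_comm n (M : 'M[C]_n) (Y : 'M[B]_n) : \tr (M^f * Y) = \tr (Y * M^f).
Proof.
rewrite /mxtrace; under eq_bigr do rewrite mxE; under [RHS]eq_bigr do rewrite mxE.
rewrite exchange_big; apply: eq_bigr => i _; apply: eq_bigr => j _.
by rewrite !mxE phi_central.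
Qed.

Lemma slot_map_comm N m (a c : 'I_m) (U : 'M[C]_N) (X : 'M[B]_N) : a != c ->
  GRing.comm ((slot a U)^f) (slot c X).
Proof.
move=> ne; rewrite /GRing.comm -slot_map ?rmorph0 //.
by apply: slot_comm => // i j k l; rewrite mxE phi_central.
Qed.

Lemma Pmx_map_comm N m (a b c : 'I_m) (X : 'M[B]_N) : a != c -> b != c ->
  GRing.comm ((@Pmx C N m a b)^f) (slot c X).
Proof.
move=> ac bc; rewrite PmxE map_mx_sum.
apply/commr_sym/commr_sum => i _; rewrite map_mx_sum; apply: commr_sum => j _.
by rewrite map_mxM; apply: commrM; apply/commr_sym/slot_map_comm.
Qed.

Lemma Qmx_map_comm g N m (a b c : 'I_m) (X : 'M[B]_N) : a != c -> b != c ->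
  GRing.comm ((@Qmx C g N m a b)^f) (slot c X).
Proof.
move=> ac bc; rewrite QmxE map_mx_sum.
apply/commr_sym/commr_sum => i _; rewrite map_mx_sum; apply: commr_sum => j _.
apply/commr_sym/map_scale_comm/commr_sym.
by rewrite map_mxM; apply: commrM; apply/commr_sym/slot_map_comm.
Qed.

Lemma linear_map_comm n (al be ga : C) (p A : 'M[C]_n) (Y : 'M[B]_n) :
  GRing.comm (p^f) Y -> GRing.comm (A^f) Y ->
  GRing.comm ((al *: (1%:M : 'M[C]_n) + be *: p + ga *: A)^f) Y.
Proof.
move=> pY AY; rewrite !map_mxD; apply/commr_sym.
apply: commrD; [apply: commrD|]; apply/commr_sym/map_scale_comm => //.
by rewrite map_mx1; apply/commr_sym/commr1.
Qed.

End ScalarMatrices.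

Section RMatrix.
Variables (C : comPzRingType) (g : bcd_type) (N m : nat).
Hypothesis N_even : g = Symplectic -> ~~ odd N.
Variables (t k : C).
Local Notation sg := (bcd_sign C g).
Hypothesis k_kappa : N%:R = k + k + sg + sg.
Local Notation K := #|{ffun 'I_m -> 'I_N}|.
Local Notation P := (@Pmx C N m).
Local Notation Q := (@Qmx C g N m).

(** Used with t = h between the two groups and with t = 1 inside a group, where h has been divided
    out of the parameters. *)
Definition Rpol (x : C) (a b : 'I_m) : 'M[C]_K := Rword t k x (P a b) (Q a b).

Lemma Rpol_yang_baxter a b c x y : a != b -> b != c -> a != c ->
  Rpol x a b * Rpol (x + y) a c * Rpol y b c = Rpol y b c * Rpol (x + y) a c * Rpol x a b.
Proof.
move=> ab bc ac.
have [ba cb ca] : [/\ b != a, c != b & c != a] by split; rewrite eq_sym.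
have PC := @Pmx_Pmx_conj C N m; have QC := @Pmx_Qmx_conj C g N m.
have QP := @Qmx_Pmx_adj C g N m; have PQ := @Pmx_Qmx_adj C g N m.
pose p := P a b; pose q := P a c; pose r := P b c.
pose A := Q a b; pose B := Q a c; pose D := Q b c.
have pE : P b a = p by rewrite Pmx_sym. have qE : P c a = q by rewrite Pmx_sym.
have rE : P c b = r by rewrite Pmx_sym. have AE : Q b a = A by rewrite Qmx_sym.
have BE : Q c a = B by rewrite Qmx_sym. have DE : Q c b = D by rewrite Qmx_sym.
have pp : p * p = 1 by apply: Pmx_sqr. have qq : q * q = 1 by apply: Pmx_sqr.
have rr : r * r = 1 by apply: Pmx_sqr.
have pA : p * A = sg *: A by apply: Pmx_Qmx. have Ap : A * p = sg *: A by apply: Qmx_Pmx.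
have rD : r * D = sg *: D by apply: Pmx_Qmx. have Dr : D * r = sg *: D by apply: Qmx_Pmx.
have AA : A * A = N%:R *: A by apply: Qmx_sqr. have DD : D * D = N%:R *: D by apply: Qmx_sqr.
have pq : p * q = r * p by apply: PC.
have qp : q * p = r * q by have := PC a c b ac cb ab; rewrite rE.
have pr : p * r = q * p by have := PC b a c ba ac bc; rewrite pE.
have qr : q * r = p * q by have := PC c a b ca ab cb; rewrite qE rE.
have rp : r * p = p * q by rewrite pq.
have rq : r * q = q * p by rewrite qp.
have Ar : A * r = A * B by apply: QP.
have Aq : A * q = A * D by have := QP b a c ba ac bc; rewrite AE.
have Br : B * r = B * A by have := QP a c b ac cb ab; rewrite rE.
have Bp : B * p = B * D by have := QP c a b ca ab cb; rewrite BE DE.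
have Dq : D * q = D * A by have := QP b c a bc ca ba; rewrite qE AE.
have Dp : D * p = D * B by have := QP c b a cb ba ca; rewrite DE pE BE.
have rA : r * A = B * A by apply: PQ.
have qA : q * A = D * A by have := PQ b a c ba ac bc; rewrite AE.
have rB : r * B = A * B by have := PQ a c b ac cb ab; rewrite rE.
have pB : p * B = D * B by have := PQ c a b ca ab cb; rewrite BE DE.
have qD : q * D = A * D by have := PQ b c a bc ca ba; rewrite qE AE.
have pD : p * D = B * D by have := PQ c b a cb ba ca; rewrite DE pE BE.
(* The two-letter words are settled by the equalities above. Each three-letter word is reduced by
   rewriting one pair so that a square, or a product of P and Q on the same factors, appears. *)
apply: (@yang_baxter_words _ _ p q r A B D sg N%:R) => //.
- by rewrite -mulrA qr mulrA pp mul1r.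
- by rewrite -mulrA qD mulrA pA scalemxMl.
- by rewrite -mulrA Br mulrA pB -Dp -mulrA pA scalemxMr.
- by rewrite pB -mulrA -Bp mulrA -Dp -mulrA pp mulr1.
- by rewrite -mulrA qr mulrA Ap scalemxMl Aq.
- by rewrite -mulrA qD mulrA AA scalemxMl.
- by rewrite -Ar -mulrA rr mulr1.
- by rewrite -mulrA -Bp mulrA -Ar -mulrA rp mulrA Ap scalemxMl Aq.
- by rewrite -mulrA qp mulrA rr mul1r.
- by rewrite -mulrA qA mulrA rD scalemxMl.
- by rewrite rB -mulrA Bp -Bp mulrA -Ar -mulrA rp mulrA Ap scalemxMl Aq.
- by rewrite -mulrA -rA mulrA rr mul1r.
- by rewrite -mulrA qp mulrA Dr scalemxMl Dq.
- by rewrite -mulrA qA mulrA DD scalemxMl.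
- by rewrite -Dp -mulrA pp mulr1.
- by rewrite -Dp -mulrA pA scalemxMr.
- exact: bcd_sign_sqr.
Qed.

Lemma Rpol_map_comm (B : pzRingType) (phi : {rmorphism C -> B}) a b c x (X : 'M[B]_N) :
  (forall c x, phi c * x = x * phi c) -> a != c -> b != c ->
  GRing.comm (map_mx phi (Rpol x a b)) (slot c X).
Proof.
move=> phi_c ac bc; apply: linear_map_comm => //; first exact: Pmx_map_comm.
exact: Qmx_map_comm.
Qed.

(** P and Q on the factors c, d are combinations of products of single slots, and commutation with
    those is [Rpol_map_comm] for the identity morphism. *)
Lemma Rpol_comm a b c d x y : a != c -> a != d -> b != c -> b != d ->
  GRing.comm (Rpol x a b) (Rpol y c d).
Proof.
move=> ac ad bc bd.
have id_c (u v : C) : idfun u * v = v * idfun u by rewrite mulrC.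
have idm n (M : 'M[C]_n) : map_mx idfun M = M by apply: map_mx_id.
have H e X : a != e -> b != e -> GRing.comm (slot e X) (Rpol x a b).
  by move=> ae be; apply/commr_sym; rewrite -[Rpol x a b]idm; apply: Rpol_map_comm.
apply/commr_sym; rewrite -[Rpol y c d]idm.
apply: linear_map_comm => //; rewrite idm ?PmxE ?QmxE; apply/commr_sym/commr_sum => i _;
  apply: commr_sum => j _; apply/commr_sym.
  by apply/commr_sym/commrM; apply/commr_sym/H.
rewrite -[_ *: _]idm; apply: map_scale_comm => //; rewrite idm.
by apply/commr_sym/commrM; apply/commr_sym/H.
Qed.

(** The terms in P and Q cancel because N = 2 k + 2 s. The zeros x = t, -t, t k, -t k of the scalar
    determine the linear factors that later have to be regular. *)
Lemma Rpol_unitarity a b x : a != b ->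
  Rpol x a b * Rpol (- x) a b = ((x ^+ 2 - t ^+ 2) * (x ^+ 2 - (t * k) ^+ 2))%:M.
Proof.
move=> ab; rewrite /Rpol /Rword -![1%:M]/(1 : 'M[C]_K) -scalemx1 -![1%:M]/(1 : 'M[C]_K).
rewrite !(mulrDl, mulrDr, scalemxMl, scalemxMr, mul1r, mulr1, scalerA).
rewrite Pmx_sqr // Pmx_Qmx // Qmx_Pmx // Qmx_sqr // !scalerA k_kappa.
move: (P a b) (Q a b) (1 : 'M[C]_K) => p A I; apply/matrixP => i j; rewrite !mxE.
ring: (bcd_sign_sqr C g).
Qed.

End RMatrix.

(** * Ordered products of R-matrices *)

Section Fusion.
Variables (M : pzRingType) (I : eqType) (lt : rel I) (r : I -> I -> M).
Implicit Types (s t : seq I) (X : I -> M).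
Local Notation comm := GRing.comm.

Lemma prod_rcons s x X : \prod_(a <- rcons s x) X a = (\prod_(a <- s) X a) * X x.
Proof. by rewrite -cats1 big_cat big_seq1. Qed.

Lemma comm_prod (y : M) s X : (forall a, a \in s -> comm y (X a)) ->
  comm y (\prod_(a <- s) X a).
Proof.
by move=> H; rewrite big_seq; apply: big_ind => [|u v|a /H //];
  [apply: commr1 | apply: commrM].
Qed.

Fixpoint full s : M :=
  if s is a :: s' then (\prod_(b <- s') r a b) * full s' else 1.

Lemma full_comm s (y : M) : pairwise lt s ->
  (forall a b, a \in s -> b \in s -> lt a b -> comm y (r a b)) -> comm y (full s).
Proof.
elim: s => [|a s IH] /=; first by move=> _ _; apply: commr1.
case/andP=> /allP lta /IH{}IH H; apply: commrM.
  by apply: comm_prod => b bs; apply: H; rewrite ?mem_head ?inE ?bs ?orbT ?lta.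
by apply: IH => b c bs cs; apply: H; rewrite inE ?bs ?cs orbT.
Qed.

(** Pairwise exchange relations reverse the order of a whole product. Outer induction peels off the
    first index a: [Ca] takes X a past the R-matrices of the tail, and the inner induction [E] takes
    it past the X of the tail by means of the row r a b. *)
Lemma full_exchange s X : uniq s -> pairwise lt s ->
  (forall a b, a \in s -> b \in s -> lt a b -> r a b * X a * X b = X b * X a * r a b) ->
  (forall a b c, a \in s -> b \in s -> lt a b -> c \in s -> c != a -> c != b ->
     comm (X c) (r a b)) ->
  full s * \prod_(a <- s) X a = (\prod_(a <- rev s) X a) * full s.
Proof.
elim: s => [|a s IH]; first by rewrite /rev /= !big_nil mulr1.
rewrite cons_uniq [pairwise _ _]/= => /andP[nas us] /andP[/allP lta lts] HX HC.
have sub b : b \in s -> b \in a :: s by rewrite inE orbC => ->.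
have {IH}IH := IH us lts (fun b c bs cs => HX b c (sub b bs) (sub c cs))
  (fun b c d bs cs l ds => HC b c d (sub b bs) (sub c cs) l (sub d ds)).
have Ca : comm (X a) (full s).
  apply: (full_comm lts) => b c bs cs l; apply: HC; rewrite ?mem_head ?sub //.
    by apply: contraNneq nas => ->.
  by apply: contraNneq nas => ->.
have E : (\prod_(b <- s) r a b) * X a * \prod_(b <- rev s) X b =
         (\prod_(b <- rev s) X b) * X a * \prod_(b <- s) r a b.
  have {}HX b : b \in s -> r a b * X a * X b = X b * X a * r a b.
    by move=> bs; apply: HX; rewrite ?mem_head ?sub ?lta.
  have {}HC b c : b \in s -> c \in s -> c != b -> comm (X c) (r a b).
    move=> bs cs ne; apply: HC; rewrite ?mem_head ?sub ?lta //.
    by apply: contraNneq nas => <-.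
  elim: s us {lta lts sub IH Ca nas} HX HC => [|b s IH];
    first by rewrite /rev /= !big_nil !(mulr1, mul1r).
  rewrite cons_uniq rev_cons prod_rcons !big_cons => /andP[nbs us] HX HC.
  have sub c : c \in s -> c \in b :: s by rewrite inE orbC => ->.
  have {}IH := IH us (fun b bs => HX b (sub b bs)) (fun c d cs ds => HC c d (sub c cs) (sub d
    ds)).
  have C1 : comm (r a b) (\prod_(c <- rev s) X c).
    apply: comm_prod => c; rewrite mem_rev => cs; apply/commr_sym/HC; rewrite ?mem_head ?sub //.
    by apply: contraNneq nbs => <-.
  have C2 : comm (X b) (\prod_(c <- s) r a c).
    apply: comm_prod => c cs; apply: HC; rewrite ?mem_head ?sub //.
    by apply: contraNneq nbs => ->.
  rewrite -!mulrA (mulrA (\prod_(c <- s) r a c)) (mulrA _ _ (X b)) IH.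
  rewrite -!mulrA -C2 !mulrA C1 -!mulrA; congr (_ * _).
  by rewrite !mulrA HX ?mem_head.
rewrite rev_cons prod_rcons big_cons /= -!mulrA (mulrA (full s)) -Ca.
by rewrite -mulrA IH !mulrA E.
Qed.

(** The mirror image of [full_exchange], starting from the reversed product. It is needed when the
    columns of [cross] play the part of X. *)
Lemma full_exchange_rev s X : uniq s -> pairwise lt s ->
  (forall a b, a \in s -> b \in s -> lt a b -> r a b * X b * X a = X a * X b * r a b) ->
  (forall a b c, a \in s -> b \in s -> lt a b -> c \in s -> c != a -> c != b ->
     comm (X c) (r a b)) ->
  full s * \prod_(a <- rev s) X a = (\prod_(a <- s) X a) * full s.
Proof.
elim: s => [|a s IH]; first by rewrite /rev /= !big_nil mulr1.
rewrite cons_uniq [pairwise _ _]/= => /andP[nas us] /andP[/allP lta lts] HX HC.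
have sub b : b \in s -> b \in a :: s by rewrite inE orbC => ->.
have {IH}IH := IH us lts (fun b c bs cs => HX b c (sub b bs) (sub c cs))
  (fun b c d bs cs l ds => HC b c d (sub b bs) (sub c cs) l (sub d ds)).
have Ca : comm (X a) (full s).
  apply: (full_comm lts) => b c bs cs l; apply: HC; rewrite ?mem_head ?sub //.
    by apply: contraNneq nas => ->.
  by apply: contraNneq nas => ->.
have E : (\prod_(b <- s) r a b) * (\prod_(b <- s) X b) * X a =
         X a * (\prod_(b <- s) X b) * \prod_(b <- s) r a b.
  have {}HX b : b \in s -> r a b * X b * X a = X a * X b * r a b.
    by move=> bs; apply: HX; rewrite ?mem_head ?sub ?lta.
  have {}HC b c : b \in s -> c \in s -> c != b -> comm (X c) (r a b).
    move=> bs cs ne; apply: HC; rewrite ?mem_head ?sub ?lta //.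
    by apply: contraNneq nas => <-.
  elim: s us {lta lts sub IH Ca nas} HX HC => [|b s IH];
    first by rewrite /rev /= !big_nil !(mulr1, mul1r).
  rewrite cons_uniq !big_cons => /andP[nbs us] HX HC.
  have sub c : c \in s -> c \in b :: s by rewrite inE orbC => ->.
  have {}IH := IH us (fun b bs => HX b (sub b bs)) (fun c d cs ds => HC c d (sub c cs) (sub d
    ds)).
  have C1 : comm (r a b) (\prod_(c <- s) X c).
    apply: comm_prod => c cs; apply/commr_sym/HC; rewrite ?mem_head ?sub //.
    by apply: contraNneq nbs => <-.
  have C2 : comm (X b) (\prod_(c <- s) r a c).
    apply: comm_prod => c cs; apply: HC; rewrite ?mem_head ?sub //.
    by apply: contraNneq nbs => ->.
  rewrite -!mulrA (mulrA _ (X b)) -C2 -!mulrA (mulrA _ _ (X a)) IH.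
  by rewrite !mulrA HX ?mem_head // -!mulrA (mulrA (r a b)) C1 !mulrA.
rewrite rev_cons prod_rcons big_cons /= -!mulrA (mulrA (full s)) IH.
by rewrite -!mulrA -Ca !mulrA E.
Qed.

(** For two neighbours the Yang-Baxter equation moves r a b through both rows to the far right. The
    ordered product thereby inherits whatever r a b absorbs or annihilates on its right. *)
Lemma full_adjacent s1 a b s2 : uniq (s1 ++ a :: b :: s2) -> pairwise lt (a :: b :: s2) ->
  (forall c, c \in s2 -> r a b * r a c * r b c = r b c * r a c * r a b) ->
  (forall c d, c \in s2 -> d \in s2 -> c != d -> comm (r a c) (r b d)) ->
  (forall c d, c \in s2 -> d \in s2 -> lt c d -> comm (r a b) (r c d)) ->
  exists Z, full (s1 ++ a :: b :: s2) = Z * r a b.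
Proof.
elim: s1 => [|c s1 IH] /=; last first.
  case/andP=> _ us lts Y C1 C2; have [Z ->] := IH us lts Y C1 C2.
  by exists ((\prod_(d <- s1 ++ a :: b :: s2) r c d) * Z); rewrite mulrA.
case/and3P=> _ nb us /and3P[_ _ lts] Y C1 C2.
have E : r a b * (\prod_(c <- s2) r a c) * (\prod_(c <- s2) r b c) =
  (\prod_(c <- s2) r b c) * (\prod_(c <- s2) r a c) * r a b.
  elim: s2 us {nb lts C2} Y C1 => [|c s IH]; first by rewrite /rev /= !big_nil !(mulr1, mul1r).
  rewrite cons_uniq !big_cons => /andP[ncs us] Y C1.
  have sub d : d \in s -> d \in c :: s by rewrite inE orbC => ->.
  have {}IH := IH us (fun d ds => Y d (sub d ds)) (fun d e ds es => C1 d e (sub d ds) (sub e es)).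
  have D1 : comm (r b c) (\prod_(d <- s) r a d).
    apply: comm_prod => d ds; apply/commr_sym/C1; rewrite ?mem_head ?sub //.
    by apply: contraNneq ncs => <-.
  have D2 : comm (r a c) (\prod_(d <- s) r b d).
    apply: comm_prod => d ds; apply: C1; rewrite ?mem_head ?sub //.
    by apply: contraNneq ncs => ->.
  rewrite -!mulrA (mulrA (\prod_(d <- s) r a d)) -D1 -!mulrA.
  rewrite (mulrA (r a c)) (mulrA (r a b)) (mulrA (r a b)) Y ?mem_head // -!mulrA.
  by rewrite (mulrA (r a b)) IH !mulrA -(mulrA (r b c)) D2 !mulrA.
exists ((\prod_(c <- s2) r b c) * (\prod_(c <- s2) r a c) * full s2).
rewrite big_cons mulrA E -!mulrA; congr (_ * (_ * _)).
by apply: (full_comm lts) => c d cs ds l; apply: C2.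
Qed.

Definition cross_col s b : M := \prod_(a <- s) r a b.
(** The columns run from the last index of t to the first, because the column standing next to the
    product of the T's must belong to the first T of the second group. *)
Definition cross s t : M := \prod_(b <- rev t) cross_col s b.

Lemma col_exchange s b X : uniq s ->
  (forall a, a \in s -> r a b * X a * X b = X b * X a * r a b) ->
  (forall a c, a \in s -> c \in s -> a != c -> comm (r a b) (X c)) ->
  cross_col s b * (\prod_(a <- s) X a) * X b = X b * (\prod_(a <- s) X a) * cross_col s b.
Proof.
rewrite /cross_col; elim: s => [|a s IH]; first by rewrite /rev /= !big_nil !(mulr1, mul1r).
rewrite cons_uniq !big_cons => /andP[nas us] HX HC.
have sub c : c \in s -> c \in a :: s by rewrite inE orbC => ->.
have {}IH := IH us (fun c cs => HX c (sub c cs)) (fun c d cs ds => HC c d (sub c cs) (sub d ds)).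
have C1 : comm (X a) (\prod_(c <- s) r c b).
  apply: comm_prod => c cs; apply/commr_sym/HC; rewrite ?mem_head ?sub //.
  by apply: contraNneq nas => <-.
have C2 : comm (r a b) (\prod_(c <- s) X c).
  apply: comm_prod => c cs; apply: HC; rewrite ?mem_head ?sub //.
  by apply: contraNneq nas => ->.
rewrite -!mulrA (mulrA _ (X a)) -C1 -!mulrA (mulrA _ _ (X b)) IH.
by rewrite !mulrA HX ?mem_head // -!mulrA (mulrA (r a b)) C2 !mulrA.
Qed.

Lemma cross_exchange s t X : uniq s -> uniq t ->
  (forall a b, a \in s -> b \in t -> r a b * X a * X b = X b * X a * r a b) ->
  (forall a b c, a \in s -> b \in t -> c \in s ++ t -> a != c -> b != c ->
    comm (r a b) (X c)) -> (forall a b, a \in s -> b \in t -> a != b) ->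
  cross s t * (\prod_(a <- s) X a) * (\prod_(b <- t) X b) =
  (\prod_(b <- t) X b) * (\prod_(a <- s) X a) * cross s t.
Proof.
rewrite /cross => us; elim: t => [|b t IH]; first by rewrite /rev /= !big_nil !(mulr1, mul1r).
rewrite cons_uniq rev_cons prod_rcons !big_cons => /andP[nbt ut] HX HC dis.
have sub c : c \in t -> c \in b :: t by rewrite inE orbC => ->.
have {}IH := IH ut (fun a c as_ ct => HX a c as_ (sub c ct)) _
  (fun a c as_ ct => dis a c as_ (sub c ct)).
have E : cross_col s b * (\prod_(a <- s) X a) * X b = X b * (\prod_(a <- s) X a) * cross_col s b.
  apply: col_exchange => //.
    by move=> a as_; apply: HX; rewrite ?mem_head.
  move=> a c as_ cs ne; apply: HC; rewrite ?mem_head ?mem_cat ?cs //.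
  by rewrite eq_sym dis ?mem_head.
have C1 : comm (cross_col s b) (\prod_(c <- t) X c).
  apply: comm_prod => c ct; apply/commr_sym/comm_prod => a as_; apply/commr_sym/HC.
  - by [].
  - exact: mem_head.
  - by rewrite mem_cat sub ?orbT.
  - by rewrite dis ?sub.
  - by apply: contraNneq nbt => ->.
have C2 : comm (X b) (\prod_(c <- rev t) cross_col s c).
  apply: comm_prod => c; rewrite mem_rev => ct; apply: comm_prod => a as_; apply/commr_sym/HC.
  - by [].
  - exact: sub.
  - by rewrite mem_cat mem_head orbT.
  - by rewrite dis ?mem_head.
  - by apply: contraNneq nbt => <-.
rewrite -!mulrA (mulrA _ (X b)) (mulrA (cross_col s b)) (mulrA (cross_col s b)) E -!mulrA C1.
rewrite (mulrA _ (X b)) -C2 -!mulrA; congr (_ * _).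
rewrite !mulrA in IH *; rewrite IH // => a c d as_ ct dst ad cd.
apply: HC => //; first exact: sub.
by move: dst; rewrite !mem_cat inE => /orP[->//|->]; rewrite !orbT.
Qed.

(** Within a column c the Yang-Baxter equation is an exchange relation for X a = r a c, so
    [full_exchange] applies column by column and reverses s in each. *)
Lemma full_cross_l s t : uniq s -> pairwise lt s ->
  (forall a b c, a \in s -> b \in s -> c \in t -> lt a b ->
     r a b * r a c * r b c = r b c * r a c * r a b) ->
  (forall a b c d, a \in s -> b \in s -> c \in s -> d \in t -> lt a b -> c != a -> c != b ->
    comm (r c d) (r a b)) ->
  full s * cross s t = cross (rev s) t * full s.
Proof.
move=> us lts Y HC; rewrite /cross -[t]revK.
have {}Y a b c : a \in s -> b \in s -> c \in rev t -> lt a b ->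
     r a b * r a c * r b c = r b c * r a c * r a b by rewrite mem_rev; apply: Y.
have {}HC a b c d : a \in s -> b \in s -> c \in s -> d \in rev t -> lt a b -> c != a -> c != b ->
    comm (r c d) (r a b) by rewrite mem_rev; apply: HC.
rewrite revK; move: (rev t) Y HC => {}t; elim: t => [|b t IH] Y HC.
  by rewrite !big_nil mulr1 mul1r.
rewrite !big_cons mulrA full_exchange //.
- rewrite -!mulrA IH // => [a1 b1 c1 ? ? ct|a1 b1 c1 d1 ? ? ? dt].
    by apply: Y; rewrite // inE ct orbT.
  by apply: HC; rewrite // inE dt orbT.
- by move=> a1 b1 ? ? ?; apply: Y; rewrite ?mem_head.
- by move=> a1 b1 c1 ? ? ? ? ? ?; apply: HC; rewrite ?mem_head.
Qed.

(** Whole columns take the part of X: the Yang-Baxter equation along s gives the exchange relation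
    between the columns of b and c, and [full_exchange_rev] then reverses their order. *)
Lemma full_cross_r s t : uniq s -> uniq t -> pairwise lt t ->
  (forall a b c, a \in s -> b \in t -> c \in t -> lt b c ->
     r a b * r a c * r b c = r b c * r a c * r a b) ->
  (forall a b c d, a \in s -> d \in t -> b \in t -> c \in t -> lt b c -> d != b -> d != c ->
    comm (r a d) (r b c)) ->
  (forall a b c d, a \in s -> b \in s -> c \in t -> d \in t -> a != b -> c != d ->
    comm (r a c) (r b d)) -> (forall b c, lt b c -> b != c) ->
  full t * cross s t = (\prod_(b <- t) cross_col s b) * full t.
Proof.
move=> us ut ltt Y C1 C2 irr;
  apply: full_exchange_rev => // [b c bt ct l|b c d bt ct l dt db dc]; last first.
  by apply/commr_sym/comm_prod => a as_; apply/commr_sym/C1.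
rewrite /cross_col; have nbc := irr b c l.
elim: s us Y C1 C2 => [|a s IH]; first by rewrite /rev /= !big_nil !(mulr1, mul1r).
rewrite cons_uniq !big_cons => /andP[nas us] Y C1 C2.
have sub d : d \in s -> d \in a :: s by rewrite inE orbC => ->.
have {}IH := IH us (fun a b c as_ => Y a b c (sub a as_))
  (fun a b c d as_ => C1 a b c d (sub a as_))
  (fun a b c d as_ bs => C2 a b c d (sub a as_) (sub b bs)).
have D1 : comm (r a b) (\prod_(d <- s) r d c).
  apply: comm_prod => d ds; apply: C2; rewrite ?mem_head ?sub //.
  by apply: contraNneq nas => ->.
have D2 : comm (r a c) (\prod_(d <- s) r d b).
  apply: comm_prod => d ds; apply: C2; rewrite ?mem_head ?sub // 1?eq_sym //.
  by apply: contraNneq nas => <-.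
have Yabc : r b c * r a c * r a b = r a b * r a c * r b c by rewrite Y ?mem_head.
rewrite -!mulrA (mulrA _ (r a b)) -D1 -!mulrA (mulrA (r b c)) (mulrA _ (r a b)) Yabc.
by rewrite -!mulrA (mulrA (r b c)) IH !mulrA -(mulrA (r a b)) D2 !mulrA.
Qed.

End Fusion.

(** * The RTT relation with denominators cleared *)

Lemma Pmx_map (A B : pzRingType) (phi : {rmorphism A -> B}) N m (a b : 'I_m) :
  map_mx phi (@Pmx A N m a b) = Pmx B N a b.
Proof.
rewrite /Pmx map_mx_sum; apply: eq_bigr => i _; rewrite map_mx_sum; apply: eq_bigr => j _.
by rewrite map_mxM -!slot_map ?rmorph0 // !map_delta_mx.
Qed.

Lemma epsilon_map (A B : pzRingType) (phi : {rmorphism A -> B}) g N (i : 'I_N) :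
  phi (epsilon A g i) = epsilon B g i.
Proof. by rewrite /epsilon; case: g; [|case: ifP]; rewrite ?rmorphN ?rmorph1. Qed.

Lemma Qmx_map (A B : pzRingType) (phi : {rmorphism A -> B}) g N m (a b : 'I_m) :
  map_mx phi (@Qmx A g N m a b) = Qmx B g N a b.
Proof.
rewrite /Qmx map_mx_sum; apply: eq_bigr => i _; rewrite map_mx_sum; apply: eq_bigr => j _.
by rewrite map_mxZ map_mxM -!slot_map ?rmorph0 // !map_delta_mx rmorphM !epsilon_map.
Qed.

(** * The closed ideal of relations *)

Section Ideal.
Variables (F : fieldType) (g : bcd_type) (N : nat).
Local Notation A := (freealg F N).
Local Notation Ah := {fps A}.

Lemma malgC_central (c : F) (x : A) : c%:MP * x = x * c%:MP.
Proof.
rewrite mul_malgC malgM_def malgZ_def /malgC fgmulgU.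
by apply: eq_bigr => k _; rewrite mulrC mulm1.
Qed.

Definition inJ (x : Ah) : Prop := x \in @dy_ideal F g N.

Lemma inJ0 : inJ 0.
Proof. by have [] := @dy_ideal_zmod_closed F g N. Qed.

Lemma inJB x y : inJ x -> inJ y -> inJ (x - y).
Proof. by have [_ H] := @dy_ideal_zmod_closed F g N; apply: H. Qed.

Lemma inJN x : inJ x -> inJ (- x).
Proof. by move=> Jx; rewrite -sub0r; apply: inJB => //; apply: inJ0. Qed.

Lemma inJD x y : inJ x -> inJ y -> inJ (x + y).
Proof. by move=> Jx Jy; rewrite -[y]opprK; apply: inJB => //; apply: inJN. Qed.

Lemma inJMl a x : inJ x -> inJ (a * x).
Proof. exact: dy_ideal_mull. Qed.

Lemma inJ_sum (I : Type) (r : seq I) (P : pred I) (f : I -> Ah) :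
  (forall i, P i -> inJ (f i)) -> inJ (\sum_(i <- r | P i) f i).
Proof. by move=> H; elim/big_ind: _ => //; [apply: inJ0 | apply: inJD]. Qed.

Lemma inJMn x n : inJ x -> inJ (x *+ n).
Proof. by move=> Jx; elim: n => [|n IH]; [apply: inJ0 | rewrite mulrS; apply: inJD]. Qed.

Lemma inJ_closed (x : Ah) :
  (forall n, exists2 y : Ah, inJ y & forall k, (k < n)%N -> x k = y k) -> inJ x.
Proof.
move=> H; apply/dy_idealP => J JP; have [[_ _ Jc] Jr] := JP; apply: Jc => n.
by have [y /dy_idealP Jy e] := H n; exists y => //; apply: Jy.
Qed.

Lemma inJ_rel (x : Ah) : dy_relation g x -> inJ x.
Proof. by move=> rx; apply/dy_idealP => J [_]; apply. Qed.

Lemma dy_proj_eq0 (x : Ah) : dy_proj g x = 0 <-> inJ x.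
Proof.
by have := tsprojE (@dy_ideal F g N) x 0; rewrite subr0 raddf0.
Qed.

Definition allJ (f : {fps Ah}) := forall q, inJ (f q).

Lemma allJB f f' : allJ f -> allJ f' -> allJ (f - f').
Proof. by move=> H H' q; apply: inJB. Qed.

Lemma allJD f f' : allJ f -> allJ f' -> allJ (f + f').
Proof. by move=> H H' q; apply: inJD. Qed.

Lemma allJMl f f' : allJ f' -> allJ (f * f').
Proof. by move=> H q; rewrite fpsME; apply: inJ_sum => i _; apply: inJMl. Qed.

(** Each coefficient of the shifted series is an infinite sum. Its truncations lie in the ideal, and
    the ideal is h-adically closed. *)
Lemma allJ_shift (c : F) f : allJ f -> allJ (fps_shift c%:MP f).
Proof.
move=> H s; apply: inJ_closed => n; exists (shK c%:MP n f s).
  by apply: inJ_sum => k _; apply/inJMn/inJMl.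
by move=> k lt; apply: fps_shiftE.
Qed.

End Ideal.

(** * From the expansion in inverse powers of u to a polynomial relation *)

Section RTTAlgebra.
Variables (V : pzRingType) (n : nat) (h v k : V).
Hypotheses (h_central : forall x, h * x = x * h) (v_central : forall x, v * x = x * v).
Hypothesis (k_central : forall x, k * x = x * k).
Variables (T1 : int -> 'M[V]_n) (T2 P Q : 'M[V]_n).
Local Notation w := (v + h * k).

Lemma w_central x : w * x = x * w.
Proof. by rewrite mulrDl mulrDr v_central -mulrA k_central mulrA h_central -mulrA. Qed.

(** [Rcoef] over an abstract ring. The poles of the P and Q terms are v and [w]. *)
Definition rcoef (j : nat) : 'M[V]_n :=
  if j is c.+1 then - (h * v ^+ c) *: P + (h * w ^+ c) *: Q else 1%:M.

Definition brk (t1 X : 'M[V]_n) : 'M[V]_n := X *m t1 *m T2 - T2 *m t1 *m X.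

Lemma brkD t1 X Y : brk t1 (X + Y) = brk t1 X + brk t1 Y.
Proof. by rewrite /brk !(mulmxDl, mulmxDr) opprD addrACA. Qed.

Lemma brkZ t1 z X : (forall x, z * x = x * z) -> brk t1 (z *: X) = z *: brk t1 X.
Proof.
move=> cz; have E (M : 'M[V]_n) : M *m (z *: X) = z *: (M *m X).
  apply/matrixP => i j; rewrite !mxE mulr_sumr; apply: eq_bigr => l _.
  by rewrite !mxE !mulrA cz.
by rewrite /brk E -!scalemxAl scalerBr.
Qed.

Lemma brk0 X : brk 0 X = 0.
Proof. by rewrite /brk !(mulmx0, mul0mx) subrr. Qed.

Lemma brkr0 t1 : brk t1 0 = 0.
Proof. by rewrite /brk !(mulmx0, mul0mx) subrr. Qed.

(** What u^(-j) from R and u^(p + j) from T_1 contribute to the coefficient of u^p. *)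
Definition rterm (p : int) (j : nat) := brk (T1 (p + j%:Z)) (rcoef j).

Definition s1 : V := v + w.
Definition s2 : V := v * w.

Lemma s1_central x : s1 * x = x * s1.
Proof. by rewrite mulrDl mulrDr v_central w_central. Qed.
Lemma s2_central x : s2 * x = x * s2.
Proof. by rewrite -mulrA w_central mulrA v_central mulrA. Qed.

Lemma geometric_rec (x y : V) j : GRing.comm x y ->
  x ^+ j.+2 - (x + y) * x ^+ j.+1 + x * y * x ^+ j = 0.
Proof.
move=> xy; rewrite !exprS mulrDl !mulrA -xy opprD addrA subrr add0r.
by rewrite addNr.
Qed.

(** From index 1 on, the coefficients of R are combinations of powers of v and w, hence satisfy the
    recurrence with characteristic polynomial (X - v) (X - w). *)
Lemma rcoef_rec j : rcoef j.+3 - s1 *: rcoef j.+2 + s2 *: rcoef j.+1 = 0.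
Proof.
have coef (x : V) : x ^+ j.+2 - s1 * x ^+ j.+1 + s2 * x ^+ j = 0 ->
   h * x ^+ j.+2 - s1 * (h * x ^+ j.+1) + s2 * (h * x ^+ j) = 0.
  move=> e; rewrite !(mulrA _ h) -!h_central -(mulrA h s1) -(mulrA h s2) -mulrBr -mulrDr e.
  by rewrite mulr0.
have cv := coef v (geometric_rec j (v_central w)).
have cw : h * w ^+ j.+2 - s1 * (h * w ^+ j.+1) + s2 * (h * w ^+ j) = 0.
  apply: coef.
  have -> : s1 = w + v by apply: addrC.
  have -> : s2 = w * v by apply: v_central.
  exact/geometric_rec/w_central.
rewrite /rcoef !scalerDr !scalerA opprD [X in X + _]addrACA [LHS]addrACA -!scalerBl -!scalerDl cw
  scale0r addr0.
by rewrite !mulrN -!opprD cv oppr0 scale0r.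
Qed.

(* The coefficient of u^p in (u - v) (u - v - h k) times the relation
   R(u - v) T_1(u) T_2(v) = T_2(v) T_1(u) R(u - v); here
   (u - v) (u - w) = u^2 - s1 u + s2 with w = v + h k. *)
Definition rtt_poly (p : int) : 'M[V]_n :=
  brk (T1 (p - 2)) 1%:M - s1 *: brk (T1 (p - 1)) 1%:M + s2 *: brk (T1 p) 1%:M
  - h *: (brk (T1 (p - 1)) P - w *: brk (T1 p) P)
  + h *: (brk (T1 (p - 1)) Q - v *: brk (T1 p) Q).

(** Multiplying by (u - v) (u - w) combines three consecutive coefficients. The lengths are chosen
    so that all three sums stop at T_1 of index p + K; [rcoef_rec] kills everything except the first
    terms, which form [rtt_poly]. *)
Lemma rtt_polyE p K : rtt_poly p = \sum_(j < K.+3) rterm (p - 2) j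
  - s1 *: \sum_(j < K.+2) rterm (p - 1) j + s2 *: \sum_(j < K.+1) rterm p j.
Proof.
have e3 : \sum_(j < K.+3) rterm (p - 2) j = brk (T1 (p - 2)) 1%:M + brk (T1 (p - 1)) (rcoef 1) +
    (brk (T1 p) (rcoef 2) + \sum_(j < K) brk (T1 (p + j.+1%:Z)) (rcoef j.+3)).
  rewrite 3!big_ord_recl -[RHS]addrA; congr (_ + (_ + (_ + _))).
  - by rewrite /rterm addr0.
  - by rewrite /rterm (_ : p - 2 + _ = p - 1) // -addrA.
  - by rewrite /rterm (_ : p - 2 + _ = p) // subrK.
  - by apply: eq_bigr => j _; rewrite /rterm !lift0; congr (brk (T1 _) _); lia.
have e2 : \sum_(j < K.+2) rterm (p - 1) j = brk (T1 (p - 1)) 1%:M + brk (T1 p) (rcoef 1) +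
    \sum_(j < K) brk (T1 (p + j.+1%:Z)) (rcoef j.+2).
  rewrite 2!big_ord_recl -[RHS]addrA; congr (_ + (_ + _)).
  - by rewrite /rterm addr0.
  - by rewrite /rterm (_ : p - 1 + _ = p) // subrK.
  - by apply: eq_bigr => j _; rewrite /rterm !lift0; congr (brk (T1 _) _); lia.
have e1 : \sum_(j < K.+1) rterm p j = brk (T1 p) 1%:M + \sum_(j < K) brk (T1 (p + j.+1%:Z))
  (rcoef j.+1).
  rewrite big_ord_recl; congr (_ + _); by rewrite /rterm addr0.
have e0 : \sum_(j < K) brk (T1 (p + j.+1%:Z)) (rcoef j.+3) -
    s1 *: \sum_(j < K) brk (T1 (p + j.+1%:Z)) (rcoef j.+2) +
    s2 *: \sum_(j < K) brk (T1 (p + j.+1%:Z)) (rcoef j.+1) = 0.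
  rewrite !scaler_sumr -sumrB -big_split big1 // => j _ /=.
  rewrite -!brkZ; [|exact: s2_central|exact: s1_central].
  by rewrite -scaleN1r -brkZ ?scaleN1r -?brkD ?rcoef_rec ?brkr0 // => x; rewrite mulN1r mulrN1.
rewrite e3 e2 e1 {e3 e2 e1}.
move: e0; move: (\sum_(j < K) _) (\sum_(j < K) _) (\sum_(j < K) _) => S3 S2 S1 e0.
have cX (y : V) j x : (forall z, y * z = z * y) -> h * y ^+ j * x = x * (h * y ^+ j).
  by move=> cy; rewrite -mulrA -(commrX j (esym (cy x))) mulrA h_central -mulrA.
have rE t1 c : brk t1 (rcoef c.+1) = - ((h * v ^+ c) *: brk t1 P) + (h * w ^+ c) *: brk t1 Q.
  rewrite /rcoef brkD !brkZ => [|x|x]; first by rewrite scaleNr.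
    by rewrite mulNr mulrN cX.
  by apply: cX => z; apply: w_central.
rewrite !rE !expr1 !expr0 !mulr1.
have hw : h * w = s1 * h - h * v by rewrite -h_central -mulrBr /s1 [v + w]addrC addrK.
have hv : h * v = s1 * h - h * w by rewrite -h_central -mulrBr /s1 addrK.
rewrite /rtt_poly; move: (brk (T1 (p - 2)) 1%:M) (brk (T1 (p - 1)) 1%:M) (brk (T1 p) 1%:M)
  (brk (T1 (p - 1)) P) (brk (T1 p) P) (brk (T1 (p - 1)) Q) (brk (T1 p) Q).
move=> b2 b1 b0 P1 P0 Q1 Q0.
have -> : h *: (P1 - w *: P0) = h *: P1 - (s1 * h) *: P0 + (h * v) *: P0.
  by rewrite scalerBr scalerA hw scalerBl opprB addrA addrAC.
have -> : h *: (Q1 - v *: Q0) = h *: Q1 - (s1 * h) *: Q0 + (h * w) *: Q0.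
  by rewrite scalerBr scalerA hv scalerBl opprB addrA addrAC.
rewrite !scalerDr !scalerN !scalerA; move: e0.
move: (s1 *: b1) (s2 *: b0) (h *: P1) ((s1 * h) *: P0) ((h * v) *: P0) (h *: Q1)
   ((s1 * h) *: Q0) ((h * w) *: Q0) (s1 *: S2) (s2 *: S3) => sb1 sb0 hP1 shP0 hvP0 hQ1 shQ0 hwQ0
     sS2 sS3 e0.
rewrite !opprD !opprK !addrA [RHS](ACl (1*7*11*2*8*4*3*9*5*(6*10*12))) /= e0 addr0.
by [].
Qed.

End RTTAlgebra.

Section Shifts.
Variables (M : pzRingType) (a c t r : M).

Lemma mul_shiftl : a * t - c = a * (t - 1) + (a - c).
Proof. by rewrite mulrBr mulr1 addrA subrK. Qed.

Lemma mul_shiftr : t * a - c = (t - 1) * a + (a - c).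
Proof. by rewrite mulrBl mul1r addrA subrK. Qed.

(** A commutator does not see constants. With a - c and t - 1 both divisible by h, the right-hand
    side exhibits divisibility by h^2. *)
Lemma commutator_shift : c * t = t * c ->
  a * t - t * a = (a - c) * (t - 1) - (t - 1) * (a - c).
Proof.
move=> ct; have -> : (a - c) * (t - 1) = a * t - (t * c + (a - c)).
  by rewrite mulrBr mulr1 mulrBl ct (opprD (t * c)) addrA.
have -> : (t - 1) * (a - c) = t * a - (t * c + (a - c)).
  by rewrite mulrBl mul1r mulrBr (opprD (t * c)) addrA.
by rewrite opprB addrA subrK.
Qed.

Lemma conj_shift : c * r = r * c -> r * a * t - t * a * r = r * (a * t - c) - (t * a - c) * r.
Proof. by move=> cr; rewrite mulrBr mulrBl mulrA cr opprB addrA subrK. Qed.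

End Shifts.

Section WeightMatrix.
Variables (A : pzRingType) (n : nat).
Local Notation V := {fps {fps A}}.

Definition mxwt al K (M : 'M[V]_n) := forall x y, wt_ge al K (M x y).

Lemma mxwtM al K L (M1 M2 : 'M[V]_n) :
  mxwt al K M1 -> mxwt al L M2 -> mxwt al (K + L) (M1 *m M2).
Proof. by move=> H1 H2 x y; rewrite mxE; apply: wt_ge_sum => z _; apply: wt_geM. Qed.

Lemma mxwtB al K (M1 M2 : 'M[V]_n) : mxwt al K M1 -> mxwt al K M2 -> mxwt al K (M1 - M2).
Proof. by move=> H1 H2 x y; rewrite !mxE; apply: wt_geB. Qed.

Lemma mxwtD al K (M1 M2 : 'M[V]_n) : mxwt al K M1 -> mxwt al K M2 -> mxwt al K (M1 + M2).
Proof. by move=> H1 H2 x y; rewrite !mxE; apply: wt_geD. Qed.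

Lemma mxwt_any al (M : 'M[V]_n) : mxwt al 0 M.
Proof. by move=> x y; apply: wt_ge_any. Qed.

Lemma mxwtMl al K (M1 M2 : 'M[V]_n) : mxwt al K M2 -> mxwt al K (M1 *m M2).
Proof. by rewrite -[K]add0n; apply/mxwtM/mxwt_any. Qed.

Lemma mxwtMr al K (M1 M2 : 'M[V]_n) : mxwt al K M1 -> mxwt al K (M1 *m M2).
Proof. by move=> H; rewrite -[K]addn0; apply: mxwtM => //; apply: mxwt_any. Qed.

Lemma mxwtZ al K z (M : 'M[V]_n) : wt_ge al K z -> mxwt al K (z *: M).
Proof. by move=> H x y; rewrite mxE; apply: wt_geMr. Qed.

Variables (h v k : V) (P Q T2 : 'M[V]_n) (T1 : int -> 'M[V]_n) (t1 : int -> bool).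
Hypotheses (h_wt : forall al, wt_ge al 1 h) (v_wt : wt_ge 1 1 v).
Hypotheses (T1_wt : forall p, mxwt 0 1 (T1 p - (t1 p)%:R%:M)) (T2_wt : mxwt 0 1 (T2 - 1%:M)).
Local Notation w := (v + h * k).
Local Notation Rc := (rcoef h v k P Q).
Local Notation rterm := (rterm h v k T1 T2 P Q).

Lemma rcoef_wt1 (j : nat) : mxwt 1 j (Rc j).
Proof.
case: j => [|c]; first exact: mxwt_any.
have ww : wt_ge 1 1 w by apply: wt_geD => //; apply: wt_geMr.
have E (x : V) : wt_ge 1 1 x -> wt_ge 1 c.+1 (h * x ^+ c).
  by move=> Hx; rewrite -(add1n c); apply: wt_geM => //; have := wt_geX (j := c) Hx;
    rewrite muln1.
by apply: mxwtD; apply: mxwtZ; [apply: wt_geN|]; apply: E.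
Qed.

Lemma rterm_wt1 p j : mxwt 1 j (rterm p j).
Proof.
have H : mxwt 1 j (Rc j) by apply: rcoef_wt1.
apply: mxwtB; last exact: mxwtMl.
by apply/mxwtMr/mxwtMr.
Qed.

Lemma rcoef_wt0 j : mxwt 0 1 (Rc j.+1).
Proof. by apply: mxwtD; apply: mxwtZ; [apply: wt_geN|]; apply: wt_geMr. Qed.

(** Every term is divisible by h^2. For j = 0 it is a commutator of two matrices that are constant
    modulo h. For j > 0 the coefficient of R supplies one h, and a second one appears because both
    orders of T_1 and T_2 reduce to the same constant modulo h. *)
Lemma rterm_wt0 p j : mxwt 0 2 (rterm p j).
Proof.
rewrite /rterm; move: (p + _) => q; rewrite /brk.
have H1 := T1_wt q; set c := _%:M in H1.
have cst (X : 'M[V]_n) : c *m X = X *m c.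
  by rewrite /c; case: (t1 q); rewrite ?mul1mx ?mulmx1 // -scalemx1 scale0r mul0mx mulmx0.
case: j => [|j].
  rewrite mul1mx mulmx1 (_ : _ - _ = (T1 q - c) *m (T2 - 1%:M) - (T2 - 1%:M) *m (T1 q - c)).
    by apply: mxwtB; apply: (@mxwtM 0 1 1).
  exact: commutator_shift (cst T2).
have HR : mxwt 0 1 (Rc j.+1) by apply: rcoef_wt0.
move: (Rc _) HR => R HR.
have H12 : mxwt 0 1 (T1 q *m T2 - c).
  rewrite (_ : _ - _ = T1 q *m (T2 - 1%:M) + (T1 q - c)); last exact: mul_shiftl.
  by apply: mxwtD => //; apply: mxwtMl.
have H21 : mxwt 0 1 (T2 *m T1 q - c).
  rewrite (_ : _ - _ = (T2 - 1%:M) *m T1 q + (T1 q - c)); last exact: mul_shiftr.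
  by apply: mxwtD => //; apply: mxwtMr.
rewrite (_ : _ - _ = R *m (T1 q *m T2 - c) - (T2 *m T1 q - c) *m R);
  last exact: (conj_shift _ _ (cst R)).
by apply: mxwtB; apply: (@mxwtM 0 1 1).
Qed.

Definition rtt_series p x y : V :=
  Fps (fun q => Fps (fun i => \sum_(j < (q + i).+1) rterm p j x y q i)).

Lemma rtt_series_wt0 p x y : wt_ge 0 2 (rtt_series p x y).
Proof. by move=> q i lt; rewrite /= big1 // => j _; rewrite (@rterm_wt0 p j x y q i lt). Qed.

Lemma rtt_series_approx p x y K :
  wt_ge 1 K (rtt_series p x y - (\sum_(j < K) rterm p j) x y).
Proof.
move=> q i; rewrite mul1n => lt; rewrite !fpsBE summxE !fps_sumE.
apply/eqP; rewrite subr_eq0; apply/eqP; rewrite /=.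
rewrite (big_ord_widen K (fun j => rterm p j x y q i)) // big_mkcond /=.
apply: eq_bigr => j _; case: ltnP => // le.
by rewrite (@rterm_wt1 p j) // mul1n; lia.
Qed.

Hypotheses (h_central : forall x, h * x = x * h) (v_central : forall x, v * x = x * v).
Hypothesis (k_central : forall x, k * x = x * k).

(** The telescoping is available for truncated sums only, so the two sides are compared modulo total
    degree K in v and h, for every K. *)
Lemma rtt_poly_series p x y : rtt_poly h v k T1 T2 P Q p x y =
  rtt_series (p - 2) x y - s1 h v k * rtt_series (p - 1) x y + s2 h v k * rtt_series p x y.
Proof.
apply/eqP; rewrite -subr_eq0; apply/eqP/(@wt_ge_inf _ 1) => K.
rewrite (rtt_polyE h_central v_central k_central _ _ _ _ p K).
have W q L : (K <= L)%N -> wt_ge 1 K (rtt_series q x y - (\sum_(j < L) rterm q j) x y).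
  by move=> le; apply: wt_geW le _; apply: rtt_series_approx.
move: (W (p - 2) K.+3 (leqW (leqW (leqnSn K)))) (W (p - 1) K.+2 (leqW (leqnSn K))) (W p K.+1
  (leqnSn K)).
move: (\sum_(j < K.+3) _) (\sum_(j < K.+2) _) (\sum_(j < K.+1) _).
move: (rtt_series (p - 2) x y) (rtt_series (p - 1) x y) (rtt_series p x y).
move: (s1 h v k) (s2 h v k) => z1 z2 a3 a2 a1 B3 B2 B1 H3 H2 H1.
rewrite !mxE; move: (B3 x y) (B2 x y) (B1 x y) H3 H2 H1 => b3 b2 b1 H3 H2 H1.
rewrite (_ : _ - _ = - ((a3 - b3) - z1 * (a2 - b2) + z2 * (a1 - b1))).
  apply/wt_geN/wt_geD; last exact: wt_geMl.
  by apply: wt_geB => //; apply: wt_geMl.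
by rewrite !mulrBr !opprD !opprK !addrA [LHS](ACl (4*1*5*2*6*3)).
Qed.

End WeightMatrix.

Lemma mul_central_sqr (V : pzRingType) (h a b c z1 z2 : V) : (forall x, h * x = x * h) ->
  h * (h * a) - z1 * (h * (h * b)) + z2 * (h * (h * c)) = h * (h * (a - z1 * b + z2 * c)).
Proof.
move=> hc; have E z x : z * (h * (h * x)) = h * (h * (z * x)).
  by rewrite mulrA -hc -mulrA; congr (_ * _); rewrite mulrA -hc -mulrA.
by rewrite !E !mulrDr !mulrN.
Qed.

Section RTT.
Variables (F : fieldType) (g : bcd_type) (N : nat).
Local Notation A := (freealg F N).
Local Notation Ah := {fps A}.
Local Notation V := {fps Ah}.
Local Notation kap := (kappa F g N).
Local Notation h := (fpsC (fpsX A) : V).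
Local Notation v := (fpsX Ah).
Local Notation k := (fpsC (fpsC kap%:MP) : V).
Local Notation T2 := (T2 F N).
Local Notation T1 := (T1coef F N).
Local Notation P := (@Pmx V N 2 ord0 ord_max).
Local Notation Q := (@Qmx V g N 2 ord0 ord_max).

Lemma h_central (x : V) : h * x = x * h.
Proof. by apply: fpsC_central => y; apply: fpsX_comm. Qed.

Lemma k_central (x : V) : k * x = x * k.
Proof. by apply: fpsC_central => y; apply: fpsC_central => z; apply: malgC_central. Qed.

Lemma v_central (x : V) : v * x = x * v.
Proof. exact: fpsX_comm. Qed.

Definition Tgens : 'M[{fps Ah}]_N :=
  \matrix_(i, j) Fps (fun s => fpsX A * fpsC (tgen F i j s)).

Lemma slot_Tplus (a : 'I_2) : slot a (Tplus F N) = 1%:M - slot a Tgens.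
Proof.
have -> : Tplus F N = 1%:M - Tgens by apply/matrixP => i j; rewrite !mxE.
by rewrite raddfB; congr (_ - _); apply: slot1.
Qed.

Lemma slot_Tgens0 (a : 'I_2) x y q : (slot a Tgens x y) q 0%N = 0.
Proof. by rewrite slotE; case: ifP => // _; rewrite mxE fpsX_mulE. Qed.

Lemma T1coef_wt0 p : mxwt 0 1 (T1 p - ((p == 0)%:R)%:M).
Proof.
move=> x y q [|n] // _; case: p => [s|s]; last first.
  by rewrite /= !mxE mul0rn subr0.
rewrite [T1 _]/= slot_Tplus; have := slot_Tgens0 ord0 x y s.
move: (slot _ Tgens) => G G0; rewrite !mxE !fpsBE fpsCE.
case: q => [|q].
  rewrite fpsBE G0 subr0.
  by case: s {G0} => [|s]; case: (x == y); rewrite /= ?subrr ?subr0.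
by case: s {G0} => [|s]; case: (x == y); rewrite /= ?subrr ?subr0.
Qed.

Lemma T2_wt0 : mxwt 0 1 (T2 - 1%:M).
Proof.
move=> x y q [|n] // _; rewrite /T2 slot_Tplus.
rewrite addrC addKr; have := slot_Tgens0 ord_max x y q.
by move: (slot _ Tgens) => G G0; rewrite mxE fpsNE G0 oppr0.
Qed.

Lemma rtt_mxE p q x y : rtt_mx F g N p q x y = rtt_series h v k P Q T2 T1 p x y q.
Proof.
rewrite mxE; apply: fpsP => i; rewrite /=; apply: eq_bigr => j _.
by rewrite /rterm /brk; case: (nat_of_ord j).
Qed.

(** Stronger than membership in the ideal: h^2 is split off with a cofactor that is itself in the
    ideal, because the relations were divided by h^2. This makes the cancellation on the diagonal
    possible. *)
Lemma rtt_poly_ideal p x y :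
  exists2 Z : V, allJ g Z & rtt_poly h v k T1 T2 P Q p x y = h * (h * Z).
Proof.
(* Division by h^2 shifts the coefficients in h by two places; the two lowest ones vanish by
   [rtt_series_wt0]. *)
pose R p : V := Fps (fun q => Fps (fun n => rtt_series h v k P Q T2 T1 p x y q n.+2)).
have h_wt al : wt_ge al 1 h by apply: wt_ge_h.
have v_wt : wt_ge 1 1 v by apply: wt_ge_v.
have RE r : rtt_series h v k P Q T2 T1 r x y = h * (h * R r).
  apply: fpsP => q; apply: fpsP => n; rewrite !fpsC_mulE fpsX_mulE.
  have W := @rtt_series_wt0 _ _ h v k P Q T2 T1 (fun p => p == 0) h_wt T1coef_wt0 T2_wt0 r x y q.
  case: n => [|n]; first by rewrite W.
  by rewrite fpsX_mulE; case: n => [|n] //; rewrite W.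
have RJ r : allJ g (R r).
  move=> q; apply: inJ_rel; right; exists r, q, x, y.
  have := congr1 (fun f : V => f q) (RE r); rewrite -rtt_mxE !fpsC_mulE => ->.
  by rewrite expr2 mulrA.
exists (R (p - 2) - s1 h v k * R (p - 1) + s2 h v k * R p).
  by apply: allJD; [apply: allJB => //|]; apply: allJMl.
rewrite (rtt_poly_series P Q T2 T1 h_wt v_wt h_central v_central k_central).
rewrite (RE (p - 2)) (RE (p - 1)) (RE p).
exact: (mul_central_sqr _ _ _ _ _ h_central).
Qed.

End RTT.

(** * Substituting the spectral parameters *)

Lemma fpsCD (A : zmodType) (a b : A) : fpsC (a + b) = fpsC a + fpsC b.
Proof. by apply: fpsP => n /=; case: eqP; rewrite ?addr0. Qed.

Lemma fpsCM (A : pzRingType) (a b : A) : fpsC (a * b) = fpsC a * fpsC b.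
Proof. exact: rmorphM. Qed.

Lemma rtt_combination_coef (V : pzRingType) (z v w h : V) (a2 a1 a0 cP dP cQ dQ : {fps V}) p :
  (a2 - fpsC z * a1 + fpsC v * (fpsC w * a0) - fpsC h * (cP - fpsC w * dP)
   + fpsC h * (cQ - fpsC v * dQ)) p =
  a2 p - z * a1 p + v * w * a0 p - h * (cP p - w * dP p) + h * (cQ p - v * dQ p).
Proof.
by rewrite !(fpsDE, fpsNE) !fpsC_mulE !(fpsDE, fpsNE) !fpsC_mulE mulrA.
Qed.

(* Psi stands for a substitution of u and v.  It cannot be a ring morphism, as
   the values of f(u) and g(v) do not commute: it is only required to respect
   products of a series in u by a series in v, in either order. *)
Section Substitution.
Variables (A B : pzRingType) (n : nat).
Local Notation V := {fps A}.
Local Notation W := {fps V}.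
Variables (Psi : W -> B) (psi1 psi2 : {fps A} -> B) (th : A -> B) (u v : B).
Hypothesis PsiB : forall x y, Psi (x - y) = Psi x - Psi y.
Hypothesis Psi_u : forall X, Psi (fpsX V * X) = u * Psi X.
Hypothesis Psi_v : forall X, Psi (fpsC (fpsX A) * X) = v * Psi X.
Hypothesis Psi_c : forall a X, Psi (fpsC (fpsC a) * X) = th a * Psi X.
Hypothesis Psi_fg : forall f g, Psi (fps_map (@fpsC A) f * fpsC g) = psi1 f * psi2 g.
Hypothesis Psi_gf : forall f g, Psi (fpsC g * fps_map (@fpsC A) f) = psi2 g * psi1 f.

Let Psi0 : Psi 0 = 0.
Proof. by have := PsiB 0 0; rewrite !subrr. Qed.
Let PsiN x : Psi (- x) = - Psi x.
Proof. by have := PsiB 0 x; rewrite Psi0 !sub0r. Qed.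
Let PsiD x y : Psi (x + y) = Psi x + Psi y.
Proof. by have := PsiB x (- y); rewrite PsiN !opprK. Qed.
Let Psi_sum (I : finType) (F : I -> W) : Psi (\sum_i F i) = \sum_i Psi (F i).
Proof. exact: (big_morph Psi PsiD Psi0). Qed.

Variables (S1 S2 : 'M[{fps A}]_n).

(** The difference M S1(u) S2(v) - S2(v) S1(u) M for a constant matrix M, with u as the outer
    variable. The RTT relation is a combination of those for M = 1, P and Q. *)
Definition biseries (M : 'M[A]_n) : 'M[W]_n :=
  map_mx (fun a => fpsC (fpsC a)) M *m map_mx (fps_map (@fpsC A)) S1 *m map_mx (@fpsC V) S2
  - map_mx (@fpsC V) S2 *m map_mx (fps_map (@fpsC A)) S1 *m map_mx (fun a => fpsC (fpsC a)) M.

Definition subst_biseries (M : 'M[A]_n) : 'M[B]_n :=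
  map_mx th M *m map_mx psi1 S1 *m map_mx psi2 S2
  - map_mx psi2 S2 *m map_mx psi1 S1 *m map_mx th M.

Lemma Psi_biseries (M : 'M[A]_n) x y : (forall i j a, M i j * a = a * M i j) ->
  (forall i j b, th (M i j) * b = b * th (M i j)) ->
  Psi (biseries M x y) = subst_biseries M x y.
Proof.
move=> cM cthM.
have cW i j (X : W) : X * fpsC (fpsC (M i j)) = fpsC (fpsC (M i j)) * X.
  by apply/esym; do 2!apply: fpsC_central => ?; apply: cM.
rewrite mxE [RHS]mxE PsiD [in X in _ + X]mxE PsiN; congr (_ + _).
  rewrite -mulmxA mxE Psi_sum -mulmxA mxE; apply: eq_bigr => i _.
  rewrite mxE Psi_c [in RHS]mxE; congr (_ * _).
  rewrite mxE Psi_sum mxE; apply: eq_bigr => j _.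
  by rewrite !mxE Psi_fg.
rewrite [in RHS]mxE; congr (- _).
rewrite mxE Psi_sum mxE; apply: eq_bigr => i _.
rewrite [X in _ * X]mxE [X in _ = _ * X]mxE cW Psi_c cthM; congr (_ * _).
rewrite mxE Psi_sum mxE; apply: eq_bigr => j _.
by rewrite !mxE Psi_gf.
Qed.

Lemma biseries_coef (M : 'M[A]_n) x y p : (biseries M x y) p =
  brk S2 (map_mx (fun f => fpsC (fcoef f p)) S1) (map_mx (@fpsC A) M) x y.
Proof.
rewrite mxE fpsDE [in RHS]mxE; congr (_ + _).
  rewrite mxE fps_sumE [RHS]mxE; apply: eq_bigr => i _.
  rewrite [X in _ * X]mxE mul_fpsCE; congr (_ * _).
  rewrite mxE fps_sumE [RHS]mxE; apply: eq_bigr => j _.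
  by rewrite !mxE fpsC_mulE.
rewrite !mxE fpsNE; congr (- _); rewrite fps_sumE; apply: eq_bigr => i _.
rewrite [X in _ * X]mxE mul_fpsCE [X in _ = _ * X]mxE; congr (_ * _).
rewrite mxE fps_sumE [RHS]mxE; apply: eq_bigr => j _.
by rewrite !mxE fpsC_mulE.
Qed.

Variables (h k : A) (T1 : int -> 'M[V]_n) (P Q : 'M[A]_n).
Local Notation w := (v + th h * th k).
Hypothesis T1E : forall s : nat, T1 s%:Z = map_mx (fun f => fpsC (fcoef f s)) S1.
Hypothesis T1N : forall s : nat, T1 (Negz s) = 0.

Lemma Psi_rtt_poly x y (Z : nat -> V) :
  (forall p : nat, rtt_poly (fpsC h) (fpsX A) (fpsC k) T1 S2 (map_mx (@fpsC A) P)
     (map_mx (@fpsC A) Q) p%:Z x y = fpsC h * (fpsC h * Z p)) ->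
  let b M := Psi (biseries M x y) in
  u * (u * b 1%:M) - (v + w) * (u * b 1%:M) + v * (w * b 1%:M)
  - th h * (u * b P - w * b P) + th h * (u * b Q - v * b Q)
  = th h * (th h * Psi (Fps Z)).
Proof.
move=> HZ b.
pose U := fpsX V; pose G M := biseries M x y; pose vW := fpsC (fpsX A) : W.
pose hW := fpsC (fpsC h) : W; pose kW := fpsC (fpsC k) : W; pose wW := vW + hW * kW.
have e : U * (U * G 1%:M) - (vW + wW) * (U * G 1%:M) + vW * (wW * G 1%:M)
  - hW * (U * G P - wW * G P) + hW * (U * G Q - vW * G Q) = hW * (hW * Fps Z).
  have wE : wW = fpsC (fpsX A + fpsC h * fpsC k) by rewrite fpsCD fpsCM.
  have vwE : vW + wW = fpsC (s1 (fpsC h) (fpsX A) (fpsC k)) by rewrite wE -fpsCD.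
  have GE M p : G M p = brk S2 (T1 p%:Z) (map_mx (@fpsC A) M) x y by rewrite /G biseries_coef T1E.
  have brkN M s : brk S2 (T1 (Negz s)) M = 0 by rewrite T1N brk0.
  apply: fpsP => p; rewrite vwE wE.
  rewrite rtt_combination_coef.
  rewrite [RHS]fpsC_mulE [in RHS]fpsC_mulE [RHS]/= -HZ /rtt_poly.
  (* For small exponents the index of T_1 becomes negative. The corresponding term is zero by [T1N],
     in agreement with the missing low coefficients of a multiple of u. *)
  have U1 M q : (U * G M) q = brk S2 (T1 (q%:Z - 1)) (map_mx (@fpsC A) M) x y.
    rewrite /U fpsX_mulE; case: q => [|q].
      by rewrite (_ : 0%:Z - 1 = Negz 0) // brkN mxE.
    by rewrite GE; congr (brk S2 (T1 _) _ x y); lia.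
  have U2 M : (U * (U * G M)) p = brk S2 (T1 (p%:Z - 2)) (map_mx (@fpsC A) M) x y.
    rewrite [in LHS]/U fpsX_mulE; case: p => [|q].
      by rewrite (_ : 0%:Z - 2 = Negz 1) // brkN mxE.
    by rewrite U1; congr (brk S2 (T1 _) _ x y); lia.
  clearbody U G.
  rewrite U2 (U1 1%:M) (U1 P) (U1 Q) (GE 1%:M) (GE P) (GE Q) map_mx1.
  move: (brk S2 (T1 (p%:Z - 2)) 1%:M) (brk S2 (T1 (p%:Z - 1)) 1%:M) (brk S2 (T1 p) 1%:M).
  move: (brk S2 (T1 (p%:Z - 1)) _) (brk S2 (T1 p) (map_mx _ P)) (brk S2 (T1 (p%:Z - 1)) _) (brk
    S2 (T1 p) (map_mx _ Q)).
  by move=> b6 b5 b4 b3 b2 b1 b0; rewrite !mxE.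
have Pw X : Psi (wW * X) = w * Psi X.
  by rewrite /wW [in LHS]mulrDl PsiD Psi_v -mulrA !Psi_c [in RHS]mulrDl mulrA.
have Pvw X : Psi ((vW + wW) * X) = (v + w) * Psi X.
  by rewrite [in LHS]mulrDl PsiD Psi_v Pw [in RHS]mulrDl.
have PU X : Psi (U * X) = u * Psi X by apply: Psi_u.
have Pv X : Psi (vW * X) = v * Psi X by apply: Psi_v.
have Ph X : Psi (hW * X) = th h * Psi X by apply: Psi_c.
have bE M : b M = Psi (G M) by [].
clearbody b G U wW kW hW vW; rewrite !bE; have := congr1 Psi e.
by rewrite !(PsiD, PsiB, PsiN) !(Ph, Pvw, Pv, Pw, PsiB, PU).
Qed.

(** Collects the terms in z = u - v. The coefficients of the brackets with 1, P and Q become those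
    of [Rword] at z. *)
Lemma subst_rtt x y (Z : nat -> V) :
  (forall p : nat, rtt_poly (fpsC h) (fpsX A) (fpsC k) T1 S2 (map_mx (@fpsC A) P)
     (map_mx (@fpsC A) Q) p%:Z x y = fpsC h * (fpsC h * Z p)) ->
  (forall b, v * b = b * v) -> (forall b, th h * b = b * th h) ->
  (forall b, th k * b = b * th k) -> (forall b, u * b = b * u) ->
  let b M := Psi (biseries M x y) in let z := u - v in
  z * (z - th h * th k) * b 1%:M - th h * (z - th h * th k) * b P
  + th h * z * b Q = th h * (th h * Psi (Fps Z)).
Proof.
move=> HZ cv ch ck cu b z; rewrite -(Psi_rtt_poly HZ) -/b.
have ew : z - th h * th k = u - w by rewrite /z opprD addrA.
rewrite ew; congr (_ - _ + _).
- rewrite /z !mulrA -mulrBl -mulrDl; congr (_ * _).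
  rewrite mulrBl !mulrBr mulrDl (cu w) !opprB !opprD !addrA.
  by rewrite [LHS](ACl (1*4*2*3)).
- by rewrite -mulrA mulrBl.
- by rewrite -mulrA mulrBl.
Qed.

End Substitution.

Lemma fps_mapE (A B : Type) (f : A -> B) (X : {fps A}) n : fps_map f X n = f (X n).
Proof. by []. Qed.

Section MapAux.
Variables (A B : zmodType) (f : A -> B).
Hypothesis fB : forall x y, f (x - y) = f x - f y.

Lemma fps_mapB x y : fps_map f (x - y) = fps_map f x - fps_map f y.
Proof. by apply: fpsP => n; rewrite /= fB. Qed.

Lemma fps_map_additiveD x y : fps_map f (x + y) = fps_map f x + fps_map f y.
Proof.
have f0 : f 0 = 0 by have := fB 0 0; rewrite !subrr.
have fN z : f (- z) = - f z by have := fB 0 z; rewrite f0 !sub0r.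
apply: fpsP => n; rewrite /=.
by have := fB (x n) (- y n); rewrite fN !opprK.
Qed.

End MapAux.

Lemma zmod_map0 (A B : zmodType) (f : A -> B) :
  (forall x y, f (x - y) = f x - f y) -> f 0 = 0.
Proof. by move=> fB; have := fB 0 0; rewrite !subrr. Qed.

Section MapMul.
Variables (A B : pzRingType) (f : A -> B).

Lemma fps_map_Xmul (X : {fps A}) : f 0 = 0 ->
  fps_map f (fpsX A * X) = fpsX B * fps_map f X.
Proof. by move=> f0; apply: fpsP => n; rewrite !fps_mapE !fpsX_mulE; case: n. Qed.

Lemma fps_map_Cmul a b (X : {fps A}) : (forall x, f (a * x) = b * f x) ->
  fps_map f (fpsC a * X) = fpsC b * fps_map f X.
Proof. by move=> fab; apply: fpsP => n; rewrite !fps_mapE !fpsC_mulE fab. Qed.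

End MapMul.

(** * Exchanging and identifying the two variables *)

Section Swap.
Variable A : pzRingType.
Implicit Types X : {fps {fps A}}.

(** [fps_shift] acts on the variable directly above h, so u and v have to be brought to that place
    in turn. *)
Definition swap X : {fps {fps A}} := Fps (fun t => Fps (fun s => X s t)).

Lemma swapE X t s : swap X t s = X s t.
Proof. by []. Qed.

Lemma swapB X Y : swap (X - Y) = swap X - swap Y.
Proof. by []. Qed.

Lemma swap_Xmul X : swap (fpsX {fps A} * X) = fpsC (fpsX A) * swap X.
Proof.
apply: fpsP => t; apply: fpsP => s; rewrite swapE fpsC_mulE !fpsX_mulE.
by case: s.
Qed.

Lemma swap_CXmul X : swap (fpsC (fpsX A) * X) = fpsX {fps A} * swap X.
Proof.
apply: fpsP => t; apply: fpsP => s; rewrite swapE fpsC_mulE !fpsX_mulE.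
by case: t.
Qed.

Lemma swap_CCmul a X : swap (fpsC (fpsC a) * X) = fpsC (fpsC a) * swap X.
Proof.
by apply: fpsP => t; apply: fpsP => s; rewrite swapE !fpsC_mulE.
Qed.

(* The substitution of the inner variable for the outer one. *)
Definition diag X : {fps A} := Fps (fun n => \sum_(i < n.+1) X i (n - i)%N).

Lemma diagE X n : diag X n = \sum_(i < n.+1) X i (n - i)%N.
Proof. by []. Qed.

Lemma diagB X Y : diag (X - Y) = diag X - diag Y.
Proof. by apply: fpsP => n; rewrite fpsBE !diagE -sumrB; apply: eq_bigr. Qed.

Lemma diag_Xmul X : diag (fpsX {fps A} * X) = fpsX A * diag X.
Proof.
apply: fpsP => n; rewrite diagE [RHS]fpsX_mulE big_ord_recl [X in X + _](_ : _ = 0); last first.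
  by rewrite fpsX_mulE.
rewrite add0r; case: n => [|n]; first by rewrite big_ord0.
by apply: eq_bigr => i _; rewrite lift0 fpsX_mulE subSS.
Qed.

Lemma diag_CXmul X : diag (fpsC (fpsX A) * X) = fpsX A * diag X.
Proof.
apply: fpsP => n; rewrite diagE [RHS]fpsX_mulE big_ord_recr.
rewrite (_ : (fpsC (fpsX A) * X) (ord_max : 'I_n.+1) _ = 0); last first.
  by rewrite fpsC_mulE subnn fpsX_mulE.
apply: etrans (addr0 _) _; case: n => [|n]; first by rewrite big_ord0.
rewrite diagE; apply: eq_bigr => i _; rewrite fpsC_mulE fpsX_mulE.
have le : (widen_ord (leqnSn n.+1) i <= n)%N := leq_ord i.
by rewrite (subSn le).
Qed.

Lemma diag_CCmul a X : diag (fpsC (fpsC a) * X) = fpsC a * diag X.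
Proof.
apply: fpsP => n; rewrite fpsC_mulE diagE mulr_sumr; apply: eq_bigr => i _.
by rewrite !fpsC_mulE.
Qed.

Lemma diag_mul (f g : {fps A}) : diag (fpsC f * fps_map (@fpsC A) g) = f * g.
Proof.
apply: fpsP => n; rewrite [RHS](fps_mul_rev f) diagE; apply: eq_bigr => i _.
by rewrite fpsC_mulE mul_fpsCE.
Qed.

Lemma diag_mul_rev (f g : {fps A}) : diag (fps_map (@fpsC A) g * fpsC f) = g * f.
Proof.
apply: fpsP => n; rewrite fpsME diagE; apply: eq_bigr => i _.
by rewrite mul_fpsCE fpsC_mulE.
Qed.

End Swap.

Section ShiftTwo.
Variables (A : pzRingType) (c c' : A).
Hypotheses (cc : forall x, c * x = x * c) (cc' : forall x, c' * x = x * c').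
Local Notation Ah := {fps A}.
Local Notation V := {fps Ah}.
Local Notation W := {fps V}.
Local Notation sh := (@fps_shift A c).
Local Notation sh' := (@fps_shift A c').

(* u |-> u + c h and v |-> v + c' h, after which the variables are exchanged. *)
Definition shift2 (X : W) : W := fps_map sh (swap (fps_map sh' X)).

Let shB x y : sh (x - y) = sh x - sh y.
Proof. exact: fps_shift_is_zmod_morphism. Qed.
Let shB' x y : sh' (x - y) = sh' x - sh' y.
Proof. exact: fps_shift_is_zmod_morphism. Qed.

Lemma shift2B X Y : shift2 (X - Y) = shift2 X - shift2 Y.
Proof. by rewrite /shift2 (fps_mapB shB') swapB (fps_mapB shB). Qed.

Lemma shift2_u X : shift2 (fpsX V * X) = fpsC (fpsX Ah + fpsC (fpsC c * fpsX A)) * shift2 X.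
Proof.
rewrite /shift2 fps_map_Xmul ?(zmod_map0 shB') // swap_Xmul.
by apply: fps_map_Cmul => x; apply: fps_shiftX.
Qed.

Lemma shift2_v X :
  shift2 (fpsC (fpsX Ah) * X) = (fpsX V + fpsC (fpsC (fpsC c' * fpsX A))) * shift2 X.
Proof.
rewrite /shift2 (fps_map_Cmul _ (fps_shiftX c')).
move: (fps_map _ X) => Y; rewrite fpsCD mulrDl [RHS]mulrDl.
transitivity (fps_map sh (fpsX V * swap Y + fpsC (fpsC (fpsC c' * fpsX A)) * swap Y)).
  by rewrite -swap_CXmul -swap_CCmul.
rewrite (fps_map_additiveD shB) fps_map_Xmul ?(zmod_map0 shB) //; congr (_ + _).
by apply: fps_map_Cmul => x; apply: fps_shift_Cmul.
Qed.

Lemma shift2_c a X : shift2 (fpsC (fpsC a) * X) = fpsC (fpsC a) * shift2 X.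
Proof.
rewrite /shift2 (@fps_map_Cmul _ _ _ _ (fpsC a)) => [|x]; last exact: fps_shift_Cmul.
by rewrite swap_CCmul; apply: fps_map_Cmul => x; apply: fps_shift_Cmul.
Qed.

Lemma shift2_fg f g : shift2 (fps_map (@fpsC Ah) f * fpsC g) =
  fpsC (sh f) * fps_map (@fpsC Ah) (sh' g).
Proof.
apply: fpsP => t; rewrite fpsC_mulE !fps_mapE -fps_shift_mulC //.
congr (sh _); apply: fpsP => s; rewrite mul_fpsCE.
by rewrite swapE fps_mapE mul_fpsCE fps_mapE fps_shift_Cmul // fpsC_mulE.
Qed.

Lemma shift2_gf f g : shift2 (fpsC g * fps_map (@fpsC Ah) f) =
  fps_map (@fpsC Ah) (sh' g) * fpsC (sh f).
Proof.
apply: fpsP => t; rewrite mul_fpsCE !fps_mapE -fps_shift_Cmul //.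
congr (sh _); apply: fpsP => s; rewrite fpsC_mulE.
by rewrite swapE fps_mapE fpsC_mulE fps_mapE fps_shift_mulC // mul_fpsCE.
Qed.

End ShiftTwo.

Lemma map_brk (A B : pzRingType) (q : {rmorphism A -> B}) n (t2 t1 X : 'M[A]_n) :
  map_mx q (brk t2 t1 X) = brk (map_mx q t2) (map_mx q t1) (map_mx q X).
Proof. by rewrite /brk map_mxB !map_mxM. Qed.

(** With z = h d every coefficient of the R-matrix is homogeneous of degree two in h. *)
Lemma factor_central_sqr (V : pzRingType) (h d k b1 bP bQ : V) :
  (forall x, h * x = x * h) ->
  (h * d) * (h * d - h * k) * b1 - h * (h * d - h * k) * bP + h * (h * d) * bQ
  = h * (h * (d * (d - k) * b1 - (d - k) * bP + d * bQ)).
Proof.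
move=> hc; rewrite -mulrBr; move: (d - k) => e.
have -> : h * d * (h * e) * b1 = h * (h * (d * e * b1)).
  by rewrite -!mulrA; congr (_ * _); rewrite mulrA -hc -mulrA.
by rewrite -!(mulrA h) -!mulrBr -!mulrDr.
Qed.

Lemma rmorph_factor (A B : pzRingType) (q : {rmorphism A -> B}) d k b1 bP bQ :
  q (d * (d - k) * b1 - (d - k) * bP + d * bQ) =
  q d * (q d - q k) * q b1 - (q d - q k) * q bP + q d * q bQ.
Proof. by rewrite rmorphD rmorphB !rmorphM rmorphB. Qed.

Lemma combination_eq (B : pzRingType) (a a' b b' c c' x x' y y' z z' : B) :
  a = a' -> x = x' -> b = b' -> y = y' -> c = c' -> z = z' ->
  a * x - b * y + c * z = a' * x' - b' * y' + c' * z'.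
Proof. by do 6!move=> ->. Qed.

Lemma brk_map_Rword (C : comPzRingType) (B : pzRingType) (phi : {rmorphism C -> B}) n
    (t2 t1 : 'M[B]_n) (t k x : C) (P Q : 'M[C]_n) i j :
  (forall c b, phi c * b = b * phi c) ->
  brk t2 t1 (map_mx phi (Rword t k x P Q)) i j =
  phi (x * (x - t * k)) * brk t2 t1 1%:M i j
  - phi (t * (x - t * k)) * brk t2 t1 (map_mx phi P) i j
  + phi (t * x) * brk t2 t1 (map_mx phi Q) i j.
Proof.
move=> cphi; rewrite /Rword !map_mxD !map_mxZ map_mx1 !brkD !brkZ //.
by rewrite !mxE rmorphN mulNr.
Qed.

Lemma brk_eq0 (B : pzRingType) n (t2 t1 X : 'M[B]_n) :
  (forall i j, brk t2 t1 X i j = 0) -> X * t1 * t2 = t2 * t1 * X.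
Proof.
move=> H; apply/eqP; rewrite -subr_eq0; apply/eqP/matrixP => i j.
by rewrite [RHS]mxE -(H i j).
Qed.

Lemma fps_map_rmorphM (A B : pzRingType) (phi : {rmorphism A -> B}) (x y : {fps A}) :
  fps_map phi (x * y) = fps_map phi x * fps_map phi y.
Proof. exact: (rmorphM (fps_map phi)). Qed.

Lemma fps_map_rmorphD (A B : pzRingType) (phi : {rmorphism A -> B}) (x y : {fps A}) :
  fps_map phi (x + y) = fps_map phi x + fps_map phi y.
Proof. exact: (rmorphD (fps_map phi)). Qed.

Lemma fps_map_CC (A B : pzRingType) (phi : {rmorphism A -> B}) a :
  fps_map (fps_map phi) (fpsC (fpsC a)) = fpsC (fpsC (phi a)).
Proof. exact: (etrans (fps_mapC _ _) (congr1 _ (fps_mapC _ _))). Qed.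

Lemma rmorph_Rcoef1 (A B : pzRingType) (phi : {rmorphism A -> B}) t k u v :
  phi ((u - v) * (u - v - t * k)) = (phi u - phi v) * (phi u - phi v - phi t * phi k).
Proof. by rewrite rmorphM !rmorphB rmorphM. Qed.

Lemma rmorph_Rcoef2 (A B : pzRingType) (phi : {rmorphism A -> B}) t k u v :
  phi (t * (u - v - t * k)) = phi t * (phi u - phi v - phi t * phi k).
Proof. by rewrite rmorphM !rmorphB rmorphM. Qed.

Lemma rmorph_Rcoef3 (A B : pzRingType) (phi : {rmorphism A -> B}) t u v :
  phi (t * (u - v)) = phi t * (phi u - phi v).
Proof. by rewrite rmorphM !rmorphB. Qed.

Lemma fpsCX_inj (A : pzRingType) (f f' : {fps {fps A}}) :
  fpsC (fpsX A) * f = fpsC (fpsX A) * f' -> f = f'.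
Proof.
move=> e; apply: fpsP => n; apply: fpsX_inj.
by rewrite -!fpsC_mulE e.
Qed.

Lemma diag_u (A : pzRingType) (a : A) (X : {fps {fps A}}) :
  diag (fpsC (fpsX A + fpsC a) * X) = (fpsX A + fpsC a) * diag X.
Proof.
rewrite fpsCD [in LHS]mulrDl [in RHS]mulrDl -diag_CXmul -diag_CCmul.
by apply: fpsP => n; rewrite fpsDE !diagE -big_split.
Qed.

Lemma diag_v (A : pzRingType) (a : A) (X : {fps {fps A}}) :
  diag ((fpsX {fps A} + fpsC (fpsC a)) * X) = (fpsX A + fpsC a) * diag X.
Proof.
rewrite [in LHS]mulrDl [in RHS]mulrDl -diag_Xmul -diag_CCmul.
by apply: fpsP => n; rewrite fpsDE !diagE -big_split.
Qed.

(** * RTT relations after the substitution *)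

Section YangianRelations.
Variables (F : comPzRingType) (A Y : pzRingType).
Variables (io : {rmorphism F -> A}) (pr : {rmorphism {fps A} -> Y}).
Hypothesis io_central : forall a x, io a * x = x * io a.
Hypothesis pr_surj : forall y, exists x, y = pr x.
Local Notation Ah := {fps A}.
Local Notation V := {fps Ah}.
Local Notation W := {fps V}.
Hypothesis pr_shift : forall a (f : V), (forall q, pr (f q) = 0) ->
  forall q, pr (fps_shift (io a) f q) = 0.
Variables (kap : F) (n : nat) (S1 S2 : 'M[V]_n) (T1 : int -> 'M[V]_n) (P Q : 'M[F]_n).
Hypothesis T1E : forall s : nat, T1 s%:Z = map_mx (fun f => fpsC (fcoef f s)) S1.
Hypothesis T1N : forall s : nat, T1 (Negz s) = 0.
Local Notation h := (fpsX A).
Local Notation k := (fpsC (io kap)).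
Local Notation iom M := (map_mx (fun a => fpsC (io a)) M).
Hypothesis rtt_zero : forall (p : nat) x y, exists2 Z : V, (forall q, pr (Z q) = 0) &
  rtt_poly (fpsC h) (fpsX Ah) (fpsC k) T1 S2 (map_mx (@fpsC Ah) (iom P))
     (map_mx (@fpsC Ah) (iom Q)) p%:Z x y = fpsC h * (fpsC h * Z).

Definition scal : {fps F} -> Y := pr \o fps_map io.
HB.instance Definition _ := GRing.RMorphism.on scal.

Lemma scalE x : scal x = pr (fps_map io x). Proof. by []. Qed.

Lemma scal_central c y : scal c * y = y * scal c.
Proof.
have [x ->] := pr_surj y; rewrite /scal /= -!rmorphM; congr (pr _).
exact: fps_map_central.
Qed.

Lemma pr_h_central y : pr h * y = y * pr h.
Proof. by have [x ->] := pr_surj y; rewrite -!rmorphM fpsX_comm. Qed.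

Variables (c c' : F).
Local Notation sh := (fps_shift (io c)).
Local Notation sh' := (fps_shift (io c')).
Local Notation S := (shift2 (io c) (io c')).

(** The cofactors for the different powers of u are chosen simultaneously, so that they form one
    series in u to which the substitution applies. *)
Lemma rtt_choice x y : exists2 Z : nat -> V, (forall p q, pr (Z p q) = 0) &
  forall p : nat, rtt_poly (fpsC h) (fpsX Ah) (fpsC k) T1 S2 (map_mx (@fpsC Ah) (iom P))
     (map_mx (@fpsC Ah) (iom Q)) p%:Z x y = fpsC h * (fpsC h * Z p).
Proof.
have H p : exists Z : V, (forall q, pr (Z q) = 0) /\
  rtt_poly (fpsC h) (fpsX Ah) (fpsC k) T1 S2 (map_mx (@fpsC Ah) (iom P))
     (map_mx (@fpsC Ah) (iom Q)) p%:Z x y = fpsC h * (fpsC h * Z).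
  by have [Z Z0 e] := rtt_zero p x y; exists Z.
have [Z HZ] := choice H.
by exists Z => p; have [] := HZ p.
Qed.

Lemma shift2_zero (Z : W) : (forall p q, pr (Z p q) = 0) -> forall p q, pr (S Z p q) = 0.
Proof.
move=> HZ p q; rewrite /shift2 fps_mapE; apply: pr_shift => s.
by rewrite swapE fps_mapE; apply: pr_shift.
Qed.

Section Diagonal.
Let Psi (X : W) : V := diag (S X).
Let d : F := c - c'.

Definition cst (a : F) : {fps Y} := fpsC (scal (fpsC a)).
Fact cst_zmod : zmod_morphism cst.
Proof. by move=> a b; rewrite /cst !raddfB. Qed.
Fact cst_monoid : monoid_morphism cst.
Proof. by split=> [|a b]; rewrite /cst ?rmorph1 ?rmorphM. Qed.
HB.instance Definition _ := GRing.isZmodMorphism.Build F {fps Y} cst cst_zmod.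
HB.instance Definition _ := GRing.isMonoidMorphism.Build F {fps Y} cst cst_monoid.

(* For v = u the factor u - v becomes (c - c') h, and the relation acquires an
   overall h^2; it is cancelled in the free algebra, since the dual Yangian may
   have h-torsion. *)
Lemma rtt_diagonal :
  let t1 := map_mx (fun f => fps_map pr (sh f)) S1 in
  let t2 := map_mx (fun f => fps_map pr (sh' f)) S2 in
  let R := map_mx cst (Rword 1 kap d P Q) in
  R * t1 * t2 = t2 * t1 * R.
Proof.
move=> t1 t2 R; apply: brk_eq0 => x y.
have ioc := io_central c; have ioc' := io_central c'.
have PB X X' : Psi (X - X') = Psi X - Psi X' by rewrite /Psi shift2B diagB.
have Pu X : Psi (fpsX V * X) = (fpsX Ah + fpsC (fpsC (io c) * h)) * Psi X.
  by rewrite /Psi shift2_u // diag_u.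
have Pv X : Psi (fpsC (fpsX Ah) * X) = (fpsX Ah + fpsC (fpsC (io c') * h)) * Psi X.
  by rewrite /Psi shift2_v // diag_v.
have Pc a X : Psi (fpsC (fpsC a) * X) = fpsC a * Psi X.
  by rewrite /Psi shift2_c // diag_CCmul.
have Pfg f f' : Psi (fps_map (@fpsC Ah) f * fpsC f') = sh f * sh' f'.
  by rewrite /Psi shift2_fg // diag_mul.
have Pgf f f' : Psi (fpsC f' * fps_map (@fpsC Ah) f) = sh' f' * sh f.
  by rewrite /Psi shift2_gf // diag_mul_rev.
have [Z Z0 HZ] := rtt_choice x y.
have Psi0 q : pr (Psi (Fps Z) q) = 0.
  by rewrite /Psi diagE raddf_sum big1 // => i _; apply: shift2_zero.
have hc (b : V) : fpsC h * b = b * fpsC h by apply: fpsC_central => z; apply: fpsX_comm.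
have cioV a (b : V) : fpsC (fpsC (io a)) * b = b * fpsC (fpsC (io a)).
  by apply: fpsC_central => z; apply: fpsC_central => w; apply: io_central.
have cu a (b : V) : (fpsX Ah + fpsC (fpsC (io a) * h)) * b = b * (fpsX Ah + fpsC (fpsC (io a) *
  h)).
  rewrite [in LHS]mulrDl [in RHS]mulrDr fpsX_comm; congr (_ + _).
  by apply: fpsC_central => z; apply: ch_comm; apply: io_central.
have ez : (fpsX Ah + fpsC (fpsC (io c) * h)) - (fpsX Ah + fpsC (fpsC (io c') * h))
   = fpsC h * fpsC (fpsC (io d)).
  rewrite hc -fpsCM opprD addrACA subrr add0r -raddfB; congr (fpsC _).
  by rewrite -mulrBl -!raddfB.
have E := subst_rtt PB Pu Pv Pc T1E T1N HZ (cu c') hc (cioV kap) (cu c).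
move: E; rewrite /= ez factor_central_sqr // => /fpsCX_inj/fpsCX_inj.
have bE M : Psi (biseries S1 S2 (iom M) x y) = brk (map_mx sh' S2) (map_mx sh S1) (map_mx (@fpsC
  Ah) (iom M)) x y.
  rewrite (Psi_biseries PB Pc Pfg Pgf) // => i j b; rewrite mxE.
    by apply: fpsC_central => z; apply: io_central.
  exact: cioV.
pose q : {rmorphism V -> {fps Y}} := fps_map pr.
have cstE a : q (fpsC (fpsC (io a))) = cst a.
  by rewrite /q /= fps_mapC /cst /scal /= fps_mapC.
have qE M : q (Psi (biseries S1 S2 (iom M) x y)) = brk t2 t1 (map_mx cst M) x y.
  rewrite bE; transitivity (map_mx q (brk (map_mx sh' S2) (map_mx sh S1)
    (map_mx (@fpsC Ah) (iom M))) x y); first by rewrite [RHS]mxE.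
  rewrite map_brk -!map_mx_comp; congr (brk _ _ _ x y).
  by apply/matrixP => i j; rewrite !mxE -cstE.
have q1 : q (Psi (biseries S1 S2 1%:M x y)) = brk t2 t1 1%:M x y.
  have := qE 1%:M; rewrite map_mx1 => <-; congr (q (Psi (biseries _ _ _ x y))).
  by apply/matrixP => i j; rewrite !mxE; case: (i == j);
    rewrite ?mulr1n ?mulr0n ?rmorph1 ?rmorph0.
have q0 : q (Psi (Fps Z)) = 0 by apply: fpsP => i; apply: Psi0.
clearbody q; move=> /(congr1 q); rewrite q0 => <-.
rewrite brk_map_Rword; last by move=> a b; apply: fpsC_central => z; apply: scal_central.
rewrite [RHS](rmorph_factor q) (cstE d) (cstE kap) !mul1r.
apply: (combination_eq _ (esym q1) _ (esym (qE P)) erefl (esym (qE Q))).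
  by apply: etrans (rmorphM cst _ _) _; congr (_ * _); apply: (rmorphB cst).
exact: (rmorphB cst).
Qed.

End Diagonal.
Section Cross.
Local Notation B := {fps {fps Y}}.
Local Notation CF := {fps {fps {fps F}}}.

Definition scal2 : CF -> B := fps_map (fps_map scal).
HB.instance Definition _ := GRing.RMorphism.on scal2.

Lemma scal2_central x b : scal2 x * b = b * scal2 x.
Proof. by apply: fps_map_central => y b'; apply: fps_map_central; apply: scal_central. Qed.

(** The parameter u + c h over the scalars. The variable u is now the inner one and v the outer one,
    in accordance with [shift2]. *)
Definition uvar : CF := fpsC (fpsX {fps F} + fpsC (fpsC c * fpsX F)).
Definition vvar : CF := fpsX {fps {fps F}} + fpsC (fpsC (fpsC c' * fpsX F)).
Definition hvar : CF := fpsC (fpsC (fpsX F)).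
Definition cvar (a : F) : CF := fpsC (fpsC (fpsC a)).

(** With u and v independent the relation may be projected at once: its right-hand side comes from
    the ideal and vanishes. Nothing is cancelled, and R keeps its factors of u - v. *)
Lemma rtt_cross :
  let t1 := map_mx (fun f => fpsC (fps_map pr (sh f))) S1 in
  let t2 := map_mx (fun f => fps_map (@fpsC Y) (fps_map pr (sh' f))) S2 in
  let R := map_mx scal2 (Rword hvar (cvar kap) (uvar - vvar) (map_mx cvar P) (map_mx cvar Q)) in
  R * t1 * t2 = t2 * t1 * R.
Proof.
move=> t1 t2 R; apply: brk_eq0 => x y.
have ioc := io_central c; have ioc' := io_central c'.
pose q : {rmorphism W -> B} := fps_map (fps_map pr).
pose Psi (X : W) : B := q (S X).
have PB X X' : Psi (X - X') = Psi X - Psi X' by rewrite /Psi shift2B rmorphB.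
have scE a : pr (fpsC (io a)) = scal (fpsC a) by rewrite scalE fps_mapC.
have qmapE X : q X = fps_map (fps_map pr) X by [].
have scal2E X : scal2 X = fps_map (fps_map scal) X by [].
have schE a : pr (fpsC (io a) * h) = scal (fpsC a * fpsX F).
  by rewrite scalE fps_map_rmorphM fps_mapC fps_mapX.
have uE : q (fpsC (fpsX Ah + fpsC (fpsC (io c) * h))) = scal2 uvar.
  rewrite qmapE scal2E /uvar !fps_mapC; congr fpsC.
  rewrite -[LHS]/(fps_map pr _) -[RHS]/(fps_map scal _).
  by rewrite !fps_map_rmorphD !fps_mapX !fps_mapC schE.
have vE : q (fpsX V + fpsC (fpsC (fpsC (io c') * h))) = scal2 vvar.
  by rewrite qmapE scal2E /vvar !fps_map_rmorphD !fps_mapX !fps_map_CC schE.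
have cE a : q (fpsC (fpsC (fpsC (io a)))) = scal2 (cvar a).
  by rewrite qmapE scal2E /cvar !fps_map_CC scE.
have hE : q (fpsC (fpsC h)) = scal2 hvar.
  by rewrite qmapE scal2E /hvar !fps_map_CC -[_ (fpsX F)]/(scal _) scalE fps_mapX.
have Pu X : Psi (fpsX V * X) = scal2 uvar * Psi X.
  by rewrite -uE /Psi shift2_u // rmorphM.
have Pv X : Psi (fpsC (fpsX Ah) * X) = scal2 vvar * Psi X.
  by rewrite -vE /Psi shift2_v // rmorphM.
have Pc a X : Psi (fpsC (fpsC a) * X) = q (fpsC (fpsC a)) * Psi X.
  by rewrite /Psi shift2_c // rmorphM.
have Pfg f f' : Psi (fps_map (@fpsC Ah) f * fpsC f') =
    fpsC (fps_map pr (sh f)) * fps_map (@fpsC Y) (fps_map pr (sh' f')).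
  rewrite /Psi shift2_fg // rmorphM; congr (_ * _); first exact: fps_mapC.
  by apply: fpsP => s; apply: fps_mapC.
have Pgf f f' : Psi (fpsC f' * fps_map (@fpsC Ah) f) =
    fps_map (@fpsC Y) (fps_map pr (sh' f')) * fpsC (fps_map pr (sh f)).
  rewrite /Psi shift2_gf // rmorphM; congr (_ * _); last exact: fps_mapC.
  by apply: fpsP => s; apply: fps_mapC.
have [Z Z0 HZ] := rtt_choice x y.
have Psi0 : Psi (Fps Z) = 0.
  by apply: fpsP => s; apply: fpsP => i; apply: shift2_zero.
have cc a b : q (fpsC (fpsC (fpsC (io a)))) * b = b * q (fpsC (fpsC (fpsC (io a)))).
  by rewrite cE scal2_central.
have hc b : q (fpsC (fpsC h)) * b = b * q (fpsC (fpsC h)) by rewrite hE scal2_central.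
have bE M : Psi (biseries S1 S2 (iom M) x y) = brk t2 t1 (map_mx scal2 (map_mx cvar M)) x y.
  rewrite (Psi_biseries PB Pc Pfg Pgf).
  - by congr (brk _ _ _ x y); apply/matrixP => i j; rewrite !mxE cE.
  - by move=> i j b; rewrite mxE; apply: fpsC_central => z; apply: io_central.
  - by move=> i j b; rewrite mxE cc.
have E := subst_rtt PB Pu Pv Pc T1E T1N HZ (scal2_central _) hc (cc kap) (scal2_central _).
cbv zeta in E; rewrite Psi0 !mulr0 in E; rewrite brk_map_Rword; last exact: scal2_central.
have b1 : brk t2 t1 1%:M x y = Psi (biseries S1 S2 1%:M x y).
  have := bE 1%:M.
  rewrite (_ : map_mx cvar 1%:M = 1%:M) ?map_mx1; last by apply/matrixP => i j;
    rewrite !mxE /cvar; case: (i == j); rewrite ?mulr1n ?mulr0n ?rmorph1 ?rmorph0.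
  move=> <-; congr (Psi (biseries _ _ _ x y)).
  by apply/matrixP => i j; rewrite !mxE; case: (i == j);
    rewrite ?mulr1n ?mulr0n ?rmorph1 ?rmorph0.
apply: etrans (combination_eq _ b1 _ (esym (bE P)) _ (esym (bE Q))) E.
- by rewrite hE cE; apply: rmorph_Rcoef1.
- by rewrite hE cE; apply: rmorph_Rcoef2.
- by rewrite hE; apply: rmorph_Rcoef3.
Qed.

End Cross.
End YangianRelations.

(** * Regular elements and the trace argument *)

Section Regular.
Variables (Y : pzRingType) (hh : Y).
Hypothesis hh_central : forall y, hh * y = y * hh.
Hypothesis hh_sep : forall y, (forall n, exists y', y = hh ^+ n * y') -> y = 0.

(* Comparing coefficients gives X_(t,s) = X_(t+1,s-1) + a h X_(t+1,s), and by
   iteration every coefficient of X is divisible by all powers of h. *)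
Lemma linear_factor_regular (a : Y) (X : {fps {fps Y}}) :
  (fpsC (fpsX Y) - fpsX {fps Y} + fpsC (fpsC (a * hh))) * X = 0 -> X = 0.
Proof.
move=> e.
have E t s : X t s = (if s is s'.+1 then X t.+1 s' else 0) + a * hh * X t.+1 s.
  have := congr1 (fun f : {fps {fps Y}} => f t.+1 s) e.
  rewrite [in X in X -> _]mulrDl [in X in X -> _]mulrBl !fpsDE !fpsNE !fpsC_mulE !fpsX_mulE fps0E.
  by rewrite addrAC => /eqP; rewrite subr_eq0 => /eqP.
suff H n s t : exists y', X t s = hh ^+ n * y'.
  by apply: fpsP => t; apply: fpsP => s; apply: hh_sep => n; apply: H.
elim: n s t => [|n IHn] s t; first by exists (X t s); rewrite mul1r.
have H y : a * hh * (hh ^+ n * y) = hh ^+ n.+1 * (a * y).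
  rewrite exprS !mulrA; congr (_ * _); rewrite -hh_central -!mulrA; congr (_ * _).
  exact: (commrX n (esym (hh_central a))).
elim: s t => [|s IHs] t; rewrite E.
  by have [y ->] := IHn 0%N t.+1; exists (a * y); rewrite add0r H.
have [y ->] := IHs t.+1; have [y' ->] := IHn s.+1 t.+1.
by exists (y + a * y'); rewrite H mulrDr.
Qed.

End Regular.

Section FusionTrace.
Variables (C : comPzRingType) (B : pzRingType) (phi : {rmorphism C -> B}) (n : nat).
Hypothesis phi_central : forall c b, phi c * b = b * phi c.
Local Notation "M ^f" := (map_mx phi M).
Variables (S R R' L L' : 'M[C]_n) (c d d' : C) (X X' X'' : 'M[B]_n).
Hypotheses (SS : S * S = c *: S) (SR : S * R = L * S).
Hypotheses (RR' : R * R' = d *: (1 : 'M[C]_n)) (R'R : R' * R = d *: (1 : 'M[C]_n)).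
Hypothesis LL' : L' * L = d' *: (1 : 'M[C]_n).
Hypotheses (RX : R^f * X = X' * R^f) (SX : S^f * X' = X'' * S^f).
Hypothesis reg : forall b, phi (c * (d' * d)) * b = 0 -> b = 0.

(** Insert R' R, move R through X and cycle it to the front; replace S R' by L' S up to scalars.
    Since S X' S = c S X', a second S can be inserted and cycled to the left of R, where S R S = c S
    R makes R and R' meet and cancel. All scalars end up on both sides and are removed by [reg]. *)
Lemma fusion_trace : \tr (S^f * X) = \tr (S^f * X').
Proof.
(* The inverted form of S R = L S, with the scalars of the quasi-inverses kept. *)
have e1 : d' *: (S * R') = d *: (L' * S).
  rewrite -[S * R' in LHS]mul1r -scalemxMl -LL' -!mulrA (mulrA L) -SR -!mulrA RR'.
  by rewrite !scalemxMr mulr1.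
have e2 : S * R * S = c *: (S * R) by rewrite SR -mulrA SS scalemxMr.
have mapM M M' : (M * M')^f = M^f * M'^f by apply: map_mxM.
have trZ a M Y : \tr ((a *: M)^f * Y) = phi a * \tr (M^f * Y).
  by rewrite map_mxZ -[_ * _]/(_ *m _) -scalemxAl linearZ.
have scf a (M Y : 'M[B]_n) : (phi a *: M) * Y = phi a *: (M * Y).
  by rewrite -[_ * _]/(_ *m _) -scalemxAl.
have scfr a (M Y : 'M[B]_n) : M * (phi a *: Y) = phi a *: (M * Y).
  apply/matrixP => i j; rewrite !mxE mulr_sumr; apply: eq_bigr => k _.
  by rewrite !mxE !mulrA phi_central.
have e3 : S^f * X' * S^f = phi c *: (S^f * X').
  by rewrite SX -mulrA -mapM SS map_mxZ scfr.
have t1 : phi d * \tr (S^f * X) = \tr ((R * S * R')^f * X').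
  rewrite -trZ -[S in LHS]mulr1 -scalemxMr -R'R !mapM -!mulrA RX.
  by rewrite !mulrA -(trace_map_comm phi_central R) !mulrA.
have t2 : phi d' * \tr ((R * S * R')^f * X') = phi d * \tr ((R * L' * S)^f * X').
  by rewrite -!trZ; congr (\tr (map_mx _ _ * _)); rewrite -!mulrA -scalemxMr e1 scalemxMr.
(* Here the second copy of S enters, on the right of X', and cyclicity brings it to the front. *)
have t3 : phi c * \tr ((R * L' * S)^f * X') = \tr ((S * R * L' * S)^f * X').
  rewrite -linearZ /= [in LHS]mapM -mulrA -scfr -e3 !mulrA -(trace_map_comm phi_central S).
  by rewrite !mapM !mulrA.
have t4 : d *: (S * R * L' * S) = d' *: (c *: (d *: S)).
  rewrite -mulrA -scalemxMr -e1 scalemxMr mulrA e2 !scalemxMl; congr (_ *: (_ *: _)).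
  by rewrite -mulrA RR' scalemxMr mulr1.
suff H : phi (c * (d' * d)) * \tr (S^f * X) = phi (c * (d' * d)) * \tr (S^f * X').
  by apply/eqP; rewrite -subr_eq0; apply/eqP/reg; rewrite mulrBr H subrr.
rewrite [in LHS]rmorphM rmorphM -!mulrA t1 t2 (mulrA (phi c)) phi_central -mulrA.
rewrite t3 -trZ t4 !trZ !rmorphM !mulrA; congr (_ * _).
by rewrite -!rmorphM; congr (phi _); ring.
Qed.

End FusionTrace.

(** * The fused idempotent *)

Lemma enum_ord_adjacent m (a b : 'I_m) : b = a.+1 :> nat ->
  exists s1 s2, enum 'I_m = s1 ++ a :: b :: s2.
Proof.
move=> ab; exists (take a (enum 'I_m)), (drop b.+1 (enum 'I_m)).
rewrite -[LHS](cat_take_drop a); congr (_ ++ _).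
rewrite (drop_nth a) ?size_enum_ord // nth_ord_enum; congr (_ :: _).
by rewrite -ab (drop_nth b) ?size_enum_ord // nth_ord_enum.
Qed.

Lemma enum_ord_pairwise m : pairwise (fun a b : 'I_m => (a < b)%N) (enum 'I_m).
Proof.
have := iota_ltn_sorted 0 m; rewrite -val_enum_ord sorted_pairwise; last exact: ltn_trans.
by rewrite pairwise_map.
Qed.

(** The recursive form on lists can be cut at two neighbouring indices, which [full_adjacent]
    requires. *)
Lemma prod_pairs_full (M : pzRingType) m (r : 'I_m -> 'I_m -> M) (s : seq 'I_m) :
  pairwise (fun a b : 'I_m => (a < b)%N) s ->
  \prod_(a <- s) \prod_(b <- s | (a < b)%N) r a b = full r s.
Proof.
elim: s => [|a s IH]; first by rewrite big_nil.
rewrite [pairwise _ _]/= big_cons => /andP[/allP lta lts] /=.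
rewrite -IH // big_cons ltnn; congr (_ * _).
  by rewrite big_seq_cond [RHS]big_seq; apply: eq_bigl => b;
    case: (boolP (b \in s)) => // /lta ->.
rewrite big_seq [RHS]big_seq; apply: eq_bigr => x /lta ax.
by rewrite big_cons ltnNge (ltnW ax).
Qed.

Lemma prod_full (M : pzRingType) m (r : 'I_m -> 'I_m -> M) :
  \prod_(a < m) \prod_(b < m | (a < b)%N) r a b = full r (enum 'I_m).
Proof.
have ie : index_enum 'I_m = enum 'I_m by rewrite [index_enum _]unlock enumT.
rewrite -prod_pairs_full; last exact: enum_ord_pairwise.
by rewrite ie.
Qed.

Lemma scale_mul3 (C : comPzRingType) n (e1 e2 e3 : C) (X Y Z : 'M[C]_n) :
  (e1 *: X) * (e2 *: Y) * (e3 *: Z) = (e1 * e2 * e3) *: (X * Y * Z).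
Proof. by rewrite !(scalemxMl, scalemxMr) !scalerA; congr (_ *: _); ring. Qed.

Lemma scale_mul2 (C : comPzRingType) n (e1 e2 : C) (X Y : 'M[C]_n) :
  (e1 *: X) * (e2 *: Y) = (e1 * e2) *: (X * Y).
Proof. by rewrite !(scalemxMl, scalemxMr) !scalerA mulrC. Qed.

Section Fusion.
Variables (F : numFieldType) (g : bcd_type) (N : nat).
Hypotheses (N_ge2 : (2 <= N)%N) (N_even : g = Symplectic -> ~~ odd N).
Local Notation sg := (bcd_sign F g).
Local Notation kap := (kappa F g N).

Lemma kappa_sign : N%:R = kap + kap + sg + sg.
Proof.
have half : N%:R / 2%:R + N%:R / 2%:R = N%:R :> F.
  by rewrite -splitr.
by rewrite /kappa /bcd_sign; case: g; rewrite -[LHS]half; ring.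
Qed.

Variable m : nat.
Hypothesis m_le : g = Symplectic -> (m <= N./2)%N.
Local Notation ub := (@ubar F g m).
Local Notation Ru := (@Rubar F g N m).
Local Notation P := (@Pmx F N m).
Local Notation Q := (@Qmx F g N m).
Implicit Types a b c d : 'I_m.

(** The parameters increase with the index in the orthogonal case and decrease in the symplectic
    one; [sg] records the direction. *)
Lemma ubar_diff a b : (a < b)%N -> ub a - ub b = - sg * (b - a)%N%:R.
Proof.
move=> ab; have lb : (b <= m.-1)%N by rewrite -ltnS (ltn_predK (ltn_ord b)).
have la := leq_trans (ltnW ab) lb.
rewrite /ubar /bcd_sign (natrB _ (ltnW ab)); case: g; last by ring.
by rewrite (natrB _ la) (natrB _ lb); ring.
Qed.

Lemma ubar_diff_neq0 a b : (a < b)%N -> ub a - ub b != 0.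
Proof.
move=> ab; rewrite ubar_diff // mulf_neq0 //; last by rewrite pnatr_eq0 subn_eq0 -ltnNge.
by rewrite oppr_eq0; apply/eqP => s0; have /eqP := bcd_sign_sqr F g;
  rewrite s0 mul0r eq_sym oner_eq0.
Qed.

(* The bound on m is needed here: for g = sp_N the difference vanishes when
   b - a = N/2 + 1. *)
Lemma ubar_diff_kappa a b : (a < b)%N -> ub a - ub b - kap != 0.
Proof.
move=> ab; have eN := kappa_sign; have sq := bcd_sign_sqr F g.
have two : 2%:R != 0 :> F by rewrite pnatr_eq0.
rewrite -(mulrI_eq0 _ (mulfI two)) ubar_diff //.
suff [k k0 ->] : exists2 k : nat, (0 < k)%N & 2%:R * (- sg * (b - a)%N%:R - kap) = - k%:R.
  by rewrite oppr_eq0 pnatr_eq0 -lt0n.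
have -> : 2%:R * (- sg * (b - a)%N%:R - kap) = - 2%:R * sg * (b - a)%N%:R - N%:R + 2%:R * sg.
  by rewrite eN; ring.
have lb := ltn_ord b; move: m_le N_even; rewrite /bcd_sign;
  case: g => [_ _|/(_ erefl) ml /(_ erefl) ev].
  have : (0 < b - a)%N by rewrite subn_gt0.
  move: (b - a)%N => e e0.
  exists (2 * e + N - 2)%N; first by lia.
  by rewrite natrB ?natrD ?natrM; [ring|lia].
have e := odd_double_half N; rewrite (negPf ev) add0n -muln2 in e.
have l : (b - a < N./2)%N by lia.
move: (b - a)%N l => r l; exists (N + 2 - 2 * r)%N; first by lia.
by rewrite natrB ?natrD ?natrM; [ring|lia].
Qed.

Lemma Rubar_Rpol a b : (a < b)%N ->
  Rpol g N 1 kap (ub a - ub b) a b = ((ub a - ub b) * (ub a - ub b - kap)) *: Ru a b.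
Proof.
move=> ab; have d0 := ubar_diff_neq0 ab; have dk := ubar_diff_kappa ab.
rewrite /Rpol /Rword /Rubar; move: (ub a - ub b) d0 dk => d d0 dk.
rewrite !mul1r !scalerDr !scalerN !scalerA scaleNr; congr (_ - _ *: _ + _ *: _).
  by rewrite mulrC mulKf.
by rewrite mulfK.
Qed.

Lemma Rubar_factor_neq0 a b : (a < b)%N -> (ub a - ub b) * (ub a - ub b - kap) != 0.
Proof. by move=> ab; rewrite mulf_neq0 ?ubar_diff_neq0 ?ubar_diff_kappa. Qed.

Lemma Rubar_yang_baxter a b c : (a < b)%N -> (b < c)%N ->
  Ru a b * Ru a c * Ru b c = Ru b c * Ru a c * Ru a b.
Proof.
move=> ab bc; have ac := ltn_trans ab bc.
have nab : a != b by rewrite neq_ltn ab. have nbc : b != c by rewrite neq_ltn bc.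
have nac : a != c by rewrite neq_ltn ac.
have := Rpol_yang_baxter N_even 1 kappa_sign (ub a - ub b) (ub b - ub c) nab nbc nac.
rewrite [ub a - ub b + _]addrA subrK !Rubar_Rpol //.
rewrite !scale_mul3 [X in _ = X *: _ -> _](_ : _ = (ub a - ub b) * (ub a - ub b - kap)
  * ((ub a - ub c) * (ub a - ub c - kap)) * ((ub b - ub c) * (ub b - ub c - kap))); last by ring.
by apply: scalerI; rewrite !mulf_neq0 ?ubar_diff_neq0 ?ubar_diff_kappa.
Qed.

Lemma Rubar_comm a b c d : (a < b)%N -> (c < d)%N -> a != c -> a != d -> b != c -> b != d ->
  GRing.comm (Ru a b) (Ru c d).
Proof.
move=> ab cd ac ad bc bd.
have := @Rpol_comm F g N m 1 kap a b c d (ub a - ub b) (ub c - ub d) ac ad bc bd.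
rewrite /GRing.comm (Rubar_Rpol ab) (Rubar_Rpol cd).
move: (Rubar_factor_neq0 ab) (Rubar_factor_neq0 cd).
move: ((ub a - ub b) * _) ((ub c - ub d) * _) => e1 e2 e10 e20.
by rewrite !scale_mul2 (mulrC e2); apply/scalerI/mulf_neq0.
Qed.

(** Neighbouring parameters differ by -s, and -s - kappa = -N/2, so the R-matrix is 1 + s P - (2/N)
    Q. Then P Q = s Q and Q^2 = N Q give both claims. *)
Lemma Rubar_adjacent a b : b = a.+1 :> nat ->
  Ru a b * P a b = sg *: Ru a b /\ Ru a b * Q a b = 0.
Proof.
move=> e; have ab : (a < b)%N by rewrite e.
have nab : a != b by rewrite neq_ltn ab.
have sq := bcd_sign_sqr F g; have N0 : N%:R != 0 :> F by rewrite pnatr_eq0 -lt0n; lia.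
have dE : ub a - ub b = - sg by rewrite ubar_diff // e subSnn mulr1.
have s0 : sg != 0 by apply/eqP => s0; have /eqP := sq; rewrite s0 mul0r eq_sym oner_eq0.
have sV : (- sg)^-1 = - sg by apply/eqP;
  rewrite -(inj_eq (mulfI (_ : - sg != 0))) ?mulfV ?mulrNN ?sq ?oppr_eq0.
have kV : (- sg - kap)^-1 = - (2%:R / N%:R).
  have -> : - sg - kap = - (N%:R / 2%:R) by rewrite kappa_sign; field.
  by rewrite invrN invf_div.
rewrite /Rubar dE sV kV scaleNr opprK -[1%:M]/(1 : 'M[F]_#|{ffun 'I_m -> 'I_N}|).
rewrite !mulrDl !mul1r !scalemxMl Pmx_sqr // Pmx_Qmx // Qmx_Pmx // Qmx_sqr //.
split.
  rewrite !scalerDr !scalerA sq scale1r; congr (_ + _).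
    by rewrite addrC.
  by rewrite mulrC.
by rewrite !scalerA sq scale1r mulNr mulrDl mulVf // scaleNr scalerDl scale1r subrr.
Qed.

Section Absorption.
Variable S : 'M[F]_#|{ffun 'I_m -> 'I_N}|.
Hypothesis S_adjacent : forall a b, b = a.+1 :> nat -> exists Z, S = Z * Ru a b.

(** Induction on the distance: P_ab and Q_ab are conjugates of P_ac and Q_ac by P_cb, where c is the
    predecessor of b. The two signs from P_cb multiply to 1. *)
Lemma absorb_PQ k a b : b = (a + k.+1)%N :> nat -> S * P a b = sg *: S /\ S * Q a b = 0.
Proof.
elim: k a b => [|k IH] a b e.
  have eb : b = a.+1 :> nat by rewrite e addn1.
  have [Z ->] := S_adjacent eb; have [eP eQ] := Rubar_adjacent eb.
  by rewrite -!mulrA eP eQ mulr0 scalemxMr.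
have lc : (a + k.+1 < m)%N by rewrite (leq_ltn_trans _ (ltn_ord b)) // e leq_add2l.
pose c := Ordinal lc; have ec : c = (a + k.+1)%N :> nat by [].
have eb : b = c.+1 :> nat by rewrite e ec addnS.
have [Z SE] := S_adjacent eb; have [eP eQ] := Rubar_adjacent eb.
have [SPac SQac] := IH a c ec.
have SPcb : S * P c b = sg *: S by rewrite SE -!mulrA eP scalemxMr.
have ncb : c != b by rewrite -val_eqE /= eb neq_ltn ltnSn.
have nba : b != a by rewrite -val_eqE neq_ltn /= e orbC -{1}[nat_of_ord a]addn0 ltn_add2l.
have nca : c != a by rewrite -val_eqE neq_ltn /= orbC -{1}[nat_of_ord a]addn0 ltn_add2l.
have PE : P a b = P c b * P a c * P c b.
  rewrite (@Pmx_sym F N m a b) 1?eq_sym // (@Pmx_sym F N m a c) 1?eq_sym //.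
  by rewrite Pmx_Pmx_conj // -mulrA Pmx_sqr // mulr1.
have QE : Q a b = P c b * Q a c * P c b.
  rewrite (@Qmx_sym F g N m N_even a b) 1?eq_sym // (@Qmx_sym F g N m N_even a c) 1?eq_sym //.
  by rewrite Pmx_Qmx_conj // -mulrA Pmx_sqr // mulr1.
split.
  rewrite PE !mulrA SPcb scalemxMl SPac scalemxMl scalemxMl SPcb !scalerA.
  by rewrite bcd_sign_sqr mul1r.
by rewrite QE !mulrA SPcb !scalemxMl SQac mul0r scaler0.
Qed.

(** Since S annihilates Q and absorbs P with sign s, the scalar is 1 + 1/(b - a), which is positive
    and hence nonzero. *)
Lemma absorb_Rubar a b : (a < b)%N -> exists2 c, c != 0 & S * Ru a b = c *: S.
Proof.
move=> ab; have [k e] : exists k, b = (a + k.+1)%N :> nat.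
  by exists (b - a).-1; rewrite prednK ?subn_gt0 // subnKC // ltnW.
have [eP eQ] := absorb_PQ e.
exists (1 + k.+1%:R^-1).
  by rewrite lt0r_neq0 // addr_gt0 // invr_gt0 ltr0n.
rewrite /Rubar -[1%:M]/(1 : 'M[F]_#|{ffun 'I_m -> 'I_N}|) mulrDr mulrBr mulr1 !scalemxMr eP eQ.
rewrite scaler0 addr0 scalerA -{1}[S]scale1r -scalerBl; congr (_ *: _).
have sq := bcd_sign_sqr F g.
have s0 : sg != 0 by apply/eqP => s0; have /eqP := sq; rewrite s0 mul0r eq_sym oner_eq0.
have sV : sg^-1 = sg by apply: (mulfI s0); rewrite mulfV // sq.
rewrite ubar_diff // e addKn invfM invrN sV !mulNr opprK.
by rewrite mulrAC sq mul1r.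
Qed.

Lemma absorb_full s : pairwise (fun a b => (a < b)%N) s ->
  exists2 c, c != 0 & S * full Ru s = c *: S.
Proof.
elim: s => [|a s IH]; first by exists 1; rewrite ?oner_eq0 //= mulr1 scale1r.
rewrite [pairwise _ _]/= => /andP[/allP lta /IH[c c0 Sc]].
have [c' c'0 Sc'] : exists2 c', c' != 0 & S * \prod_(b <- s) Ru a b = c' *: S.
  elim: s lta {IH Sc} => [|b s IH] lta; first by exists 1;
    rewrite ?oner_eq0 // big_nil mulr1 scale1r.
  have [|c1 c10 S1] := IH; first by move=> x xs; apply: lta; rewrite inE xs orbT.
  have [c2 c20 S2] := absorb_Rubar (lta b (mem_head _ _)).
  by exists (c2 * c1); rewrite ?mulf_neq0 // big_cons mulrA S2 scalemxMl S1 scalerA.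
by exists (c' * c); rewrite ?mulf_neq0 //= mulrA Sc' scalemxMl Sc scalerA.
Qed.

End Absorption.

(** [full_adjacent] makes the product absorb its own factors one by one. The scalar is the product
    of all 1 + 1/(b - a), that is m!, in accordance with the normalisation of [Smx]; only its being
    nonzero is recorded. *)
Lemma full_Rubar_sqr : exists2 c, c != 0 &
  full Ru (enum 'I_m) * full Ru (enum 'I_m) = c *: full Ru (enum 'I_m).
Proof.
apply: absorb_full; last exact: enum_ord_pairwise.
move=> a b e; have [s1 [s2 es]] := enum_ord_adjacent e.
have pw := enum_ord_pairwise m; have un := enum_uniq 'I_m; rewrite es in pw un *.
move: (pw); rewrite pairwise_cat => /and3P[_ _ pw2].
move: (pw2) => /= /andP[/andP[ab /allP la] /andP[/allP lb lt2]].
apply: (full_adjacent un pw2) => [c cs|c d cs ds ncd|c d cs ds cd].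
- by apply: Rubar_yang_baxter => //; apply: lb.
- have [ac bc ad bd] := And4 (la c cs) (lb c cs) (la d ds) (lb d ds).
  apply: Rubar_comm => //; first by rewrite neq_ltn ab.
    by rewrite neq_ltn ad.
  by rewrite neq_ltn bc orbT.
- have [ac bc ad bd] := And4 (la c cs) (lb c cs) (la d ds) (lb d ds).
  by apply: Rubar_comm; rewrite // neq_ltn ?ac ?ad ?bc ?bd.
Qed.

End Fusion.

(** * RTT relations in the dual Yangian *)

Section DualYangianRTT.
Variables (F : fieldType) (g : bcd_type) (N : nat).
Local Notation A := (freealg F N).
Local Notation Ah := {fps A}.
Local Notation V := {fps Ah}.
Local Notation Y := (dualYangian F g N).
Local Notation kap := (kappa F g N).

Definition dy_pr : Ah -> Y := @dy_proj F g N.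
Fact dy_pr_zmod : zmod_morphism dy_pr.
Proof. exact: (@tsproj_is_zmod_morphism _ (@dy_ideal F g N)). Qed.
Fact dy_pr_monoid : monoid_morphism dy_pr.
Proof. exact: (@tsproj_is_monoid_morphism _ (@dy_ideal F g N)). Qed.
HB.instance Definition _ := GRing.isZmodMorphism.Build Ah Y dy_pr dy_pr_zmod.
HB.instance Definition _ := GRing.isMonoidMorphism.Build Ah Y dy_pr dy_pr_monoid.

Definition dy_io : F -> A := @malgC _ F.
HB.instance Definition _ := GRing.RMorphism.on dy_io.

Lemma dy_pr_eq0 x : dy_pr x = 0 <-> inJ g x.
Proof. exact: dy_proj_eq0. Qed.

Lemma dy_pr_surj y : exists x, y = dy_pr x.
Proof. exact: tsproj_surj. Qed.

Lemma dy_pr_shift a (f : V) : (forall q, dy_pr (f q) = 0) ->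
  forall q, dy_pr (fps_shift (dy_io a) f q) = 0.
Proof.
move=> f0 q; apply/dy_pr_eq0/allJ_shift => q'.
exact/dy_pr_eq0.
Qed.

Lemma fpsX_expE n (x : Ah) i : (fpsX A ^+ n * x) i = if (n <= i)%N then x (i - n)%N else 0.
Proof.
elim: n i => [|n IH] i; first by rewrite mul1r subn0.
by rewrite exprS -mulrA fpsX_mulE; case: i.
Qed.

(** This is the closedness of the ideal read in the quotient. *)
Lemma dy_separated y : (forall n, exists y', y = dy_pr (fpsX A) ^+ n * y') -> y = 0.
Proof.
have [x ->] := dy_pr_surj y => H; apply/dy_pr_eq0/inJ_closed => n.
have [y' e] := H n; have [x' ex'] := dy_pr_surj y'.
(* This element lies in the ideal and agrees with x in all orders of h below n. *)
exists (x - fpsX A ^+ n * x').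
  have E : dy_pr (fpsX A ^+ n * x') = dy_pr x.
    by rewrite e ex'; apply: etrans (rmorphM dy_pr _ _) _; congr (_ * _); apply: (rmorphXn dy_pr).
  apply/dy_pr_eq0; apply: etrans (raddfB dy_pr _ _) _; apply/eqP; rewrite subr_eq0.
  by apply/eqP/esym.
move=> i lt; rewrite fpsBE fpsX_expE leqNgt lt /=.
by rewrite subr0.
Qed.

Local Notation P := (@Pmx F N 2 ord0 ord_max).
Local Notation Q := (@Qmx F g N 2 ord0 ord_max).

Lemma dy_rtt_zero (p : nat) x y : exists2 Z : V, (forall q, dy_pr (Z q) = 0) &
  rtt_poly (fpsC (fpsX A)) (fpsX Ah) (fpsC (fpsC (dy_io kap))) (T1coef F N) (T2 F N)
    (map_mx (@fpsC Ah) (map_mx (fun a => fpsC (dy_io a)) P))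
    (map_mx (@fpsC Ah) (map_mx (fun a => fpsC (dy_io a)) Q)) p%:Z x y
  = fpsC (fpsX A) * (fpsC (fpsX A) * Z).
Proof.
have [Z ZJ e] := @rtt_poly_ideal F g N p%:Z x y; exists Z; first by move=> q; apply/dy_pr_eq0.
have eP : map_mx (@fpsC Ah) (map_mx (fun a => fpsC (dy_io a)) P) = Pmx V N ord0 ord_max.
  apply: etrans (Pmx_map (@fpsC Ah) N (ord0 : 'I_2) ord_max); congr map_mx.
  exact: (Pmx_map (@fpsC A \o dy_io) N (ord0 : 'I_2) ord_max).
have eQ : map_mx (@fpsC Ah) (map_mx (fun a => fpsC (dy_io a)) Q) = Qmx V g N ord0 ord_max.
  apply: etrans (Qmx_map (@fpsC Ah) g N (ord0 : 'I_2) ord_max); congr map_mx.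
  exact: (Qmx_map (@fpsC A \o dy_io) g N (ord0 : 'I_2) ord_max).
by rewrite eP eQ; exact: e.
Qed.

Definition dy_cst : F -> {fps Y} := cst dy_io dy_pr.
HB.instance Definition _ := GRing.RMorphism.on dy_cst.
Definition dy_scal2 : {fps {fps {fps F}}} -> {fps {fps Y}} := scal2 dy_io dy_pr.
HB.instance Definition _ := GRing.RMorphism.on dy_scal2.

Lemma dy_io_central a x : dy_io a * x = x * dy_io a.
Proof. exact: malgC_central. Qed.

Lemma dy_scal2_central x b : dy_scal2 x * b = b * dy_scal2 x.
Proof. exact: scal2_central dy_io_central dy_pr_surj x b. Qed.

Lemma dy_cst_central x b : dy_cst x * b = b * dy_cst x.
Proof. by apply: fpsC_central => y; apply: scal_central dy_io_central dy_pr_surj _ y. Qed.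

Lemma shift_pr0 c : fps_map dy_pr (fps_shift (dy_io c) (0 : V)) = 0.
Proof.
rewrite (_ : fps_shift (dy_io c) (0 : V) = 0); last exact: (raddf0 (fps_shift (dy_io c))).
exact: (raddf0 (fps_map dy_pr)).
Qed.

Lemma slot_Tplus_at (a : 'I_2) c : slot a (Tplus_at g N c) =
  map_mx (fun f => fps_map dy_pr (fps_shift (dy_io c) f)) (slot a (Tplus F N)).
Proof. exact: (slot_map a (Tplus F N) (shift_pr0 c)). Qed.

Lemma dy_rtt_diagonal (c c' : F) :
  let t1 := slot ord0 (Tplus_at g N c) in let t2 := slot ord_max (Tplus_at g N c') in
  let R := map_mx dy_cst (Rpol g N 1 kap (c - c') ord0 ord_max) in
  R * t1 * t2 = t2 * t1 * R :> 'M_#|{ffun 'I_2 -> 'I_N}|.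
Proof.
move=> t1 t2 R; rewrite /t1 /t2 !slot_Tplus_at.
exact: (rtt_diagonal dy_io_central dy_pr_surj dy_pr_shift (fun _ => erefl) (fun _ => erefl)
  dy_rtt_zero c c').
Qed.

Lemma map_cvar_Pmx m (a b : 'I_m) : map_mx (@cvar F) (Pmx F N a b) = Pmx _ N a b.
Proof. exact: (Pmx_map (@fpsC _ \o (@fpsC _ \o @fpsC F)) N a b). Qed.

Lemma map_cvar_Qmx m (a b : 'I_m) : map_mx (@cvar F) (Qmx F g N a b) = Qmx _ g N a b.
Proof. exact: (Qmx_map (@fpsC _ \o (@fpsC _ \o @fpsC F)) g N a b). Qed.

Lemma dy_rtt_cross (c c' : F) :
  let t1 := slot ord0 (map_mx (@fpsC _) (Tplus_at g N c)) in
  let t2 := slot ord_max (map_mx (fps_map (@fpsC _)) (Tplus_at g N c')) in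
  let R := map_mx dy_scal2 (Rpol g N (hvar F) (cvar kap) (uvar c - vvar c') ord0 ord_max) in
  R * t1 * t2 = t2 * t1 * R :> 'M_#|{ffun 'I_2 -> 'I_N}|.
Proof.
move=> t1 t2 R.
have e1 : t1 = map_mx (fun f => fpsC (fps_map dy_pr (fps_shift (dy_io c) f))) (slot ord0 (Tplus F
  N)).
  rewrite /t1 (slot_map _ _ (raddf0 (@fpsC _))) slot_Tplus_at.
  by apply/matrixP => i j; rewrite !mxE.
have e2 : t2 = map_mx (fun f => fps_map (@fpsC _) (fps_map dy_pr (fps_shift (dy_io c') f))) (slot
  ord_max (Tplus F N)).
  rewrite /t2 (slot_map _ _ (raddf0 (fps_map (@fpsC _)))) slot_Tplus_at.
  by apply/matrixP => i j; rewrite !mxE.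
rewrite e1 e2 /R /Rpol -map_cvar_Pmx -map_cvar_Qmx.
exact: (rtt_cross dy_io_central dy_pr_surj dy_pr_shift (fun _ => erefl) (fun _ => erefl)
  dy_rtt_zero c c').
Qed.

End DualYangianRTT.

Section FullMorphism.
Variables (M M' : pzRingType) (I J : eqType).

Lemma prod_morph (f : M -> M') (s : seq I) X : f 1 = 1 -> {morph f : x y / x * y} ->
  f (\prod_(a <- s) X a) = \prod_(a <- s) f (X a).
Proof. by move=> f1 fM; apply: big_morph. Qed.

Lemma full_morph (f : M -> M') (r : I -> I -> M) s : f 1 = 1 -> {morph f : x y / x * y} ->
  f (full r s) = full (fun a b => f (r a b)) s.
Proof.
move=> f1 fM; elim: s => [|a s IH] //=.
by rewrite fM IH prod_morph.
Qed.

Lemma cross_morph (f : M -> M') (r : I -> I -> M) s t : f 1 = 1 -> {morph f : x y / x * y} ->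
  f (cross r s t) = cross (fun a b => f (r a b)) s t.
Proof.
move=> f1 fM; rewrite prod_morph //; apply: eq_bigr => b _.
by rewrite prod_morph.
Qed.

Lemma full_map (g : J -> I) (r : I -> I -> M) s :
  full r (map g s) = full (fun a b => r (g a) (g b)) s.
Proof. by elim: s => [|a s IH] //=; rewrite IH big_map. Qed.

Lemma eq_full (r r' : I -> I -> M) s : (forall a b, r a b = r' a b) -> full r s = full r' s.
Proof. by move=> e; elim: s => [|a s IH] //=; rewrite IH; congr (_ * _); apply: eq_bigr. Qed.

End FullMorphism.

Section FusedElements.
Variables (M : pzRingType) (S1 S2 X1 X2 Z1 Z2 : M).
Hypotheses (SX1 : S1 * X1 = Z1 * S1) (SX2 : S2 * X2 = Z2 * S2).
Hypotheses (S12 : S1 * S2 = S2 * S1).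

Lemma fused_exchange : S1 * X2 = X2 * S1 -> S2 * Z1 = Z1 * S2 ->
  S2 * S1 * (X2 * X1) = Z2 * Z1 * (S2 * S1).
Proof.
move=> c1 c2; rewrite -mulrA (mulrA S1) c1 -(mulrA X2) SX1 mulrA SX2.
by rewrite -mulrA (mulrA S2) c2 -!mulrA.
Qed.

Lemma fused_split_l : S2 * X1 = X1 * S2 -> S2 * S1 * (X1 * X2) = S1 * X1 * (S2 * X2).
Proof. by move=> c; rewrite -S12 -mulrA (mulrA S2) c -!mulrA. Qed.

Lemma fused_split_r : S1 * X2 = X2 * S1 -> S2 * S1 * (X2 * X1) = S2 * X2 * (S1 * X1).
Proof. by move=> c; rewrite -mulrA (mulrA S1) c -!mulrA. Qed.

End FusedElements.

(** * Transport of R-matrices between tensor powers and between rings *)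

Section RpolTransport.
Variables (C D : comPzRingType) (g : bcd_type) (N : nat).

Lemma emb_Pmx k m (f : 'I_k -> 'I_m) (a b : 'I_k) : injective f ->
  emb f (Pmx C N a b) = Pmx C N (f a) (f b).
Proof.
move=> fi; rewrite !PmxE raddf_sum; apply: eq_bigr => i _; rewrite raddf_sum.
by apply: eq_bigr => j _; apply: etrans (embM fi _ _) _; rewrite !emb_slot.
Qed.

Lemma emb_Qmx k m (f : 'I_k -> 'I_m) (a b : 'I_k) : injective f ->
  emb f (Qmx C g N a b) = Qmx C g N (f a) (f b).
Proof.
move=> fi; rewrite !QmxE raddf_sum; apply: eq_bigr => i _; rewrite raddf_sum.
by apply: eq_bigr => j _; apply: etrans (embZ _ _ _) _; rewrite embM // !emb_slot.
Qed.

Lemma emb_Rpol k m (f : 'I_k -> 'I_m) (t kp x : C) (a b : 'I_k) : injective f ->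
  emb f (Rpol g N t kp x a b) = Rpol g N t kp x (f a) (f b).
Proof.
move=> fi; rewrite /Rpol /Rword.
have ED (X Y : 'M[C]_#|{ffun 'I_k -> 'I_N}|) : emb f (X + Y) = emb f X + emb f Y by apply: raddfD.
rewrite !ED !embZ emb_Pmx // emb_Qmx //.
by congr (_ *: _ + _ + _); apply: emb1.
Qed.

Lemma Rpol_map (phi : {rmorphism C -> D}) m (t kp x : C) (a b : 'I_m) :
  map_mx phi (Rpol g N t kp x a b) = Rpol g N (phi t) (phi kp) (phi x) a b.
Proof.
rewrite /Rpol /Rword !map_mxD !map_mxZ map_mx1 Pmx_map Qmx_map.
by rewrite rmorphN !rmorphM !rmorphB !rmorphM.
Qed.

Lemma Rpol_homogeneous m (h kp x : C) (a b : 'I_m) :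
  Rpol g N h kp (h * x) a b = (h * h) *: Rpol g N 1 kp x a b.
Proof.
rewrite /Rpol /Rword !scalerDr !scalerA; congr (_ *: _ + _ *: _ + _ *: _); ring.
Qed.

End RpolTransport.

Section TwoSlots.
Variables (m : nat) (i j : 'I_m).
Hypothesis ij : i != j.

Definition two_slots (k : 'I_2) : 'I_m := if k == ord0 then i else j.

Lemma two_slots_inj : injective two_slots.
Proof.
have aux (a b : 'I_2) : (a == ord0) = (b == ord0) -> a = b.
  by case: a b => [[|[|//]] la] [[|[|//]] lb] //= _; apply: val_inj.
move=> a b; rewrite /two_slots => e; apply: aux; move: e ij.
by case: (a == ord0); case: (b == ord0) => // ->; rewrite eqxx.
Qed.

End TwoSlots.

Section CvarMorphism.
Variable F : comPzRingType.
HB.instance Definition _ := GRing.RMorphism.copy (@cvar F) (@fpsC _ \o (@fpsC _ \o @fpsC F)).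

(** Cancelling h is legitimate over the scalar series, where all identities between R-matrices alone
    are proved. *)
Lemma hvar_inj (x y : {fps {fps {fps F}}}) : hvar F * x = hvar F * y -> x = y.
Proof.
move=> e; apply: fpsP => t; apply: fpsCX_inj.
by have := congr1 (fun f : {fps {fps {fps F}}} => f t) e; rewrite !fpsC_mulE.
Qed.

Lemma uvar_sub (c c' : F) : uvar c - uvar c' = hvar F * cvar (c - c').
Proof.
rewrite /uvar /hvar /cvar -!fpsCM fpsX_comm -raddfB; congr fpsC.
by rewrite opprD addrACA subrr add0r -raddfB -mulrBl -raddfB.
Qed.

Lemma vvar_sub (c c' : F) : vvar c - vvar c' = hvar F * cvar (c - c').
Proof.
rewrite /vvar /hvar /cvar -!fpsCM fpsX_comm opprD addrACA subrr add0r.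
by rewrite -!raddfB -mulrBl -raddfB.
Qed.

Lemma uvar_vvar_shift (c c' e : F) : uvar c - vvar c' + hvar F * cvar e =
  fpsC (fpsX _) - fpsX _ + fpsC (fpsC (fpsC (c - c' + e) * fpsX F)).
Proof.
have fpsCN (V : zmodType) (a : V) : fpsC (- a) = - fpsC a.
  by apply: fpsP => n /=; case: eqP; rewrite ?oppr0.
rewrite /uvar /vvar /hvar /cvar -!fpsCM fpsX_comm [fpsC (_ + _)]fpsCD.
rewrite opprD addrACA; apply: etrans (esym (addrA _ _ _)) _.
by rewrite !(fpsCD, mulrDl, fpsCN, mulNr).
Qed.

End CvarMorphism.

Lemma cvar_inj (F : fieldType) (a : F) x y : a != 0 -> cvar a * x = cvar a * y -> x = y.
Proof.
move=> a0 /(congr1 ( *%R (cvar a^-1))).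
by rewrite !mulrA -(rmorphM (@cvar F)) mulVf // rmorph1 !mul1r.
Qed.

Lemma fps_map_linear_factor (A Y : pzRingType) (f : {rmorphism A -> Y}) a :
  fps_map (fps_map f) (fpsC (fpsX A) - fpsX _ + fpsC (fpsC a)) =
  fpsC (fpsX Y) - fpsX _ + fpsC (fpsC (f a)).
Proof.
rewrite fps_map_rmorphD fps_map_CC; congr (_ + _).
apply: etrans (rmorphB (fps_map (fps_map f)) _ _) _; congr (_ - _); last exact: fps_mapX.
apply: etrans (fps_mapC _ _) _; congr fpsC; exact: fps_mapX.
Qed.

Lemma left_inverse_regular (B : pzRingType) (u v b : B) : v * u = 1 -> u * b = 0 -> b = 0.
Proof. by move=> e ub; rewrite -[b]mul1r -e -mulrA ub mulr0. Qed.

(** * Regular scalars *)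

Section Regularity.
Variables (F : fieldType) (g : bcd_type) (N : nat).
Local Notation C := {fps {fps {fps F}}}.
Local Notation B := {fps {fps (dualYangian F g N)}}.
Local Notation phi := (@dy_scal2 F g N).

Definition regular (d : C) := forall b : B, phi d * b = 0 -> b = 0.

Lemma regularM d d' : regular d -> regular d' -> regular (d * d').
Proof.
move=> rd rd' b; rewrite (rmorphM phi) -mulrA => /rd; exact: rd'.
Qed.

Lemma regular_linear (c c' e : F) : regular (uvar c - vvar c' + hvar F * cvar e).
Proof.
move=> b; rewrite uvar_vvar_shift.
pose sc : {rmorphism {fps F} -> dualYangian F g N} := scal (@dy_io F N) (@dy_pr F g N).
have -> : phi (fpsC (fpsX _) - fpsX _ + fpsC (fpsC (fpsC (c - c' + e) * fpsX F))) =
  fpsC (fpsX _) - fpsX _ + fpsC (fpsC (sc (fpsC (c - c' + e)) * dy_pr g (fpsX (freealg F N)))).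
  apply: etrans (fps_map_linear_factor sc _) _; congr (_ + fpsC (fpsC _)).
  apply: etrans (rmorphM sc _ _) _; congr (_ * _).
  by congr (dy_pr g _); apply: fps_mapX.
apply: linear_factor_regular.
- by move=> y; apply: pr_h_central (@dy_pr_surj F g N) y.
- exact: dy_separated.
Qed.

(** The scalar of [Rpol_unitarity] splits into the four linear factors x + h, x - h, x + h k and x -
    h k, each covered by [regular_linear]. *)
Lemma regular_Rpol (c c' k : F) (x := uvar c - vvar c') :
  regular ((x ^+ 2 - hvar F ^+ 2) * (x ^+ 2 - (hvar F * cvar k) ^+ 2)).
Proof.
have -> : (x ^+ 2 - hvar F ^+ 2) * (x ^+ 2 - (hvar F * cvar k) ^+ 2) =
  (x + hvar F * cvar 1) * (x + hvar F * cvar (-1)) *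
  ((x + hvar F * cvar k) * (x + hvar F * cvar (- k))).
  by rewrite !rmorphN rmorph1; ring.
by apply: regularM; apply: regularM; apply: regular_linear.
Qed.

End Regularity.

(** * Commuting traces *)

Section QuasiInverse.
Variables (C : comPzRingType) (K : nat) (reg : C -> Prop).
Hypotheses (reg1 : reg 1) (regM : forall d d', reg d -> reg d' -> reg (d * d')).

Definition quasi_invertible (R : 'M[C]_K) := exists (R' : 'M[C]_K) (d : C),
  [/\ R * R' = d *: (1 : 'M[C]_K), R' * R = d *: (1 : 'M[C]_K) & reg d].

Lemma quasi_invertible_prod (I : eqType) (s : seq I) (R : I -> 'M[C]_K) :
  (forall i, i \in s -> quasi_invertible (R i)) -> quasi_invertible (\prod_(i <- s) R i).
Proof.
move=> H; rewrite big_seq;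
  apply: big_ind => [|R1 R2 [R1' [d1 [e1 f1 g1]]] [R2' [d2 [e2 f2 g2]]]|//].
  by exists 1, 1; split=> //; rewrite mulr1 scale1r.
exists (R2' * R1'), (d1 * d2); split; last exact: regM.
  by rewrite -mulrA (mulrA R2) e2 scalemxMl mul1r scalemxMr e1 scalerA mulrC.
by rewrite -mulrA (mulrA R1') f1 scalemxMl mul1r scalemxMr f2 scalerA.
Qed.

End QuasiInverse.

Section FusedTrace.
Variables (C : comPzRingType) (B : pzRingType) (phi : {rmorphism C -> B}) (K : nat).
Hypothesis phi_central : forall c b, phi c * b = b * phi c.
Local Notation "M ^f" := (map_mx phi M).
Let reg (d : C) := forall b : B, phi d * b = 0 -> b = 0.
Variables (I : eqType) (lt : rel I) (r : I -> I -> 'M[C]_K) (X : I -> 'M[B]_K) (s t : seq I).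
Hypotheses (st_uniq : uniq (s ++ t)) (st_lt : pairwise lt (s ++ t)).
Hypothesis lt_irr : forall a b, lt a b -> a != b.
Hypothesis yang_baxter : forall a b c, lt a b -> lt b c ->
  r a b * r a c * r b c = r b c * r a c * r a b.
Hypothesis r_comm : forall a b c d, lt a b -> lt c d -> a != c -> a != d -> b != c -> b != d ->
  GRing.comm (r a b) (r c d).
Hypothesis rX : forall a b, lt a b -> (r a b)^f * X a * X b = X b * X a * (r a b)^f.
Hypothesis rX_comm : forall a b c, lt a b -> a != c -> b != c -> GRing.comm ((r a b)^f) (X c).
Hypothesis r_quasi_invertible : forall a b, a \in s -> b \in t -> quasi_invertible reg (r a b).
Variables c1 c2 : C.
Hypotheses (sqr_s : full r s * full r s = c1 *: full r s)
  (sqr_t : full r t * full r t = c2 *: full r t) (reg1 : reg c1) (reg2 : reg c2).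
Local Notation Xs := (\prod_(a <- s) X a).
Local Notation Xt := (\prod_(b <- t) X b).
Local Notation Ss := (full r s).
Local Notation St := (full r t).

Let st_facts : [/\ uniq s, uniq t, pairwise lt s, pairwise lt t & forall a b, a \in s -> b \in t
  -> lt a b].
Proof.
move: st_uniq st_lt; rewrite cat_uniq pairwise_cat => /and3P[us _ ut] /and3P[st ls lt_].
split=> // a b as_ bt; move/allrelP: st; exact.
Qed.

Let regM d d' : reg d -> reg d' -> reg (d * d').
Proof. by move=> rd rd' b; rewrite rmorphM -mulrA => /rd /rd'. Qed.

Let map1 : (1 : 'M[C]_K)^f = 1. Proof. exact: map_mx1. Qed.
Let mapM (M M' : 'M[C]_K) : (M * M')^f = M^f * M'^f. Proof. exact: map_mxM. Qed.

(** An application of [fusion_trace] to the joint element St Ss and the cross product. The fully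
    reversed products of the T's serve as X''. *)
Lemma fused_trace_comm : \tr (Ss^f * Xs * (St^f * Xt)) = \tr (St^f * Xt * (Ss^f * Xs)).
Proof.
have [us ut ls lt_ st] := st_facts.
have st_neq a b : a \in s -> b \in t -> a != b by move=> as_ bt; apply/lt_irr/st.
have ts_neq b a : a \in s -> b \in t -> b != a by move=> as_ bt; rewrite eq_sym st_neq.
have comm_Ss_St : GRing.comm Ss St.
  apply: (full_comm lt_) => b c bt ct bc; apply/commr_sym/(full_comm ls) => a d as_ ds ad.
  by apply: r_comm; rewrite ?ts_neq.
have mapS u : (full r u)^f = full (fun a b => (r a b)^f) u by apply: full_morph.
have Ss_comm b : b \in t -> GRing.comm (Ss^f) (X b).
  move=> bt; rewrite mapS; apply/commr_sym/(full_comm ls) => a d as_ ds ad;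
    apply/commr_sym/rX_comm => //.
    exact: st_neq.
  exact: st_neq.
have St_comm a : a \in s -> GRing.comm (St^f) (X a).
  move=> as_; rewrite mapS; apply/commr_sym/(full_comm lt_) => b d bt dt bd;
    apply/commr_sym/rX_comm => //.
    exact: ts_neq.
  exact: ts_neq.
have exch u : uniq u -> pairwise lt u ->
    (full r u)^f * \prod_(a <- u) X a = (\prod_(a <- rev u) X a) * (full r u)^f.
  move=> uu lu; rewrite mapS; apply: (full_exchange uu lu) => [a b _ _|a b c _ _ ab _ ca cb];
    first exact: rX.
  by apply/commr_sym/rX_comm; rewrite // eq_sym.
have SsXt : Ss^f * Xt = Xt * Ss^f by apply: comm_prod => b /Ss_comm.
have StXs : St^f * Xs = Xs * St^f by apply: comm_prod => a /St_comm.
have StZs : St^f * (\prod_(a <- rev s) X a) = (\prod_(a <- rev s) X a) * St^f.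
  by apply: comm_prod => a; rewrite mem_rev => /St_comm.
have comm_f : Ss^f * St^f = St^f * Ss^f by rewrite -!mapM comm_Ss_St.
rewrite -(fused_split_l Xt comm_f StXs) -(fused_split_r (St^f) Xs SsXt).
rewrite -mapM.
have [R' [d [RR' R'R reg_d]]] : quasi_invertible reg (cross r s t).
  have q : reg 1 by move=> b; rewrite rmorph1 mul1r.
  apply: quasi_invertible_prod => // b; rewrite mem_rev => bt.
  by apply: quasi_invertible_prod => // a as_; apply: r_quasi_invertible.
(* Passing Ss through the cross product reverses s inside each column; passing St reverses the order
   of the columns. *)
pose L := \prod_(b <- t) cross_col r (rev s) b.
have [L' [d' [_ L'L reg_d']]] : quasi_invertible reg L.
  have q : reg 1 by move=> b; rewrite rmorph1 mul1r.
  apply: quasi_invertible_prod => // b bt.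
  by apply: quasi_invertible_prod => // a; rewrite mem_rev => as_; apply: r_quasi_invertible.
apply: (@fusion_trace _ _ phi K phi_central (St * Ss) (cross r s t) R' L L' (c2 * c1) d d'
   (Xs * Xt) (Xt * Xs) ((\prod_(a <- rev t) X a) * (\prod_(a <- rev s) X a))) => //.
- rewrite mulrA -(mulrA St Ss) comm_Ss_St mulrA sqr_t -mulrA sqr_s.
  by rewrite scalemxMl scalemxMr scalerA.
- rewrite -mulrA (full_cross_l us ls) => [|a b c as_ bs ct ab|a b c e as_ bs cs et ab ca cb].
  + rewrite !mulrA (@full_cross_r _ _ lt) // ?rev_uniq // => [a b c|a b c e|a b c e];
      rewrite ?mem_rev.
    * by move=> as_ bt ct; apply: yang_baxter; apply: st.
    * by move=> as_ et bt ct bc eb ec; apply: r_comm;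
        rewrite ?(st a e) ?(st_neq a b) ?(st_neq a c).
    * by move=> as_ bs ct et ab ce; apply: r_comm; rewrite ?st ?(st_neq a e) ?(ts_neq c b).
  + by apply: yang_baxter => //; apply: st.
  + by apply: r_comm; rewrite ?(st c e) ?(ts_neq e) //.
- have -> : (cross r s t)^f = cross (fun a b => (r a b)^f) s t by apply: cross_morph.
  rewrite !mulrA; apply: cross_exchange => // [a b as_ bt|a b c as_ bt _ ac bc];
    first exact/rX/st.
  by apply: rX_comm => //; apply: st.
- rewrite mapM; apply: fused_exchange => //; exact: exch.
- by apply: regM => //; apply: regM => //.
Qed.

End FusedTrace.

Lemma scalemx_cancel (C : comPzRingType) (e : C) n (M M' : 'M[C]_n) :
  (forall x y, e * x = e * y -> x = y) -> e *: M = e *: M' -> M = M'.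
Proof.
move=> ei /matrixP eM; apply/matrixP => i j; apply: ei.
by have := eM i j; rewrite !mxE.
Qed.

Lemma map_scale_cancel (F : fieldType) (D : pzRingType) (cst : {rmorphism F -> D}) n (e : F)
    (R : 'M[F]_n) (X Y : 'M[D]_n) : (forall a x, cst a * x = x * cst a) -> e != 0 ->
  map_mx cst (e *: R) * X = Y * map_mx cst (e *: R) -> map_mx cst R * X = Y * map_mx cst R.
Proof.
move=> cC e0.
have -> : map_mx cst (e *: R) * X = cst e *: (map_mx cst R * X).
  by rewrite map_mxZ -[LHS]/(_ *m _) -scalemxAl.
have -> : Y * map_mx cst (e *: R) = cst e *: (Y * map_mx cst R).
  rewrite map_mxZ; apply/matrixP => i j; rewrite !mxE mulr_sumr; apply: eq_bigr => k _.
  by rewrite !mxE !mulrA cC.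
move=> /(congr1 (fun M => cst e^-1 *: M)); rewrite !scalerA -rmorphM mulVf // rmorph1.
by rewrite !scale1r.
Qed.

Lemma transport_rtt (D B : pzRingType) (psi : {rmorphism D -> B}) N k m (f : 'I_k -> 'I_m)
    (a b : 'I_k) (R : 'M[D]_#|{ffun 'I_k -> 'I_N}|) (t1 t2 : 'M[D]_N) : injective f ->
  R * slot a t1 * slot b t2 = slot b t2 * slot a t1 * R ->
  map_mx psi (emb f R) * slot (f a) (map_mx psi t1) * slot (f b) (map_mx psi t2) =
  slot (f b) (map_mx psi t2) * slot (f a) (map_mx psi t1) * map_mx psi (emb f R).
Proof.
move=> fi /(congr1 (fun M => map_mx psi (emb f M))).
rewrite !(embM fi) !(emb_slot fi) !(slot_map _ _ (rmorph0 psi)).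
have mapM (M M' : 'M[D]_#|{ffun 'I_m -> 'I_N}|) : map_mx psi (M * M') = map_mx psi M * map_mx psi
  M'.
  exact: map_mxM.
by rewrite !mapM.
Qed.

(** * Two fused groups side by side *)

Section TwoFusedGroups.
Variables (F : numFieldType) (g : bcd_type) (N : nat).
Hypotheses (N_ge2 : (2 <= N)%N) (N_even : g = Symplectic -> ~~ odd N).
Variables (C : comPzRingType) (D B : pzRingType).
Variables (cv : {rmorphism F -> C}) (cst : {rmorphism F -> D}).
Variables (phi : {rmorphism C -> B}) (psi1 psi2 : {rmorphism D -> B}).
Hypothesis phi_central : forall c x, phi c * x = x * phi c.
Hypotheses (psi1_cst : forall a, psi1 (cst a) = phi (cv a))
  (psi2_cst : forall a, psi2 (cst a) = phi (cv a)).
Variable h : C.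
Hypothesis h_inj : forall x y, h * x = h * y -> x = y.
Hypothesis cv_inj : forall a x y, a != 0 -> cv a * x = cv a * y -> x = y.
Variables (m n : nat).
Hypotheses (m_le : g = Symplectic -> (m <= N./2)%N) (n_le : g = Symplectic -> (n <= N./2)%N).
Local Notation kap := (kappa F g N).
Variables (z1 : 'I_m -> C) (z2 : 'I_n -> C) (T1 : 'I_m -> 'M[D]_N) (T2 : 'I_n -> 'M[D]_N).
Hypothesis z1_sub : forall a b, z1 a - z1 b = h * cv (ubar F g a - ubar F g b).
Hypothesis z2_sub : forall a b, z2 a - z2 b = h * cv (ubar F g a - ubar F g b).
Hypothesis rtt1 : forall a b : 'I_m, (a < b)%N ->
  map_mx cst (Rubar F g N a b) * slot a (T1 a) * slot b (T1 b) =
  slot b (T1 b) * slot a (T1 a) * map_mx cst (Rubar F g N a b).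
Hypothesis rtt2 : forall a b : 'I_n, (a < b)%N ->
  map_mx cst (Rubar F g N a b) * slot a (T2 a) * slot b (T2 b) =
  slot b (T2 b) * slot a (T2 a) * map_mx cst (Rubar F g N a b).
Hypothesis rtt12 : forall a b,
  let t1 := slot (ord0 : 'I_2) (map_mx psi1 (T1 a)) in
  let t2 := slot (ord_max : 'I_2) (map_mx psi2 (T2 b)) in
  let R := map_mx phi (Rpol g N h (cv kap) (z1 a - z2 b) ord0 ord_max) in
  R * t1 * t2 = t2 * t1 * R.
Hypothesis reg12 : forall a b (x := z1 a - z2 b) y,
  phi ((x ^+ 2 - h ^+ 2) * (x ^+ 2 - (h * cv kap) ^+ 2)) * y = 0 -> y = 0.

Local Notation I := 'I_(m + n).
Local Notation K := #|{ffun I -> 'I_N}|.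
Local Notation Ru := (Rubar F g N).

(** C stands for scalar series in u, v and h, and D for series in one variable over the dual
    Yangian. The maps [psi1] and [psi2] read that variable as u or as v. *)
Definition joint_var (i : I) : C := match split i with inl a => z1 a | inr b => z2 b end.
Local Notation z := joint_var.
Local Notation Rp i j := (Rpol g N h (cv kap) (z i - z j) i j).

(* Within a group the parameters differ by multiples of h, so that Rpol has a
   factor h^2, which may be a zero divisor over the dual Yangian; joint_R is the
   quotient, up to a nonzero constant. *)
Definition joint_R (i j : I) : 'M[C]_K :=
  match split i, split j with
  | inl a, inl b => map_mx cv (emb (lshift n) (Ru a b))
  | inr a, inr b => map_mx cv (emb (@rshift m n) (Ru a b))
  | _, _ => Rp i j
  end.
Local Notation r := joint_R.

Definition joint_T (i : I) : 'M[B]_K :=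
  slot i (match split i with inl a => map_mx psi1 (T1 a) | inr b => map_mx psi2 (T2 b) end).
Local Notation X := joint_T.

Let splitl (a : 'I_m) : split (lshift n a) = inl a. Proof. exact: (unsplitK (inl a)). Qed.
Let splitr (b : 'I_n) : split (@rshift m n b) = inr b. Proof. exact: (unsplitK (inr b)). Qed.
Let li : injective (@lshift m n). Proof. exact: lshift_inj. Qed.
Let ri : injective (@rshift m n). Proof. exact: rshift_inj. Qed.

Lemma Rpol_group k (kle : g = Symplectic -> (k <= N./2)%N) (f : 'I_k -> I) (x : C) (a b : 'I_k) :
  injective f -> (a < b)%N ->
  x = h * cv (ubar F g a - ubar F g b) ->
  Rpol g N h (cv kap) x (f a) (f b) =
  (h * h * cv ((ubar F g a - ubar F g b) * (ubar F g a - ubar F g b - kap))) *: map_mx cv (emb f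
    (Ru a b)).
Proof.
move=> fi ab ->; rewrite Rpol_homogeneous -[in LHS](rmorph1 cv) -Rpol_map.
by rewrite -emb_Rpol // (Rubar_Rpol F N_ge2 N_even kle ab) embZ map_mxZ scalerA.
Qed.

(** The ratio is 1 between the groups and h^2 times a nonzero constant inside a group. Both can be
    cancelled in C, so [joint_R] inherits the Yang-Baxter equation and the commutation rules from
    [Rpol]. *)
Lemma joint_R_Rpol (i j : I) : (i < j)%N ->
  exists2 e, (forall x y, e * x = e * y -> x = y) & Rp i j = e *: r i j.
Proof.
have H d : d != 0 -> forall x y, h * h * cv d * x = h * h * cv d * y -> x = y.
  by move=> d0 x y; rewrite -!mulrA => /h_inj/h_inj/(cv_inj d0).
have one x y : 1 * x = 1 * y -> x = y :> C by rewrite !mul1r.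
rewrite /joint_R /joint_var; case: (split_ordP i) => a ->; case: (split_ordP j) => b ->;
  rewrite ?splitl ?splitr => ij.
- exists (h * h * cv ((ubar F g a - ubar F g b) * (ubar F g a - ubar F g b - kap))).
    by apply/H/(Rubar_factor_neq0 F N_ge2 N_even m_le).
  exact: Rpol_group.
- by exists 1; rewrite // scale1r.
- by exists 1; rewrite // scale1r.
- have ab : (a < b)%N by move: ij; rewrite /= ltn_add2l.
  exists (h * h * cv ((ubar F g a - ubar F g b) * (ubar F g a - ubar F g b - kap))).
    by apply/H/(Rubar_factor_neq0 F N_ge2 N_even n_le).
  exact: Rpol_group.
Qed.

Lemma cv_kappa : N%:R = cv kap + cv kap + bcd_sign C g + bcd_sign C g.
Proof.
rewrite -(rmorph_nat cv) (kappa_sign F g N) !rmorphD.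
by congr (_ + _ + _ + _); rewrite /bcd_sign; case: g; rewrite ?rmorphN rmorph1.
Qed.

Lemma joint_R_yang_baxter (i j k : I) : (i < j)%N -> (j < k)%N ->
  r i j * r i k * r j k = r j k * r i k * r i j.
Proof.
move=> ij jk; have ik := ltn_trans ij jk.
have nij : i != j by rewrite neq_ltn ij. have njk : j != k by rewrite neq_ltn jk.
have nik : i != k by rewrite neq_ltn ik.
have [e1 i1 E1] := joint_R_Rpol ij; have [e2 i2 E2] := joint_R_Rpol ik.
have [e3 i3 E3] := joint_R_Rpol jk.
have := Rpol_yang_baxter N_even h cv_kappa (z i - z j) (z j - z k) nij njk nik.
rewrite [z i - z j + _]addrA subrK E1 E2 E3; move: (r i j) (r i k) (r j k) => A1 A2 A3.
rewrite !scale_mul3.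
rewrite [X in _ = X *: _ -> _](_ : _ = e1 * e2 * e3); last by ring.
by apply: scalemx_cancel => x y; rewrite -!mulrA => /i1/i2/i3.
Qed.

Lemma joint_R_comm (i j k l : I) : (i < j)%N -> (k < l)%N -> i != k -> i != l -> j != k -> j != l
  ->
  GRing.comm (r i j) (r k l).
Proof.
move=> ij kl ik il jk jl.
have [e1 i1 E1] := joint_R_Rpol ij; have [e2 i2 E2] := joint_R_Rpol kl.
have := @Rpol_comm C g N _ h (cv kap) i j k l (z i - z j) (z k - z l) ik il jk jl.
rewrite /GRing.comm E1 E2; move: (r i j) (r k l) => A1 A2.
rewrite !scale_mul2 (mulrC e2).
by apply: scalemx_cancel => x y; rewrite -!mulrA => /i1/i2.
Qed.

Lemma map_emb_cst psi k (f : 'I_k -> I) (M : 'M[F]_#|{ffun 'I_k -> 'I_N}|) :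
  (forall a, psi (cst a) = phi (cv a)) ->
  map_mx phi (map_mx cv (emb f M)) = map_mx psi (emb f (map_mx cst M)).
Proof. by move=> E; rewrite emb_map -!map_mx_comp; apply: eq_map_mx => x /=. Qed.

(** This relation lives over B, where the factor h^2 must not be cancelled. Inside a group it
    therefore comes from [rtt1] or [rtt2], which are already free of h, and between the groups from
    [rtt12]. *)
Lemma joint_rtt (i j : I) : (i < j)%N ->
  map_mx phi (r i j) * X i * X j = X j * X i * map_mx phi (r i j).
Proof.
rewrite /joint_R /joint_T /joint_var; case: (split_ordP i) => a ->;
  case: (split_ordP j) => b ->; rewrite ?splitl ?splitr => ij.
- by rewrite (map_emb_cst _ _ psi1_cst); apply: transport_rtt => //; apply: rtt1.
- have ne : lshift n a != @rshift m n b by rewrite neq_ltn ij.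
  have ti := two_slots_inj ne.
  have := congr1 (emb (two_slots (lshift n a) (@rshift m n b))) (rtt12 a b).
  by rewrite /= !(embM ti) !(emb_slot ti) emb_map emb_Rpol //.
(* The indices of the second group are larger, so this case contradicts i < j. *)
- by have := ltn_ord b; rewrite ltnNge (leq_trans (leq_addr a m) (ltnW ij)).
- rewrite (map_emb_cst _ _ psi2_cst); apply: transport_rtt => //; apply: rtt2.
  by move: ij; rewrite /= ltn_add2l.
Qed.

Lemma Rubar_map_comm k (f : 'I_k -> I) (fi : injective f) (a b : 'I_k) c (Z : 'M[B]_N) : f a != c
  -> f b != c ->
  GRing.comm (map_mx phi (map_mx cv (emb f (Ru a b)))) (slot c Z).
Proof.
move=> ac bc; rewrite /Rubar -scaleNr; set e1 := - _; set e2 := _^-1.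
have -> : map_mx cv (emb f (1%:M + e1 *: Pmx F N a b + e2 *: Qmx F g N a b)) =
    1 *: 1%:M + cv e1 *: Pmx C N (f a) (f b) + cv e2 *: Qmx C g N (f a) (f b).
  rewrite !raddfD /= !embZ emb_Pmx // emb_Qmx // -[1%:M]/(1 : 'M[F]_#|{ffun 'I_k -> 'I_N}|).
  rewrite emb1 -[X in map_mx cv X]/(1%:M) scale1r.
  by rewrite !map_mxZ Pmx_map Qmx_map map_mx1.
by apply: linear_map_comm => //; [apply: Pmx_map_comm | apply: Qmx_map_comm].
Qed.

Lemma joint_R_slot_comm (i j k : I) : (i < j)%N -> i != k -> j != k ->
  GRing.comm (map_mx phi (r i j)) (X k).
Proof.
rewrite /joint_R {1}/joint_T; case: (split_ordP i) => a ->; case: (split_ordP j) => b ->;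
  rewrite ?splitl ?splitr => ij ik jk.
- exact: Rubar_map_comm.
- exact: Rpol_map_comm.
- exact: Rpol_map_comm.
- exact: Rubar_map_comm.
Qed.

Section JointLists.
Variables (k : nat) (f : 'I_k -> I) (T : 'I_k -> 'M[D]_N) (psi : {rmorphism D -> B}).
Hypothesis f_inj : injective f.
Hypothesis psi_cst : forall a, psi (cst a) = phi (cv a).
Hypothesis r_f : forall a b, r (f a) (f b) = map_mx cv (emb f (Ru a b)).
Hypothesis X_f : forall a, X (f a) = slot (f a) (map_mx psi (T a)).

Lemma joint_full_image : full r (map f (enum 'I_k)) = map_mx cv (emb f (full (Ru (m := k)) (enum
  'I_k))).
Proof.
rewrite full_map (eq_full _ r_f).
apply/esym/(full_morph (f := fun M : 'M[F]_#|{ffun 'I_k -> 'I_N}| => map_mx cv (emb f M))).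
  by rewrite emb1 -[X in map_mx cv X]/(1%:M) map_mx1.
by move=> M M' /=; rewrite embM //; apply: map_mxM.
Qed.

Lemma joint_full_sqr : (g = Symplectic -> (k <= N./2)%N) -> exists2 c, (forall x, phi c * x = 0
  -> x = 0) &
  full r (map f (enum 'I_k)) * full r (map f (enum 'I_k)) = c *: full r (map f (enum 'I_k)).
Proof.
move=> kle; have [c c0 e] := full_Rubar_sqr F N_ge2 N_even kle.
exists (cv c).
  move=> x; apply: (@left_inverse_regular _ _ (phi (cv c^-1))).
  by rewrite -!rmorphM mulVf // !rmorph1.
rewrite joint_full_image -map_mxZ -embZ -e embM //.
by apply/esym/map_mxM.
Qed.

Lemma joint_group_image :
  map_mx phi (full r (map f (enum 'I_k))) * \prod_(a <- map f (enum 'I_k)) X a =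
  map_mx psi (emb f (map_mx cst (full (Ru (m := k)) (enum 'I_k)) * \prod_(a <- enum 'I_k) slot a
    (T a))).
Proof.
rewrite joint_full_image (map_emb_cst _ _ psi_cst) embM //.
apply: etrans (esym (map_mxM psi _ _)); congr (_ * _); rewrite big_map.
rewrite (prod_morph (f := fun M : 'M[D]_#|{ffun 'I_k -> 'I_N}| => map_mx psi (emb f M))).
- by apply: eq_bigr => a _; rewrite X_f emb_slot // slot_map ?rmorph0.
- by rewrite emb1 -[X in map_mx psi X]/(1%:M) map_mx1.
- by move=> M M' /=; rewrite embM //; apply: map_mxM.
Qed.

End JointLists.

(** The trace over all m + n factors is multiplicative over the two groups, which turns
    [fused_trace_comm] into commutation of the separate traces. *)
Lemma fused_groups_trace_comm
    (W1 := map_mx cst (full (Ru (m := m)) (enum 'I_m)) * \prod_(a <- enum 'I_m) slot a (T1 a))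
    (W2 := map_mx cst (full (Ru (m := n)) (enum 'I_n)) * \prod_(b <- enum 'I_n) slot b (T2 b)) :
  psi1 (\tr W1) * psi2 (\tr W2) = psi2 (\tr W2) * psi1 (\tr W1).
Proof.
pose s := map (@lshift m n) (enum 'I_m); pose t := map (@rshift m n) (enum 'I_n).
pose lt : rel I := fun i j => (i < j)%N.
have lt_irr i j : lt i j -> i != j by move=> ij; rewrite neq_ltn [(i < j)%N]ij.
have st_lt : pairwise lt (s ++ t).
  rewrite pairwise_cat (pairwise_map (@lshift m n)) (pairwise_map (@rshift m n)); apply/and3P;
    split.
  - apply/allrelP => _ _ /mapP[a _ ->] /mapP[b _ ->].
    by rewrite /lt /= (leq_trans (ltn_ord a)) // leq_addr.
  - by apply: sub_pairwise (enum_ord_pairwise m) => a b.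
  - apply: sub_pairwise (enum_ord_pairwise n) => a b ab.
    by rewrite /lt /= ltn_add2l.
have st_uniq : uniq (s ++ t) by rewrite uniq_pairwise; apply: sub_pairwise st_lt => i j /lt_irr.
have rl a b : r (lshift n a) (lshift n b) = map_mx cv (emb (lshift n) (Ru a b)).
  by rewrite /joint_R !splitl.
have rr a b : r (@rshift m n a) (@rshift m n b) = map_mx cv (emb (@rshift m n) (Ru a b)).
  by rewrite /joint_R !splitr.
have Xl a : X (lshift n a) = slot (lshift n a) (map_mx psi1 (T1 a)) by rewrite /joint_T splitl.
have Xr a : X (@rshift m n a) = slot (@rshift m n a) (map_mx psi2 (T2 a)) by rewrite /joint_T
  splitr.
have [c1 reg1 sq1] := joint_full_sqr li rl m_le.
have [c2 reg2 sq2] := joint_full_sqr ri rr n_le.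
have := @fused_trace_comm C B phi K phi_central _ lt r X s t st_uniq st_lt lt_irr
  joint_R_yang_baxter joint_R_comm joint_rtt (fun i j k => @joint_R_slot_comm i j k)
  _ c1 c2 sq1 sq2 reg1 reg2.
rewrite (joint_group_image li psi1_cst rl Xl) (joint_group_image ri psi2_cst rr Xr).
rewrite -/W1 -/W2 -!emb_map.
rewrite (@tr_emb_emb _ _ _ _ _ (lshift n) (@rshift m n) split splitl splitr); last exact: splitK.
(* In the product taken in the other order the second group comes first, so the splitting is used
   with its two sides exchanged. *)
pose sw c := match split c with inl a => inr a | inr b => inl b end : 'I_n + 'I_m.
rewrite (@tr_emb_emb _ _ _ _ _ (@rshift m n) (lshift n) sw).
- rewrite !trace_map_mx; apply=> i j /mapP[a _ ->] /mapP[b _ ->].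
  (* The quasi-inverse of R(x) is R(-x), with the scalar of [Rpol_unitarity]. *)
  exists (Rpol g N h (cv kap) (- (z1 a - z2 b)) (lshift n a) (@rshift m n b)).
  exists (((z1 a - z2 b) ^+ 2 - h ^+ 2) * ((z1 a - z2 b) ^+ 2 - (h * cv kap) ^+ 2)).
  have ne : lshift n a != @rshift m n b by rewrite eq_lrshift.
  have -> : r (lshift n a) (rshift m b) = Rpol g N h (cv kap) (z1 a - z2 b) (lshift n a) (@rshift
    m n b).
    by rewrite /joint_R /joint_var splitl splitr.
  split; last exact: reg12.
    by rewrite (Rpol_unitarity N_even _ cv_kappa) // scalemx1.
  rewrite -{2}[z1 a - z2 b]opprK (Rpol_unitarity N_even _ cv_kappa) // scalemx1.
  by congr (_%:M); rewrite !sqrrN.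
- by move=> b; rewrite /sw splitr.
- by move=> a; rewrite /sw splitl.
- by move=> c; rewrite /sw -[RHS](splitK c); case: (split c).
Qed.

End TwoFusedGroups.

Lemma central_factors_comm (Y : pzRingType) (c c' : Y) (x y : {fps Y}) p q :
  (forall z, c * z = z * c) -> (forall z, c' * z = z * c') -> x p * y q = y q * x p ->
  (fpsC c * x) p * (fpsC c' * y) q = (fpsC c' * y) q * (fpsC c * x) p.
Proof.
rewrite !fpsC_mulE; move: (x p) (y q) => {}x {}y cC cC' xy.
rewrite [LHS]mulrA -(cC' (c * x)) -[LHS]mulrA -[RHS]mulrA; congr (_ * _).
by rewrite mulrA -(cC y) -!mulrA xy.
Qed.

Section TwoSlotRtt.
Variables (F : numFieldType) (g : bcd_type) (N : nat) (D : pzRingType) (cst : {rmorphism F -> D}).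
Hypotheses (N_ge2 : (2 <= N)%N) (N_even : g = Symplectic -> ~~ odd N).
Hypothesis cst_central : forall a x, cst a * x = x * cst a.

(** The diagonal relation on two factors is embedded at the factors a and b and divided by the
    constant of [Rubar_Rpol], nonzero under the bound on m. *)
Lemma two_slot_rtt m (a b : 'I_m) (t1 t2 : 'M[D]_N) (d := ubar F g a - ubar F g b) :
  (g = Symplectic -> (m <= N./2)%N) -> (a < b)%N ->
  map_mx cst (Rpol g N 1 (kappa F g N) d ord0 ord_max) * slot (ord0 : 'I_2) t1 * slot ord_max t2 =
  slot ord_max t2 * slot ord0 t1 * map_mx cst (Rpol g N 1 (kappa F g N) d ord0 ord_max) ->
  map_mx cst (Rubar F g N a b) * slot a t1 * slot b t2 =
  slot b t2 * slot a t1 * map_mx cst (Rubar F g N a b).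
Proof.
move=> m_le ab /(congr1 (emb (two_slots a b))).
have ti : injective (two_slots a b) by apply: two_slots_inj; rewrite neq_ltn ab.
rewrite !(embM ti) !(emb_slot ti) !emb_map !emb_Rpol //.
rewrite ![two_slots _ _ _]/= (Rubar_Rpol F N_ge2 N_even m_le ab) -!mulrA => e.
rewrite [RHS]mulrA; apply: map_scale_cancel cst_central (Rubar_factor_neq0 F N_ge2 N_even m_le
  ab) _.
by rewrite e mulrA.
Qed.

End TwoSlotRtt.

Lemma trace_map_scale (C D : pzRingType) (cst : {rmorphism C -> D}) n c (M : 'M[C]_n) (Z :
  'M[D]_n) :
  \tr (map_mx cst (c *: M) *m Z) = cst c * \tr (map_mx cst M * Z).
Proof. by rewrite map_mxZ -scalemxAl mxtraceZ. Qed.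

Section TransferSeriesComm.
Variables (F : numFieldType) (g : bcd_type) (N : nat).
Hypotheses (N_ge2 : (2 <= N)%N) (N_even : g = Symplectic -> ~~ odd N).
Local Notation Y := (dualYangian F g N).

Definition fused_trace m : {fps Y} :=
  \tr (map_mx (@dy_cst F g N) (full (Rubar F g N (m := m)) (enum 'I_m)) *
       \prod_(a <- enum 'I_m) slot a (Tplus_at g N (ubar F g a))).

Lemma fpsC_dy_cst (a : F) : fpsC (dy_cst g N a) = dy_scal2 g N (cvar a).
Proof.
apply/esym; apply: etrans (fps_mapC _ _) _; congr fpsC.
exact: fps_mapC.
Qed.

Lemma fps_map_dy_cst (a : F) : fps_map (@fpsC _) (dy_cst g N a) = dy_scal2 g N (cvar a).
Proof. by rewrite -fpsC_dy_cst; exact: fps_mapC. Qed.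

Lemma fused_trace_series_comm m n : (g = Symplectic -> (m <= N./2)%N) -> (g = Symplectic -> (n <=
  N./2)%N) ->
  fpsC (fused_trace m) * fps_map (@fpsC _) (fused_trace n) =
  fps_map (@fpsC _) (fused_trace n) * fpsC (fused_trace m).
Proof.
move=> m_le n_le.
apply: (@fused_groups_trace_comm F g N N_ge2 N_even {fps {fps {fps F}}} {fps Y} {fps {fps Y}}
  (@cvar F) (@dy_cst F g N) (@dy_scal2 F g N) (@fpsC {fps Y}) (fps_map (@fpsC Y))
  (@dy_scal2_central F g N) fpsC_dy_cst fps_map_dy_cst (hvar F) (@hvar_inj F) (@cvar_inj F) m n
  m_le n_le (fun a => uvar (ubar F g a)) (fun b => vvar (ubar F g b))
  (fun a => Tplus_at g N (ubar F g a)) (fun b => Tplus_at g N (ubar F g b))).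
- by move=> a b; apply: uvar_sub.
- by move=> a b; apply: vvar_sub.
- move=> a b ab; apply: (two_slot_rtt N_ge2 N_even (@dy_cst_central F g N) m_le ab).
  exact: dy_rtt_diagonal.
- move=> a b ab; apply: (two_slot_rtt N_ge2 N_even (@dy_cst_central F g N) n_le ab).
  exact: dy_rtt_diagonal.
- by move=> a b; apply: dy_rtt_cross.
- by move=> a b; apply: regular_Rpol.
Qed.

(** The coefficient at outer exponent p and inner exponent q isolates one coefficient of each
    series. *)
Lemma fps_separate_comm (A : pzRingType) (x y : {fps A}) p q :
  fpsC x * fps_map (@fpsC A) y = fps_map (@fpsC A) y * fpsC x -> x q * y p = y p * x q.
Proof.
move=> /(congr1 (fun f : {fps {fps A}} => f p q)).
by rewrite fpsC_mulE (mul_fpsCE x) -![fps_map _ _ _]/(fpsC (y p)) mul_fpsCE fpsC_mulE.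
Qed.

Lemma TTplusE m : TTplus F g N m = dy_cst g N (m`!%:R)^-1 * fused_trace m.
Proof.
rewrite /TTplus /Smx prod_full; apply: etrans (trace_map_scale (@dy_cst F g N) _ _ _) _.
have ie : index_enum 'I_m = enum 'I_m by rewrite [index_enum _]unlock enumT.
by rewrite ie.
Qed.
End TransferSeriesComm.

(** * The subalgebra generated by commuting elements *)

Definition commutant (A : pzRingType) (S : set A) : set A := [set x | forall y, S y -> x * y = y
  * x].

Lemma commutant_subring (A : pzRingType) (S : set A) : GRing.subring_closed [pred x | x \in
  commutant S].
Proof.
split=> [|x y|x y]; rewrite !inE.
- by move=> z _; rewrite mul1r mulr1.
- by move=> cx cy z Sz; rewrite mulrBl mulrBr cx // cy.
- by move=> cx cy z Sz; rewrite -mulrA cy // mulrA cx // mulrA.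
Qed.

Section GeneratedSubalgebra.
Variables (F : fieldType) (g : bcd_type) (N : nat).
Local Notation Y := (dualYangian F g N).
Implicit Types (S G : set Y) (x y : Y).

Lemma dy_scalar_central c y : dy_scalar g N c * y = y * dy_scalar g N c.
Proof. exact: (scal_central (@dy_io_central F N) (@dy_pr_surj F g N) c y). Qed.

(** The commutant of S is a subring containing the central scalars, so it contains the subalgebra
    generated by G as soon as it contains G. *)
Lemma gen_subalgebra_sub_commutant G S : (forall x y, G x -> S y -> x * y = y * x) ->
  forall x y, gen_subalgebra G x -> S y -> x * y = y * x.
Proof.
move=> GS x y /(_ (commutant S)) Gx; apply: Gx; split; last by move=> z Gz w; apply: GS.
split; first exact: commutant_subring.
by move=> c z _; apply: dy_scalar_central.
Qed.

(** The commutant argument is used twice: for the generators against the subalgebra, then for the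
    subalgebra against itself. *)
Lemma gen_subalgebra_comm G : (forall x y, G x -> G y -> x * y = y * x) ->
  forall x y, gen_subalgebra G x -> gen_subalgebra G y -> x * y = y * x.
Proof.
move=> GG; apply: gen_subalgebra_sub_commutant => x y Gx Gy.
by apply/esym/(gen_subalgebra_sub_commutant GG Gy).
Qed.

End GeneratedSubalgebra.

Lemma TTcoefs_comm (F : numFieldType) (g : bcd_type) (N : nat) (x y : dualYangian F g N) :
  (2 <= N)%N -> (g = Symplectic -> ~~ odd N) ->
  TTcoefs F g N x -> TTcoefs F g N y -> x * y = y * x.
Proof.
move=> N_ge2 N_even [m [p [m_range ->]]] [n [q [n_range ->]]].
have rangeW k : (1 <= k <= match g with Orthogonal => N | Symplectic => N./2 end)%N ->
    g = Symplectic -> (k <= N./2)%N by move=> /andP[_ k_le] gE; rewrite gE in k_le.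
have tau_comm :=
  fps_separate_comm q p (fused_trace_series_comm F N_ge2 N_even (rangeW m m_range) (rangeW n
    n_range)).
rewrite !TTplusE.
exact: central_factors_comm (dy_scalar_central _) (dy_scalar_central _) tau_comm.
Qed.

Theorem corollary2p11 (R : realType) (g : bcd_type) (N : nat)
    (N_ge2 : (2 <= N)%N) (N_even : g = Symplectic -> ~~ odd N)
    (x y : dualYangian R[i] g N) :
  gen_subalgebra (TTcoefs R[i] g N) x -> gen_subalgebra (TTcoefs R[i] g N) y ->
  x * y = y * x.
Proof.
apply: gen_subalgebra_comm => u v; exact: (@TTcoefs_comm R[i] g N u v N_ge2 N_even).
Qed.
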